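(* Let $d\ge1$, $T>0$, and let $\beta:\mathbb{R}\to\mathbb{R}$ and $b=(b^1,\dots,b^d):\mathbb{R}^d\times\mathbb{R}\to\mathbb{R}^d$ satisfy: (i) $\beta(0)=0$, $\beta\in C^1(\mathbb{R})$, and there is $0<\gamma_0<\infty$ with $\gamma_0|r_1-r_2|^2\le(\beta(r_1)-\beta(r_2))(r_1-r_2)$ for all $r_1,r_2\in\mathbb{R}$; (ii) for every $i$, $b^i\in C_b(\mathbb{R}^d\times\mathbb{R})\cap C^1(\mathbb{R}^d\times\mathbb{R})$, $b^i(x,0)=0$ for all $x\in\mathbb{R}^d$; for every $M>0$ there is $C_M<\infty$ with $\sup\{|\partial_r b^i(x,r)|: x\in\mathbb{R}^d,\ |r|\le M\}\le C_M$ for all $i$; and the function $\delta(r):=\sup\{|\nabla_x b(x,r)|: x\in\mathbb{R}^d\}$ belongs to $C_b(\mathbb{R})$. Then for each $u_0\in L^\infty(\mathbb{R}^d)\cap L^1(\mathbb{R}^d)$, the nonlinear Fokker–Planck equation $$u_t-\Delta\beta(u)+\operatorname{div}(b(x,u)u)=0 \text{ in } \mathcal{D}'((0,\infty)\times\mathbb{R}^d),\qquad u(0,x)=u_0(x),$$ has at most one distributional solution $u$ with $u\in L^\infty((0,T);L^1(\mathbb{R}^d))\cap L^\infty((0,T)\times\mathbb{R}^d)$.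
   Context: A distributional solution with initial condition $u_0\in L^1(\mathbb{R}^d)$ is a function $u:[0,\infty)\to L^1(\mathbb{R}^d)$ such that: $t\mapsto u(t,x)\,dx$ is narrowly continuous, i.e. $\lim_{t\to s}\int_{\mathbb{R}^d}u(t,x)\psi(x)\,dx=\int_{\mathbb{R}^d}u(s,x)\psi(x)\,dx$ for all $\psi\in C_b(\mathbb{R}^d)$ and $s\ge0$; for all $\varphi\in C_0^\infty((0,\infty)\times\mathbb{R}^d)$, $$\int_0^\infty\int_{\mathbb{R}^d}\big(u\varphi_t+\beta(u)\Delta\varphi+b(x,u)u\cdot\nabla_x\varphi\big)\,dx\,dt=0;$$ and $u(0,x)=u_0(x)$ for a.e. $x\in\mathbb{R}^d$. Here $C_b$ denotes continuous bounded functions, $|\cdot|$ the Euclidean norm. *)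

(* Defs.v *)
From HB Require Import structures.
From mathcomp Require Import all_boot all_order all_algebra.
From mathcomp Require Import all_classical all_reals all_analysis.
Set Implicit Arguments. Unset Strict Implicit. Unset Printing Implicit Defensive.
Import Order.TTheory GRing.Theory Num.Theory.
Import numFieldNormedType.Exports.
Local Open Scope classical_set_scope.
Local Open Scope ring_scope.

Record mspace (R : realType) := MSpace {
  md : measure_display;
  mT : measurableType md;
  mmu : {measure set mT -> \bar R} }.

Fixpoint lebn (R : realType) (n : nat) : mspace R :=
  match n with
  | 0 => @MSpace R _ unit (@dirac _ unit tt R)
  | n'.+1 => @MSpace R _ _
      ((mmu (lebn R n') \x @lebesgue_measure R)%E : {measure set _ -> \bar R})
  end.

Fixpoint fromcoord (R : realType) (n : nat) : mT (lebn R n) -> 'rV[R]_n :=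
  match n return mT (lebn R n) -> 'rV[R]_n with
  | 0 => fun _ => 0
  | n'.+1 => fun p => \row_(j < n'.+1)
      match unlift ord_max j with
      | Some k => @fromcoord R n' p.1 0 k
      | None => p.2
      end
  end.

Definition lebtx (R : realType) (d : nat) :=
  (@lebesgue_measure R \x^ mmu (lebn R d))%E.

Section Rd.
Variables (R : realType) (d : nat).
Local Notation V := 'rV[R]_d.
Local Notation Ld := (mmu (lebn R d)).
Local Notation Ltx := (@lebtx R d).

Definition intRd (f : V -> \bar R) : \bar R :=
  (\int[Ld]_p f (fromcoord p))%E.
Definition measRd (f : V -> R) : Prop :=
  measurable_fun [set: mT (lebn R d)] (fun p => f (fromcoord p)).
Definition integrableRd (f : V -> R) : Prop :=
  Ld.-integrable [set: mT (lebn R d)] (fun p => (f (fromcoord p))%:E).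
Definition aeRd (P : V -> Prop) : Prop :=
  {ae Ld, forall p, P (fromcoord p)}.

Definition intRRd (f : R -> V -> \bar R) : \bar R :=
  (\int[Ltx]_p f p.1 (fromcoord p.2))%E.
Definition integrableRRd (f : R -> V -> R) : Prop :=
  Ltx.-integrable [set: _] (fun p => (f p.1 (fromcoord p.2))%:E).

Definition pd (k : option 'I_d) (f : R -> V -> R) : R -> V -> R :=
  match k with
  | None => fun t x => derive1 (fun s => f s x) t
  | Some j => fun t x => derive1 (fun h : R => f t (x + h *: delta_mx 0 j)) 0
  end.
Definition pderivable (k : option 'I_d) (f : R -> V -> R) (t : R) (x : V) : Prop :=
  match k with
  | None => derivable (fun s : R => f s x) t 1
  | Some j => derivable (fun h : R => f t (x + h *: delta_mx 0 j)) 0 1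
  end.
Fixpoint iterpd (s : seq (option 'I_d)) (f : R -> V -> R) : R -> V -> R :=
  match s with
  | [::] => f
  | k :: s' => pd k (iterpd s' f)
  end.

Definition C1 (f : R -> V -> R) : Prop :=
  continuous (fun p : R * V => f p.1 p.2) /\
  forall k, (forall t x, pderivable k f t x) /\
            continuous (fun p : R * V => pd k f p.1 p.2).
Definition Cinf (f : R -> V -> R) : Prop :=
  forall s, continuous (fun p : R * V => iterpd s f p.1 p.2) /\
            forall k t x, pderivable k (iterpd s f) t x.
Definition test_fun (phi : R -> V -> R) : Prop :=
  Cinf phi /\
  exists K : set (R * V), [/\ compact K, K `<=` [set p | 0 < p.1] &
                              forall p, ~ K p -> phi p.1 p.2 = 0].

Definition laplacian (phi : R -> V -> R) t x : R :=
  \sum_(j < d) pd (Some j) (pd (Some j) phi) t x.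

(* u : [0,oo) -> L^1(R^d), represented as u : R -> R^d -> R            *)
(* (values at t < 0 are irrelevant)                                    *)
Definition NFPE_integrand (beta : R -> R) (b : V -> R -> 'rV[R]_d)
  (u : R -> V -> R) (phi : R -> V -> R) : seq (R -> V -> R) :=
  [:: (fun t x => u t x * pd None phi t x);
      (fun t x => beta (u t x) * laplacian phi t x);
      (fun t x => \sum_(i < d) b x (u t x) 0 i * u t x * pd (Some i) phi t x)].

Definition distr_solution (beta : R -> R) (b : V -> R -> 'rV[R]_d)
  (u0 : V -> R) (u : R -> V -> R) : Prop :=
  [/\
      (forall t, 0 <= t -> measRd (u t) /\ integrableRd (u t)),
      (forall psi : V -> R, continuous psi -> (exists C, forall x, `|psi x| <= C) ->
        forall s : R, 0 <= s ->
        (fun t => intRd (fun x => (u t x * psi x)%:E))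
          @ within [set t : R | 0 <= t] (nbhs s)
          --> intRd (fun x => (u s x * psi x)%:E)),
      (forall phi, test_fun phi ->
         (forall g, g \in NFPE_integrand beta b u phi -> integrableRRd g) /\
         intRRd (fun t x => (\sum_(g <- NFPE_integrand beta b u phi) g t x)%:E) = 0%E)
    &
      aeRd (fun x => u 0 x = u0 x)].

Definition sol_class (T : R) (u : R -> V -> R) : Prop :=
  [/\ exists C : R, {ae @lebesgue_measure R, forall t, 0 < t < T ->
                      (intRd (fun x => (`|u t x|)%:E) <= C%:E)%E},
      measurable_fun [set p : _ * mT (lebn R d) | 0 < p.1 < T]
                     (fun p => u p.1 (fromcoord p.2))
    & exists M : R, {ae Ltx, forall p, 0 < p.1 < T ->
                      `|u p.1 (fromcoord p.2)| <= M}].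

Definition jac_norm (b : V -> R -> 'rV[R]_d) (x : V) (r : R) : R :=
  Num.sqrt (\sum_(i < d) \sum_(j < d)
     (pd (Some j) (fun r' x' => b x' r' 0 i) r x) ^+ 2).
Definition delta_b (b : V -> R -> 'rV[R]_d) (r : R) : R :=
  sup [set jac_norm b x r | x in [set: V]].

End Rd.

(* Main.v *)
(* Let z = u1 - u2, let w be the difference of the beta(u_i) and B that of the fluxes b(x,u_i) u_i,
   so that |w|, |B| <= L |z| and gamma z^2 <= w z. Testing the equation with localized plane waves
   theta(t) cos(xi.x + a), removing the localization, and letting theta tend to the indicator of
   [0,t] gives the transforms of z as primitives in time: z^_t = int_0^t (-|xi|^2 w^ + i xi.B^) ds
   in real form.

   The energy is a regularized H^-1 norm, E_m(t) = int W_m (1 + |xi|^2)^-1 |z^_t|^2 dxi, where W_m is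
   a product of Laplace weights exp(-e|xi_j|)/(2 pi) with e = 1/(m+1). The Fourier transform of W_m
   is a Poisson kernel P_m, so int W_m f^ conj(g^) = int int f(x) g(y) P_m(x,y) equals <f,g> up to
   Dirichlet forms of P_m, which vanish as m -> oo. This replaces Plancherel's theorem: the term
   -|xi|^2/(1+|xi|^2) w^ conj(z^) contributes at most -gamma |z|_2^2 + C E_m + o(1), and Young's
   inequality absorbs the fluxes. Gronwall's lemma gives E_m(t) -> 0, while E_m increases with m, so
   z^ = 0. The same Poisson kernels show that the transform is injective on L^1. *)
Require Import Defs.
From HB Require Import structures.
From mathcomp Require Import all_boot all_order all_algebra.
From mathcomp Require Import all_classical all_reals all_analysis measurable_realfun.
From mathcomp Require Import lra ring.
Import Order.TTheory GRing.Theory Num.Theory.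
Import numFieldNormedType.Exports.
Local Open Scope classical_set_scope.
Local Open Scope ring_scope.
Set Implicit Arguments.
Unset Strict Implicit.
Unset Printing Implicit Defensive.

(** * Real-valued integrals *)

(** The solutions are controlled only for almost every time and point, while the conclusion is for
    every t. Each [u] is therefore replaced by a truncation [U] that obeys the bounds everywhere, so
    that its transforms exist at every time; narrow continuity makes the transforms of the original
    solutions continuous in t, and this carries the identities from almost every time back to every
    t.

    The energy is never differentiated in time: the square of a primitive over [0,t] is a double
    integral that splits along the diagonal, and Gronwall's lemma is proved for inequalities valid
    almost everywhere. The factor (1 + |xi|^2)^-1 compensates the growth of the right-hand side, and
    W_m supplies the integrability in xi that bounded transforms lack. The Dirichlet forms are at
    most 4 |f|_2^2 uniformly in m, so their vanishing at each time passes to the time integral by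
    dominated convergence. The Young parameter is gamma / ((d+1)(L^2+1)), one share for w and one
    for each flux component, so that the positive terms never exceed gamma |z|_2^2. *)

Notation integrable1 mu f := (integrable mu setT (EFin \o f)).

Section real_integral.
Context d (X : measurableType d) (R : realType) (mu : {measure set X -> \bar R}).
Implicit Types f g h : X -> R.

Lemma integrable1_meas f : integrable1 mu f -> measurable_fun setT f.
Proof. by move=> /measurable_int/measurable_EFinP. Qed.

Lemma integrable1_dom f g : measurable_fun setT f -> (forall x, `|f x| <= g x) ->
  integrable1 mu g -> integrable1 mu f.
Proof.
move=> mf fg; apply: le_integrable => //; first exact/measurable_EFinP.
by move=> x _ /=; rewrite lee_fin (le_trans (fg x)) // ler_norm.
Qed.

Lemma integrable1D f g : integrable1 mu f -> integrable1 mu g ->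
  integrable1 mu (fun x => f x + g x).
Proof.
move=> fi gi; have := integrableD measurableT fi gi; apply: eq_integrable => //.
Qed.

Lemma integrable1B f g : integrable1 mu f -> integrable1 mu g ->
  integrable1 mu (fun x => f x - g x).
Proof.
move=> fi gi; have := integrableB measurableT fi gi; apply: eq_integrable => //.
Qed.

Lemma integrable1Z c f : integrable1 mu f -> integrable1 mu (fun x => c * f x).
Proof.
move=> fi; have := integrableZl measurableT c fi; apply: eq_integrable => //.
Qed.

Lemma integrable1N f : integrable1 mu f -> integrable1 mu (fun x => - f x).
Proof.
move=> fi; have := integrableN fi; apply: eq_integrable => //.
Qed.

Lemma integrable1_norm f : integrable1 mu f -> integrable1 mu (fun x => `|f x|).
Proof. by move=> fi; have := integrable_norm fi; exact. Qed.

Lemma integrable1_sum (I : Type) (s : seq I) (F : I -> X -> R) :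
  (forall i, integrable1 mu (F i)) -> integrable1 mu (fun x => \sum_(i <- s) F i x).
Proof.
move=> Fi; elim: s => [|i s IH].
  under [X in EFin \o X]eq_fun do rewrite big_nil.
  exact: (integrable0 mu setT).
under [X in EFin \o X]eq_fun do rewrite big_cons.
exact: integrable1D.
Qed.

Lemma integrable1_bndMl (c : R) f g : measurable_fun setT f ->
  (forall x, `|f x| <= c) ->
  integrable1 mu g -> integrable1 mu (fun x => f x * g x).
Proof.
move=> mf fc gi; apply: (@integrable1_dom _ (fun x => c * `|g x|)).
- by apply: measurable_funM => //; exact: integrable1_meas.
- by move=> x; rewrite normrM ler_wpM2r.
- by apply: integrable1Z; exact: integrable1_norm.
Qed.

Lemma integrable1_bndMr (c : R) f g : measurable_fun setT f ->
  (forall x, `|f x| <= c) ->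
  integrable1 mu g -> integrable1 mu (fun x => g x * f x).
Proof.
move=> mf fc gi; rewrite (_ : (fun x => _) = (fun x => f x * g x)).
  exact: (integrable1_bndMl _ fc).
by apply/funext => x; rewrite mulrC.
Qed.

Lemma Rint_sum (I : Type) (s : seq I) (F : I -> X -> R) :
  (forall i, integrable1 mu (F i)) ->
  \int[mu]_x (\sum_(i <- s) F i x) = \sum_(i <- s) \int[mu]_x F i x.
Proof.
move=> Fi; elim: s => [|i s IH].
  rewrite big_nil; under eq_Rintegral do rewrite big_nil.
  by rewrite /Rintegral integral0.
rewrite big_cons -IH; under eq_Rintegral do rewrite big_cons.
by rewrite RintegralD //; exact: integrable1_sum.
Qed.

Lemma Rint_le f g : integrable1 mu f -> integrable1 mu g ->
  (forall x, f x <= g x) -> \int[mu]_x f x <= \int[mu]_x g x.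
Proof. by move=> fi gi fg; apply: le_Rintegral. Qed.

Lemma Rint_norm_le f g : integrable1 mu g -> measurable_fun setT f ->
  (forall x, `|f x| <= g x) -> `|\int[mu]_x f x| <= \int[mu]_x g x.
Proof.
move=> gi mf fg; have fi := integrable1_dom mf fg gi.
apply: (le_trans (le_normr_Rintegral measurableT fi)).
by apply: Rint_le => //; exact: integrable1_norm.
Qed.

Lemma RintN f : integrable1 mu f -> \int[mu]_x (- f x) = - \int[mu]_x f x.
Proof.
move=> fi; under eq_Rintegral do rewrite -mulN1r.
by rewrite RintegralZl // mulN1r.
Qed.

Lemma Rint_dct (f_ : nat -> X -> R) f g :
  (forall n, measurable_fun setT (f_ n)) -> measurable_fun setT f ->
  {ae mu, forall x, f_ n x @[n --> \oo] --> f x} ->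
  integrable1 mu g -> (forall n x, `|f_ n x| <= g x) ->
  \int[mu]_x f_ n x @[n --> \oo] --> \int[mu]_x f x.
Proof.
move=> mf_ mf fl gi fg.
have [fi _ cv] := @dominated_convergence _ X R mu setT measurableT
  (fun n => EFin \o f_ n) (EFin \o f) (EFin \o g)
  (fun n => (measurable_EFinP _ _).2 (mf_ n)) ((measurable_EFinP _ _).2 mf)
  ltac:(apply: filterS fl => x /= h _; exact/cvg_EFin/h/nearW) gi
  ltac:(apply: aeW => x n _ /=; rewrite lee_fin; exact: fg).
have fin := integrable_fin_num measurableT fi.
apply: (@fine_cvg R nat \oo _ (fun n => \int[mu]_x (f_ n x)%:E)%E).
by rewrite fineK.
Qed.

Lemma Rint_ae f g : measurable_fun setT f -> measurable_fun setT g ->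
  {ae mu, forall x, f x = g x} -> \int[mu]_x f x = \int[mu]_x g x.
Proof.
move=> mf mg fg; congr fine; apply: ae_eq_integral => //;
  [exact/measurable_EFinP|exact/measurable_EFinP|].
by apply: filterS fg => x -> _.
Qed.

Lemma Rint_le_ae f g : integrable1 mu f -> integrable1 mu g ->
  {ae mu, forall x, f x <= g x} -> \int[mu]_x f x <= \int[mu]_x g x.
Proof.
move=> fi gi fg.
have mf := integrable1_meas fi; have mg := integrable1_meas gi.
(* [Rint_le] compares functions everywhere, so [f] is first replaced by min(f, g), which equals it
   almost everywhere. *)
rewrite (_ : \int[mu]_x f x = \int[mu]_x (Num.min (f x) (g x))); last first.
  apply: Rint_ae => //; first exact: measurable_minr.
  by apply: filterS fg => x /min_idPl ->.
apply: Rint_le => //; last by move=> x; rewrite ge_min lexx orbT.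
apply: (@integrable1_dom _ (fun x => `|f x| + `|g x|)).
- exact: measurable_minr.
- by move=> x; rewrite minEle; case: ifP => _; rewrite ?lerDl ?lerDr.
- by apply: integrable1D; exact: integrable1_norm.
Qed.

Lemma ge0_integrable1 f : measurable_fun setT f -> (forall x, 0 <= f x) ->
  (\int[mu]_x (f x)%:E < +oo)%E -> integrable1 mu f.
Proof.
move=> mf f0 foo; apply/integrableP; split; first exact/measurable_EFinP.
by under eq_integral do rewrite /= ger0_norm //.
Qed.

Lemma integrable1_EFin f : integrable1 mu f ->
  (\int[mu]_x (f x)%:E)%E = (\int[mu]_x f x)%:E.
Proof. by move=> fi; rewrite fineK //; exact: integrable_fin_num. Qed.

Lemma Rint_eq0_ae f : integrable1 mu f -> (forall x, 0 <= f x) ->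
  \int[mu]_x f x <= 0 -> {ae mu, forall x, f x = 0}.
Proof.
move=> fi f0 f00; have mf := integrable1_meas fi.
have e0 : (\int[mu]_x `|(f x)%:E| = 0)%E.
  under eq_integral do rewrite gee0_abs ?lee_fin //.
  rewrite (integrable1_EFin fi); congr EFin; apply/eqP.
  by rewrite eq_le f00 Rintegral_ge0.
have := (ae_eq_integral_abs mu measurableT ((measurable_EFinP setT f).2 mf)).1 e0.
by apply: filterS => x /= /(_ I) [].
Qed.
End real_integral.

Section real_fubini.
Context d1 d2 (X : measurableType d1) (Y : measurableType d2) (R : realType).
Variables (mu : {sigma_finite_measure set X -> \bar R})
  (nu : {sigma_finite_measure set Y -> \bar R}).
Implicit Types (f : X -> R) (g : Y -> R) (h : X * Y -> R).

Lemma measurable_prod1 h x : measurable_fun setT h -> measurable_fun setT (fun y => h (x, y)).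
Proof. by move=> mh; exact: measurableT_comp. Qed.

Lemma measurable_prod2 h y : measurable_fun setT h -> measurable_fun setT (fun x => h (x, y)).
Proof. by move=> mh; exact: measurableT_comp. Qed.

(** No integrability is assumed: the inner integral is [fine] of the difference of the Tonelli
    integrals of the positive and negative parts, and each of these is measurable in [x]. *)
Lemma measurable_Rint2 h : measurable_fun setT h ->
  measurable_fun setT (fun x => \int[nu]_y h (x, y)).
Proof.
move=> mh; rewrite /Rintegral; apply: measurableT_comp => //.
under eq_fun do rewrite integralE.
have mE : measurable_fun setT (EFin \o h) by exact/measurable_EFinP.
apply: emeasurable_funB.
- under eq_fun do under eq_integral do rewrite -[X in X^\+%E]/((EFin \o h) \o (fun z => (_, z))) funepos_comp /=.
  exact: (@measurable_fun_fubini_tonelli_F _ _ _ _ _ nu _ (measurable_funepos mE) (funepos_ge0 _)).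
- under eq_fun do under eq_integral do rewrite -[X in X^\-%E]/((EFin \o h) \o (fun z => (_, z))) funeneg_comp /=.
  exact: (@measurable_fun_fubini_tonelli_F _ _ _ _ _ nu _ (measurable_funeneg mE) (funeneg_ge0 _)).
Qed.

Lemma measurable_Rint1 h : measurable_fun setT h ->
  measurable_fun setT (fun y => \int[mu]_x h (x, y)).
Proof.
move=> mh; rewrite /Rintegral; apply: measurableT_comp => //.
under eq_fun do rewrite integralE.
have mE : measurable_fun setT (EFin \o h) by exact/measurable_EFinP.
apply: emeasurable_funB.
- under eq_fun do under eq_integral do rewrite -[X in X^\+%E]/((EFin \o h) \o (fun z => (z, _))) funepos_comp /=.
  exact: (@measurable_fun_fubini_tonelli_G _ _ _ _ _ mu _ (measurable_funepos mE) (funepos_ge0 _)).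
- under eq_fun do under eq_integral do rewrite -[X in X^\-%E]/((EFin \o h) \o (fun z => (z, _))) funeneg_comp /=.
  exact: (@measurable_fun_fubini_tonelli_G _ _ _ _ _ mu _ (measurable_funeneg mE) (funeneg_ge0 _)).
Qed.

Lemma integrable1_tensor f g : integrable1 mu f -> integrable1 nu g ->
  integrable1 (mu \x nu)%E (fun p => f p.1 * g p.2).
Proof.
move=> fi gi.
have mf := integrable1_meas fi; have mg := integrable1_meas gi.
have m : measurable_fun setT (fun p : X * Y => f p.1 * g p.2).
  by apply: measurable_funM; exact: measurableT_comp.
apply/(integrable12ltyP _ _ ((measurable_EFinP _ _).2 m)) => /=.
have ng := integrable1_norm gi; have nf := integrable1_norm fi.
rewrite (_ : (fun x => _) = (fun x => ((\int[nu]_y `|g y|) * `|f x|)%:E)).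
  rewrite (_ : (\int[mu]_x _)%E = (\int[mu]_x ((\int[nu]_y `|g y|) * `|f x|))%:E) ?ltry //.
  by apply: integrable1_EFin; exact: integrable1Z.
apply/funext => x; under eq_integral do rewrite normrM.
rewrite (integrable1_EFin (integrable1Z `|f x| ng)) RintegralZl //.
by rewrite mulrC.
Qed.

Lemma integrable1_ae1 h : integrable1 (mu \x nu)%E h ->
  {ae mu, forall x, integrable1 nu (fun y => h (x, y))}.
Proof. by move=> hi; have := ae_integrable1 hi; exact. Qed.

Lemma integrable1_ae2 h : integrable1 (mu \x nu)%E h ->
  {ae nu, forall y, integrable1 mu (fun x => h (x, y))}.
Proof. by move=> hi; have := ae_integrable2 hi; exact. Qed.

Lemma Rint_fubini1 h : integrable1 (mu \x nu)%E h ->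
  \int[(mu \x nu)%E]_p h p = \int[mu]_x \int[nu]_y h (x, y).
Proof.
move=> hi; rewrite /Rintegral -(integral12_prod_meas1 hi); congr fine.
(* The sections are integrable only for almost every [x]; elsewhere [fine] may alter the inner
   integral. *)
apply: ae_eq_integral => //.
- exact: (measurable_fubini_F hi).
- apply/measurable_EFinP; apply: measurable_Rint2; exact: integrable1_meas hi.
- apply: filterS (integrable1_ae1 hi) => x xi _.
  by rewrite /fubini_F (integrable1_EFin xi).
Qed.

Lemma Rint_fubini2 h : integrable1 (mu \x nu)%E h ->
  \int[(mu \x nu)%E]_p h p = \int[nu]_y \int[mu]_x h (x, y).
Proof.
move=> hi; rewrite /Rintegral -(integral21_prod_meas1 hi); congr fine.
apply: ae_eq_integral => //.
- exact: (measurable_fubini_G hi).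
- apply/measurable_EFinP; apply: measurable_Rint1; exact: integrable1_meas hi.
- apply: filterS (integrable1_ae2 hi) => x xi _.
  by rewrite /fubini_G (integrable1_EFin xi).
Qed.

Lemma Rint_swap h : integrable1 (mu \x nu)%E h ->
  \int[mu]_x \int[nu]_y h (x, y) = \int[nu]_y \int[mu]_x h (x, y).
Proof. by move=> hi; rewrite -Rint_fubini1 // Rint_fubini2. Qed.

Lemma integrable1_bound h f g : measurable_fun setT h ->
  integrable1 mu f -> integrable1 nu g ->
  (forall x y, `|h (x, y)| <= f x * g y) -> integrable1 (mu \x nu)%E h.
Proof.
move=> mh fi gi hfg; apply: (integrable1_dom mh _ (integrable1_tensor fi gi)).
by case=> x y /=.
Qed.

Lemma Rint_tensor f g : integrable1 mu f -> integrable1 nu g ->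
  \int[(mu \x nu)%E]_p (f p.1 * g p.2) = (\int[mu]_x f x) * (\int[nu]_y g y).
Proof.
move=> fi gi; rewrite Rint_fubini1 ?integrable1_tensor //=.
under eq_Rintegral do rewrite RintegralZl //.
by rewrite RintegralZr.
Qed.
End real_fubini.

(** * Poisson and Laplace kernels on the line *)

Section one_dim.
Context (R : realType).
Notation leb := (@lebesgue_measure R).

Lemma norm_cos_le1 (x : R) : `|cos x| <= 1.
Proof. by rewrite ler_norml cos_geN1 cos_le1. Qed.

Lemma norm_sin_le1 (x : R) : `|sin x| <= 1.
Proof. by rewrite ler_norml sin_geN1 sin_le1. Qed.

Lemma is_derive_continuous (F f : R -> R) :
  (forall x, is_derive x (1:R) F (f x)) -> continuous F.
Proof.
move=> dF x; have [d _] := dF x.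
exact/differentiable_continuous/derivable1_diffP.
Qed.

Lemma integral_FTC (F f : R -> R) (a b : R) :
  (forall x, is_derive x (1:R) F (f x)) -> continuous f -> a <= b ->
  (\int[leb]_(x in `[a, b]) (f x)%:E = (F b - F a)%:E)%E.
Proof.
move=> dF cf; rewrite le_eqVlt => /predU1P[<-|ab].
  by rewrite set_itv1 integral_set1 subrr.
have cF := is_derive_continuous dF.
rewrite (continuous_FTC2 (F := F) ab) //.
- exact: continuous_subspaceT.
- split.
  + by move=> x _; have [] := dF x.
  + exact/cvg_at_right_filter/cF.
  + exact/cvg_at_left_filter/cF.
- by move=> x _; rewrite derive1E; have [_ ->] := dF x.
Qed.

Lemma integrable_itv (f : R -> R) (a b : R) : continuous f ->
  leb.-integrable `[a, b] (EFin \o f).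
Proof.
move=> cf; apply: continuous_compact_integrable; first exact: segment_compact.
exact: continuous_subspaceT.
Qed.

Lemma nat_itv_cvg (x : R) : \forall n \near \oo, (- n%:R <= x <= n%:R).
Proof.
have [m mx] : exists m : nat, `|x| <= m%:R.
  by exists (Num.bound `|x|); rewrite ltW // archi_boundP.
near=> n; rewrite -ler_norml (le_trans mx) // ler_nat; near: n.
by exists m.
Unshelve. all: by end_near. Qed.

(** The truncations of [f] to [-n, n] increase to [f], so monotone convergence turns their common
    bound into a bound on the whole integral. *)
Lemma integral_nat_itv_nneg (f : R -> R) (M : R) : measurable_fun setT f ->
  (forall x, 0 <= f x) ->
  (forall n, (\int[leb]_(x in `[(- n%:R)%R, n%:R%R]) (f x)%:E <= M%:E)%E) ->
  integrable1 leb f.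
Proof.
move=> mf f0 fM; apply: ge0_integrable1 => //.
apply: le_lt_trans (ltry M).
pose g n x := (f x * \1_(`[- n%:R, n%:R] : set R) x)%:E.
have gl x : (g n x @[n --> \oo] --> (f x)%:E)%E.
  apply: cvg_near_cst; apply: filterS (nat_itv_cvg x) => n nx.
  by rewrite /g indicE mem_set ?mulr1 //= in_itv.
have -> : (\int[leb]_x (f x)%:E = \int[leb]_x (limn (g ^~ x)))%E.
  by apply: eq_integral => x _; apply/esym/cvg_lim => //; exact: gl.
have mg n : measurable_fun setT (g n).
  apply/measurable_EFinP; exact: measurable_funM.
have ndg x : {homo g ^~ x : n m / (n <= m)%N >-> (n <= m)%E}.
  move=> n m nm; rewrite /g lee_fin ler_wpM2l // !indicE.
  have [/set_mem/= xn|_] := boolP (x \in _); last by rewrite ler0n.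
  rewrite mem_set //=; move: xn; rewrite !in_itv /= => /andP[a b].
  by rewrite (le_trans _ a) ?(le_trans b) ?lerN2 ?ler_nat.
rewrite monotone_convergence //; last by move=> n x _; rewrite /g lee_fin mulr_ge0.
apply: lime_le.
  apply: ereal_nondecreasing_is_cvgn => n m nm; apply: ge0_le_integral => //.
  - by move=> x _; rewrite /g lee_fin mulr_ge0.
  - exact: mg.
  - exact: mg.
  - by move=> x _; exact: ndg.
apply: nearW => n; apply: le_trans (fM n).
rewrite [leRHS]integral_mkcond le_eqVlt; apply/orP; left; apply/eqP.
apply: eq_integral => x _; rewrite /g /patch indicE.
by case: ifP => _; rewrite ?mulr1 ?mulr0.
Qed.

Lemma integral_nat_itv (f : R -> R) : integrable1 leb f ->
  (\int[leb]_(x in `[- n%:R, n%:R]) f x) @[n --> \oo] --> \int[leb]_x f x.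
Proof.
move=> fi; have mf := integrable1_meas fi.
under eq_fun do rewrite Rintegral_mkcond.
apply: (@Rint_dct _ _ R leb (fun n => f \_ `[- n%:R, n%:R]) f (fun x => `|f x|)) => //.
- move=> n; apply: (measurable_restrictT _ _).1; last exact: measurable_funTS.
  exact: measurable_itv.
- apply: aeW => x; apply: cvg_near_cst; apply: filterS (nat_itv_cvg x) => n nx.
  by rewrite /patch mem_set //= in_itv.
- exact: integrable1_norm.
- by move=> n x; rewrite /patch; case: ifP => // _; rewrite normr0.
Qed.

(** Poisson kernel of the upper half-plane at height [e], that is, the Cauchy density of scale [e]
    centred at [x]. *)
Definition poisson (e x y : R) : R := e / (e ^+ 2 + (x - y) ^+ 2) / pi.

Lemma poisson_den (e h : R) : 0 < e -> 0 < e ^+ 2 + h ^+ 2.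
Proof. by move=> e0; rewrite ltr_pwDl ?exprn_gt0 ?sqr_ge0. Qed.

Lemma poisson_ge0 e x y : 0 < e -> 0 <= poisson e x y.
Proof.
move=> e0; rewrite !mulr_ge0 // ?ltW // ?invr_gt0 ?pi_gt0 //.
exact: poisson_den.
Qed.

Lemma poissonC e x y : poisson e x y = poisson e y x.
Proof. by rewrite /poisson -(sqrrN (x - y)) opprB. Qed.

Lemma is_derive_poisson (e x y : R) : 0 < e ->
  is_derive y (1:R) (fun y => atan ((y - x) / e) / pi) (poisson e x y).
Proof.
move=> e0.
have D : is_derive y (1:R) (fun y => atan ((y - x) / e) / pi)
   ((1 + ((y - x) / e) ^+ 2)^-1 * e^-1 / pi).
  have h1 : is_derive y (1:R) (fun y => (y - x) / e) (e^-1).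
    by apply: is_derive_eq; rewrite /GRing.scale /=; ring.
  have ha := is_derive1_comp (f := atan) (g := fun y => (y - x) / e) (x := y).
  have h2 := ha _ _ _ h1.
  apply: is_derive_eq; rewrite /GRing.scale /=; ring.
apply: (is_derive_eq D).
rewrite /poisson; have h := poisson_den (x - y) e0.
move: (pi : R) (lt0r_neq0 (pi_gt0 R)) => p p0.
by field; rewrite p0 !gt_eqF.
Qed.

Lemma continuous_poisson (e x : R) : 0 < e -> continuous (poisson e x).
Proof.
move=> e0 y; rewrite /poisson; apply: cvgM; last exact: cvg_cst.
apply: cvgM; first exact: cvg_cst.
apply: cvgV; first by rewrite gt_eqF // poisson_den.
apply: cvgD; first exact: cvg_cst.
have cB : (x - z) @[z --> y] --> x - y by apply: cvgB; [exact: cvg_cst|exact: cvg_id].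
rewrite expr2; under eq_fun do rewrite expr2.
exact: cvgM.
Qed.

Lemma integral_poisson_itv (e x a b : R) : 0 < e -> a <= b ->
  (\int[leb]_(y in `[a, b]) (poisson e x y)%:E =
   ((atan ((b - x) / e) - atan ((a - x) / e)) / pi)%:E)%E.
Proof.
move=> e0 ab.
rewrite (@integral_FTC (fun y => atan ((y - x) / e) / pi) (poisson e x) a b
  (fun y => @is_derive_poisson e x y e0) (@continuous_poisson e x e0) ab).
by rewrite /= -mulrBl.
Qed.

Lemma atan_cvg (c e : R) : 0 < e -> atan ((n%:R - c) / e) @[n --> \oo] --> pi / 2.
Proof.
move=> e0; apply: (cvg_comp (fun n : nat => (n%:R - c) / e) (@atan R) _ (@cvgy_atan R)).
apply/cvgryPge => A; near=> n.
rewrite ler_pdivlMr // lerBrDr; near: n; exact: nbhs_infty_ger.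
Unshelve. all: by end_near. Qed.

Lemma poisson_mass (e x : R) : 0 < e ->
  integrable1 leb (poisson e x) /\ \int[leb]_y poisson e x y = 1.
Proof.
move=> e0; have mp := continuous_measurable_fun (@continuous_poisson e x e0).
have nn (n : nat) : - n%:R <= n%:R :> R by rewrite ge0_cp ?ler0n.
have pi0 := pi_gt0 R.
have pi2 : pi = pi / 2 + pi / 2 :> R by rewrite -splitr.
have i1 : integrable1 leb (poisson e x).
  apply: (@integral_nat_itv_nneg _ 1) => //; first by move=> y; exact: poisson_ge0.
  move=> n; rewrite integral_poisson_itv // lee_fin ler_pdivrMr // mul1r.
  by rewrite [leRHS]pi2 lerD // ?ltW ?atan_ltpi2 // ltrNl atan_gtNpi2.
split => //.
apply: (cvg_unique _ (integral_nat_itv i1)) => //.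
(* Since atan is odd, the lower endpoint also becomes a limit at +oo, with centre [- x]. *)
rewrite (_ : (fun n : nat => _) =
  (fun n : nat => (atan ((n%:R - x) / e) + atan ((n%:R - (- x)) / e)) / pi)); last first.
  apply/funext => n; rewrite /Rintegral integral_poisson_itv //= -atanN.
  by congr ((_ + atan _) / _); rewrite -mulNr; congr (_ / _); ring.
have := cvgM (cvgD (@atan_cvg x e e0) (@atan_cvg (- x) e e0)) (cvg_cst (pi^-1 : R)).
by rewrite -pi2 divff ?gt_eqF //; exact.
Qed.


(** The factor 1 / (2 pi) is that of Fourier inversion: with it the cosine transform is exactly the
    Poisson kernel of mass one. *)
Definition laplace_weight (e xi : R) : R := expR (- (e * `|xi|)) / (2 * pi).

Lemma laplace_weight_ge0 e xi : 0 <= laplace_weight e xi.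
Proof. by rewrite mulr_ge0 ?expR_ge0 // invr_ge0 mulr_ge0 // pi_ge0. Qed.

Lemma laplace_weight_le e e' xi : e <= e' -> laplace_weight e' xi <= laplace_weight e xi.
Proof.
move=> ee; rewrite ler_wpM2r ?invr_ge0 ?mulr_ge0 ?pi_ge0 //.
by rewrite ler_expR lerN2 ler_wpM2r.
Qed.

Lemma continuous_laplace e : continuous (laplace_weight e).
Proof.
move=> x; apply: cvgM; last exact: cvg_cst.
apply: (cvg_comp _ (@expR R) _ (@continuous_expR R _)).
apply: cvgN; apply: cvgM; first exact: cvg_cst.
exact: norm_continuous.
Qed.

(** Real part of exp(-e x + i (c + x h)) / (-e + i h), divided by 2 pi: a primitive of the integrand
    on x >= 0. *)
Let F1 (e h c x : R) := expR (- (e * x)) * (h * sin (c + x * h) - e * cos (c + x * h)) / (e ^+ 2 + h ^+ 2) / (2 * pi).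

Let dF1 (e h c x : R) : 0 < e ->
  is_derive x (1:R) (F1 e h c) (expR (- (e * x)) * cos (c + x * h) / (2 * pi)).
Proof.
move=> e0; have h0 := poisson_den h e0; rewrite /F1.
have d1 : is_derive x (1:R) (fun x => expR (- (e * x))) (expR (- (e * x)) * - e).
  apply: is_derive1_comp.
  by apply: is_derive_eq; rewrite /GRing.scale /=; ring.
have dl : is_derive x (1:R) (fun x => c + x * h) h.
  by apply: is_derive_eq; rewrite /GRing.scale /=; ring.
have d2 : is_derive x (1:R) (fun x => sin (c + x * h)) (cos (c + x * h) * h).
  exact: is_derive1_comp.
have d3 : is_derive x (1:R) (fun x => cos (c + x * h)) (- sin (c + x * h) * h).
  exact: is_derive1_comp.
apply: is_derive_eq; rewrite /GRing.scale /=.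
move: (pi : R) (lt0r_neq0 (pi_gt0 R)) (lt0r_neq0 h0) => p p0 n0.
by field; rewrite n0 p0.
Qed.

Let F1_cvg (e h c : R) : 0 < e -> F1 e h c n%:R @[n --> \oo] --> 0.
Proof.
move=> e0; have h0 := poisson_den h e0.
pose K := (`|h| + e) / (e ^+ 2 + h ^+ 2) / (2 * pi).
have cE : expR (- (e * n%:R)) @[n --> \oo] --> (0 : R).
  apply: (cvg_comp (fun n : nat => e * n%:R) _ _ (@cvgr_expR R)).
  apply/cvgryPge => A; near=> n.
  by rewrite mulrC -ler_pdivrMr //; near: n; exact: nbhs_infty_ger.
have cK : expR (- (e * n%:R)) * K @[n --> \oo] --> 0.
  by rewrite -(mul0r K); apply: cvgM => //; exact: cvg_cst.
apply/cvgr0Pnorm_lt => d d0.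
move/cvgr0Pnorm_lt: cK => /(_ d d0); apply: filterS => n.
apply: le_lt_trans.
pose q := (e ^+ 2 + h ^+ 2)^-1 / (2 * pi).
have q0 : 0 <= q by rewrite mulr_ge0 // ?invr_ge0 ?mulr_ge0 ?pi_ge0 // ltW.
rewrite /F1 /K -!mulrA -/q; move: q q0 => q q0.
rewrite !normrM ler_wpM2l // ler_wpM2r //.
rewrite [leRHS]ger0_norm; last by rewrite addr_ge0 // ltW.
apply: le_trans (ler_normB _ _) _; rewrite !normrM lerD //.
  by apply: ler_piMr; rewrite ?norm_sin_le1.
by rewrite (gtr0_norm e0); apply: ler_piMr; rewrite ?norm_cos_le1 // ltW.
Unshelve. all: by end_near. Qed.

Let laplace_cos_cont (e h c : R) : continuous (fun x => laplace_weight e x * cos (c + x * h)).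
Proof.
move=> x; apply: cvgM; first exact: continuous_laplace.
apply: (cvg_comp _ (@cos R) _ (@continuous_cos R _)).
apply: cvgD; first exact: cvg_cst.
by apply: cvgM; [exact: cvg_id|exact: cvg_cst].
Qed.

Let laplace_half (e h c b : R) : 0 < e -> 0 <= b ->
  \int[leb]_(x in `[0, b]) (laplace_weight e x * cos (c + x * h)) = F1 e h c b - F1 e h c 0.
Proof.
move=> e0 b0; rewrite /Rintegral.
transitivity (fine (\int[leb]_(x in `[0%R, b]) (expR (- (e * x)) * cos (c + x * h) / (2 * pi))%:E)%E).
  congr fine; apply: eq_integral => x; rewrite inE /= in_itv /= => /andP[x0 _].
  by rewrite /laplace_weight ger0_norm //; congr EFin; ring.
rewrite (@integral_FTC (F1 e h c) _ 0 b (fun x => @dF1 e h c x e0) _ b0) //.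
move=> x; apply: cvgM; last exact: cvg_cst.
apply: cvgM.
  apply: (cvg_comp _ (@expR R) _ (@continuous_expR R _)).
  by apply: cvgN; apply: cvgM; [exact: cvg_cst|exact: cvg_id].
apply: (cvg_comp _ (@cos R) _ (@continuous_cos R _)).
apply: cvgD; first exact: cvg_cst.
by apply: cvgM; [exact: cvg_id|exact: cvg_cst].
Qed.

(** The reflection x -> -x preserves the weight and turns [h] into [- h]. *)
Let laplace_neg_half (e h c b : R) : 0 < e -> 0 <= b ->
  \int[leb]_(x in `[- b, 0]) (laplace_weight e x * cos (c + x * h)) = F1 e (- h) c b - F1 e (- h) c 0.
Proof.
move=> e0 b0; rewrite /Rintegral.
transitivity (fine (\int[leb]_(x in `[(- b)%R, 0%R]) (expR (e * x) * cos (c + x * h) / (2 * pi))%:E)%E).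
  congr fine; apply: eq_integral => x; rewrite inE /= in_itv /= => /andP[_ x0].
  by rewrite /laplace_weight ler0_norm // mulrN opprK; congr EFin; ring.
have dF x : is_derive x (1:R) (fun x => - F1 e (- h) c (- x)) (expR (e * x) * cos (c + x * h) / (2 * pi)).
  have d1 : is_derive x (1:R) (fun x => F1 e (- h) c (- x)) (expR (- (e * (- x))) * cos (c + - x * - h) / (2 * pi) * - 1).
    by apply: (@is_derive1_comp _ (F1 e (- h) c) -%R); exact: dF1.
  have E1 : - (e * - x) = e * x by ring.
  have E2 : - x * - h = x * h by ring.
  by apply: is_derive_eq; rewrite E1 E2; ring.
rewrite (@integral_FTC _ _ (- b) 0 dF _ _) //=; last by rewrite oppr_le0.
  by rewrite !opprK oppr0 addrC.
move=> x; apply: cvgM; last exact: cvg_cst.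
apply: cvgM.
  apply: (cvg_comp _ (@expR R) _ (@continuous_expR R _)).
  by apply: cvgM; [exact: cvg_cst|exact: cvg_id].
apply: (cvg_comp _ (@cos R) _ (@continuous_cos R _)).
apply: cvgD; first exact: cvg_cst.
by apply: cvgM; [exact: cvg_id|exact: cvg_cst].
Qed.

Let laplace_sym (e h c b : R) : 0 < e -> 0 <= b ->
  \int[leb]_(x in `[- b, b]) (laplace_weight e x * cos (c + x * h)) =
  (F1 e h c b - F1 e h c 0) + (F1 e (- h) c b - F1 e (- h) c 0).
Proof.
move=> e0 b0.
have gi a1 a2 := @integrable_itv _ a1 a2 (@laplace_cos_cont e h c).
rewrite -laplace_half // -laplace_neg_half //; apply/eqP; rewrite -subr_eq; apply/eqP.
rewrite Rintegral_itvB ?bnd_simp ?oppr_le0 // Rintegral_itv_obnd_cbnd //.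
by apply: integrableS (gi 0 b) => //; apply: subset_itvr; rewrite bnd_simp.
Qed.

Lemma integrable1_laplace e : 0 < e -> integrable1 leb (laplace_weight e).
Proof.
(* [- F1 e 0 0 0] is 1 / (2 pi e), the mass of one half-line; twice this is the total mass. *)
move=> e0; apply: (@integral_nat_itv_nneg _ (- F1 e 0 0 0 *+ 2)).
- exact: continuous_measurable_fun (@continuous_laplace e).
- exact: laplace_weight_ge0.
move=> n.
have : \int[leb]_(x in `[- n%:R, n%:R]) laplace_weight e x =
    (F1 e 0 0 n%:R - F1 e 0 0 0) + (F1 e 0 0 n%:R - F1 e 0 0 0).
  have := @laplace_sym e 0 0 n%:R e0 (ler0n _ _); rewrite oppr0 => <-.
  by apply: eq_Rintegral => x _; rewrite mulr0 addr0 cos0 mulr1.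
rewrite /Rintegral => E.
rewrite -[X in (X <= _)%E]fineK; last first.
  apply: integrable_fin_num => //.
  exact: integrable_itv (@continuous_laplace e).
rewrite E lee_fin -mulr2n lerMn2r /= gerDr.
rewrite /F1 !mulr0 addr0 sin0 cos0 mul0r mulr1 sub0r mulrN !mulNr oppr_le0.
by rewrite !mulr_ge0 ?expR_ge0 ?ltW // ?invr_gt0 ?mulr_gt0 ?pi_gt0 ?poisson_den.
Qed.

(** The phase [c] will carry the other coordinates in the induction on the dimension. The part odd
    in x integrates to zero, which leaves the factor [cos c]. *)
Lemma laplace_fourier e h c : 0 < e ->
  \int[leb]_x (laplace_weight e x * cos (c + x * h)) = cos c * (e / (e ^+ 2 + h ^+ 2) / pi).
Proof.
move=> e0.
have gi : integrable1 leb (fun x => laplace_weight e x * cos (c + x * h)).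
  apply: (@integrable1_dom _ _ R leb (fun x => laplace_weight e x * cos (c + x * h)) (laplace_weight e)) => [||]; last exact: integrable1_laplace.
    exact: continuous_measurable_fun (@laplace_cos_cont e h c).
  move=> x; rewrite normrM (ger0_norm (laplace_weight_ge0 _ _)).
  by apply: ler_piMr; rewrite ?laplace_weight_ge0 ?norm_cos_le1.
apply: (cvg_unique _ (integral_nat_itv gi)) => //.
rewrite (_ : (fun n : nat => _) = (fun n : nat => (F1 e h c n%:R - F1 e h c 0) + (F1 e (- h) c n%:R - F1 e (- h) c 0))); last first.
  by apply/funext => n; rewrite laplace_sym.
have -> : cos c * (e / (e ^+ 2 + h ^+ 2) / pi) = (0 - F1 e h c 0) + (0 - F1 e (- h) c 0).
  have h0 := poisson_den h e0.
  rewrite /F1 sqrrN !mulr0 !mul0r !addr0 oppr0 expR0.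
  move: (pi : R) (lt0r_neq0 (pi_gt0 R)) (lt0r_neq0 h0) => p p0 n0.
  by field; rewrite n0 p0.
by apply: cvgD; (apply: cvgB; [exact: F1_cvg|exact: cvg_cst]).
Qed.

End one_dim.

(** * Dirichlet forms of Markov kernels *)

Lemma cvge0_nnegP (R : realType) (u : nat -> \bar R) : (forall n, (0 <= u n)%E) ->
  (u n @[n --> \oo] --> 0)%E <->
  (forall e : R, 0 < e -> \forall n \near \oo, (u n <= e%:E)%E).
Proof.
move=> u0; split.
  move=> /fine_cvgP[uf /cvgr0Pnorm_le ul] e e0.
  near=> n; have un : u n \is a fin_num by near: n.
  rewrite -(fineK un) lee_fin (le_trans (ler_norm _)) //; near: n.
  exact: ul.
move=> H.
have uf e n : (u n <= e%:E)%E -> u n \is a fin_num.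
  by move=> un; rewrite ge0_fin_numE // (le_lt_trans un) // ltry.
apply/fine_cvgP; split.
  by apply: filterS (H 1 ltr01) => n; exact: uf.
apply/cvgr0Pnorm_le => e e0; apply: filterS (H e e0) => n un.
by rewrite /= ger0_norm ?fine_ge0 // -lee_fin fineK // (uf e).
Unshelve. all: by end_near. Qed.

Section dirichlet_form.
Context d (X : measurableType d) (R : realType).
Variable (mu : {sigma_finite_measure set X -> \bar R}).
Implicit Types (f g h : X -> R) (K : X -> X -> R).

Definition markov_kernel K := [/\ measurable_fun setT (fun p : X * X => K p.1 p.2),
  forall x y, 0 <= K x y, forall x y, K x y = K y x &
  forall x, (\int[mu]_y (K x y)%:E = 1)%E].

(** For square-integrable [f] this is 2 <f, f> - 2 <f, K f>, the defect of [K] from the identity. It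
    is extended-valued so as to make sense before square-integrability is known. *)
Definition dirichlet K f :=
  (\int[(mu \x mu)%E]_p ((f p.1 - f p.2) ^+ 2 * K p.1 p.2)%:E)%E.

Lemma dirichlet_ge0 K f : markov_kernel K -> (0 <= dirichlet K f)%E.
Proof. by case=> _ K0 _ _; apply: integral_ge0 => p _; rewrite lee_fin mulr_ge0 ?sqr_ge0. Qed.

Lemma measurable_fst1 f : measurable_fun setT f -> measurable_fun setT (fun p : X * X => f p.1).
Proof. by move=> mf; exact: measurableT_comp. Qed.

Lemma measurable_snd1 f : measurable_fun setT f -> measurable_fun setT (fun p : X * X => f p.2).
Proof. by move=> mf; exact: measurableT_comp. Qed.

Lemma measurable_dirichlet K f : markov_kernel K -> measurable_fun setT f ->
  measurable_fun setT (fun p : X * X => (f p.1 - f p.2) ^+ 2 * K p.1 p.2).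
Proof.
move=> [mK _ _ _] mf; apply: measurable_funM => //; apply: measurable_funX.
by apply: measurable_funB; [exact: measurable_fst1|exact: measurable_snd1].
Qed.

Lemma markov_fst K h : markov_kernel K -> measurable_fun setT h -> (forall x, 0 <= h x) ->
  (\int[(mu \x mu)%E]_p (h p.1 * K p.1 p.2)%:E = \int[mu]_x (h x)%:E)%E.
Proof.
move=> [mK K0 Ks K1] mh h0.
rewrite (fubini_tonelli1 (fun p => (h p.1 * K p.1 p.2)%:E)); last 2 first.
- by apply/measurable_EFinP; apply: measurable_funM => //; exact: measurable_fst1.
- by move=> p; rewrite lee_fin mulr_ge0.
apply: eq_integral => x _; rewrite /fubini_F /=.
under eq_integral do rewrite EFinM.
rewrite ge0_integralZl_EFin ?K1 ?mule1 //.
- by move=> y _; rewrite lee_fin.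
- by apply/measurable_EFinP; exact: (@measurable_prod1 _ _ _ _ _ (fun p => K p.1 p.2)).
Qed.

Lemma markov_snd K h : markov_kernel K -> measurable_fun setT h -> (forall x, 0 <= h x) ->
  (\int[(mu \x mu)%E]_p (h p.2 * K p.1 p.2)%:E = \int[mu]_x (h x)%:E)%E.
Proof.
move=> [mK K0 Ks K1] mh h0.
rewrite (fubini_tonelli2 (fun p => (h p.2 * K p.1 p.2)%:E)); last 2 first.
- by apply/measurable_EFinP; apply: measurable_funM => //; exact: measurable_snd1.
- by move=> p; rewrite lee_fin mulr_ge0.
apply: eq_integral => y _; rewrite /fubini_G /=.
under eq_integral do rewrite EFinM Ks.
rewrite ge0_integralZl_EFin ?K1 ?mule1 //.
- by move=> x _; rewrite lee_fin.
- by apply/measurable_EFinP; exact: (@measurable_prod1 _ _ _ _ _ (fun p => K p.1 p.2)).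
Qed.

Lemma sqrD_le (a b : R) : (a + b) ^+ 2 <= 2 * a ^+ 2 + 2 * b ^+ 2.
Proof. by rewrite -subr_ge0 (_ : _ - _ = (a - b) ^+ 2) ?sqr_ge0 //; ring. Qed.

(** From (a - b)^2 <= 2 a^2 + 2 b^2 and the unit mass of the kernel in either variable. The constant
    does not depend on [K]; this allows both L^2 approximation and dominated convergence along a
    sequence of kernels. *)
Lemma dirichlet_le K f : markov_kernel K -> measurable_fun setT f ->
  (dirichlet K f <= 4%:E * \int[mu]_x (f x ^+ 2)%:E)%E.
Proof.
move=> Kk mf; have [mK K0 Ks K1] := Kk.
have mf2 : measurable_fun setT (fun x => 2 * f x ^+ 2).
  by apply: measurable_funM => //; exact: measurable_funX.
have f20 x : 0 <= 2 * f x ^+ 2 by rewrite mulr_ge0 ?sqr_ge0.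
apply: (@le_trans _ _ (\int[(mu \x mu)%E]_p ((2 * f p.1 ^+ 2 * K p.1 p.2)%:E + (2 * f p.2 ^+ 2 * K p.1 p.2)%:E)))%E.
  apply: ge0_le_integral => //.
  - by move=> p _; rewrite lee_fin mulr_ge0 ?sqr_ge0.
  - by apply/measurable_EFinP; exact: measurable_dirichlet.
  - by apply: emeasurable_funD; apply/measurable_EFinP; apply: measurable_funM => //;
      [exact: (measurable_fst1 mf2)|exact: (measurable_snd1 mf2)].
  - move=> p _; rewrite -EFinD lee_fin -mulrDl ler_wpM2r //.
    by rewrite -[f p.2 ^+ 2]sqrrN; exact: sqrD_le.
rewrite ge0_integralD //; first last.
- by apply/measurable_EFinP; apply: measurable_funM => //; exact: (measurable_snd1 mf2).
- by move=> p _; rewrite lee_fin mulr_ge0.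
- by apply/measurable_EFinP; apply: measurable_funM => //; exact: (measurable_fst1 mf2).
- by move=> p _; rewrite lee_fin mulr_ge0.
rewrite (markov_fst Kk mf2) // (markov_snd Kk mf2) //.
under eq_integral do rewrite EFinM.
rewrite ge0_integralZl_EFin //; last 2 first.
- by move=> x _; rewrite lee_fin sqr_ge0.
- by apply/measurable_EFinP; exact: measurable_funX.
rewrite -ge0_muleDl ?lee_fin // -EFinD (_ : 2 + 2 = 4 :> R) //; ring.
Qed.

Lemma dirichletD K f g : markov_kernel K -> measurable_fun setT f -> measurable_fun setT g ->
  (dirichlet K (fun x => f x + g x)%R <= 2%:E * (dirichlet K f + dirichlet K g))%E.
Proof.
move=> Kk mf mg; have [mK K0 Ks K1] := Kk.
rewrite /dirichlet -ge0_integralD //; last 4 first.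
- by move=> p _; rewrite lee_fin mulr_ge0 ?sqr_ge0.
- by apply/measurable_EFinP; exact: measurable_dirichlet.
- by move=> p _; rewrite lee_fin mulr_ge0 ?sqr_ge0.
- by apply/measurable_EFinP; exact: measurable_dirichlet.
have mm : measurable_fun setT (fun p : X * X => (((f p.1 - f p.2) ^+ 2 * K p.1 p.2)%:E + ((g p.1 - g p.2) ^+ 2 * K p.1 p.2)%:E)%E).
  apply: emeasurable_funD.
    by apply/measurable_EFinP; exact: measurable_dirichlet.
  by apply/measurable_EFinP; exact: measurable_dirichlet.
have pp (p : X * X) : (0 <= ((f p.1 - f p.2) ^+ 2 * K p.1 p.2)%:E + ((g p.1 - g p.2) ^+ 2 * K p.1 p.2)%:E)%E.
  by rewrite adde_ge0 // lee_fin mulr_ge0 ?sqr_ge0.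
rewrite -ge0_integralZl_EFin //.
apply: ge0_le_integral => //.
- by move=> p _; rewrite lee_fin mulr_ge0 ?sqr_ge0.
- by apply/measurable_EFinP; exact: (measurable_dirichlet Kk (measurable_funD mf mg)).
- by apply: emeasurable_funM => //.
- move=> p _; rewrite -EFinD -EFinM lee_fin -mulrDl mulrA ler_wpM2r //.
  rewrite mulrDr (_ : f p.1 + _ - _ = (f p.1 - f p.2) + (g p.1 - g p.2)); last by ring.
  exact: sqrD_le.
Qed.

Lemma dirichletZ K f c : markov_kernel K -> measurable_fun setT f ->
  dirichlet K (fun x => c * f x) = ((c ^+ 2)%:E * dirichlet K f)%E.
Proof.
move=> Kk mf; have [mK K0 Ks K1] := Kk.
rewrite /dirichlet -ge0_integralZl_EFin ?sqr_ge0 //.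
- by apply: eq_integral => p _; rewrite -EFinM; congr EFin; ring.
- by move=> p _; rewrite lee_fin mulr_ge0 ?sqr_ge0.
- by apply/measurable_EFinP; exact: measurable_dirichlet.
Qed.

Section approximate_identity.
Variable (K : nat -> X -> X -> R).
Hypothesis Kk : forall n, markov_kernel (K n).

(** These functions form a vector space closed under L^2 limits, so that in the end only indicators
    of intervals have to be examined. *)
Definition approximable f := measurable_fun setT f /\
  (dirichlet (K n) f @[n --> \oo] --> 0)%E.

Lemma approximableD f g : approximable f -> approximable g -> approximable (fun x => f x + g x).
Proof.
move=> [mf fl] [mg gl]; split; first exact: measurable_funD.
apply: (@squeeze_cvge _ _ _ _ (cst 0%E) _ (fun n => 2%:E * (dirichlet (K n) f + dirichlet (K n) g)))%E.
- by apply: nearW => n; rewrite dirichlet_ge0 // dirichletD.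
- exact: cvg_cst.
- have cD : ((dirichlet (K n) f + dirichlet (K n) g) @[n --> \oo] --> 0 + 0)%E by exact: cvgeD.
  have := cvgeZl (y := 2%:E) isT cD.
  by rewrite adde0 mule0; exact.
Qed.

Lemma approximableZ f c : approximable f -> approximable (fun x => c * f x).
Proof.
move=> [mf fl]; split; first exact: measurable_funM.
under eq_fun do rewrite dirichletZ //.
have := cvgeZl (y := (c ^+ 2)%:E) isT fl.
by rewrite mule0; exact.
Qed.

Lemma approximable_L2 f : measurable_fun setT f ->
  (forall e, 0 < e -> exists g, approximable g /\
     (\int[mu]_x ((f x - g x) ^+ 2)%:E <= e%:E)%E) -> approximable f.
Proof.
move=> mf H; split => //.
apply/cvge0_nnegP; first by move=> n; exact: dirichlet_ge0.
move=> e e0.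
(* Splitting f = (f - g) + g costs a factor 2 and [dirichlet_le] a factor 4: 2 (4 (e / 16) + e / 4)
   = e. *)
have [|g [[mg gl] fg]] := H (e / 16); first by rewrite divr_gt0.
have e4 : 0 < e / 4 by rewrite divr_gt0.
have := (cvge0_nnegP (fun n => dirichlet_ge0 g (Kk n))).1 gl _ e4.
apply: filterS => n gn.
have mfg := measurable_funB mf mg.
rewrite (_ : f = (fun x => (f x - g x) + g x)); last by apply/funext => x; rewrite subrK.
apply: le_trans (dirichletD (Kk n) mfg mg) _.
apply: (@le_trans _ _ (2%:E * (4%:E * (e / 16)%:E + (e / 4)%:E)))%E.
  rewrite lee_wpmul2l // leeD //.
  apply: le_trans (dirichlet_le (Kk n) mfg) _.
  by rewrite lee_wpmul2l.
by rewrite -EFinM lee_fin; lra.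
Qed.

(** Domination by a square-integrable [g] upgrades pointwise convergence to L^2 convergence, with
    majorant 4 g^2. *)
Lemma approximable_dct (f_ : nat -> X -> R) f g :
  (forall n, approximable (f_ n)) -> measurable_fun setT f ->
  (forall x, f_ n x @[n --> \oo] --> f x) ->
  measurable_fun setT g -> integrable1 mu (fun x => g x ^+ 2) ->
  (forall n x, `|f_ n x| <= g x) -> approximable f.
Proof.
move=> fa mf fl mg gi fg; apply: approximable_L2 => // e e0.
have flg x : `|f x| <= g x.
  apply: (@cvgr_to_le _ \oo _ R (fun n => `|f_ n x|) `|f x| (g x)).
    exact: cvg_norm.
  by apply: nearW => n; exact: fg.
have mf_ n : measurable_fun setT (f_ n) by case: (fa n).
have dom n x : `|(f x - f_ n x) ^+ 2| <= 4 * g x ^+ 2.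
  rewrite ger0_norm ?sqr_ge0 //.
  apply: (@le_trans _ _ ((2 * g x) ^+ 2)); last by rewrite exprMn -natrX.
  have g0 := le_trans (normr_ge0 _) (flg x).
  rewrite -[X in X <= _]real_normK ?num_real // ler_sqr ?nnegrE ?mulr_ge0 //.
  by rewrite (le_trans (ler_normB _ _)) // mulr2n mulrDl !mul1r lerD.
have cv : \int[mu]_x ((f x - f_ n x) ^+ 2) @[n --> \oo] --> \int[mu]_x 0.
  apply: (@Rint_dct _ _ R mu (fun n x => (f x - f_ n x) ^+ 2) (fun=> 0) (fun x => 4 * g x ^+ 2)).
  - by move=> n; apply: measurable_funX; exact: measurable_funB.
  - exact: measurable_cst.
  - apply: aeW => x.
    have c1 : f x - f_ n x @[n --> \oo] --> f x - f x by apply: cvgB => //; exact: cvg_cst.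
    have c2 := cvgM c1 c1; rewrite subrr mul0r in c2.
    rewrite (_ : (fun n => _) = (fun n => f x - f_ n x) \* (fun n => f x - f_ n x)).
      exact: c2.
    by apply/funext => n; rewrite expr2.
  - exact: integrable1Z.
  - exact: dom.
have f2 n : (\int[mu]_x ((f x - f_ n x) ^+ 2)%:E = (\int[mu]_x ((f x - f_ n x) ^+ 2))%:E)%E.
  apply: integrable1_EFin; apply: (@integrable1_dom _ _ _ _ _ (fun x => 4 * g x ^+ 2)).
  - by apply: measurable_funX; exact: measurable_funB.
  - exact: dom.
  - exact: integrable1Z.
have [n _ Hn] : \forall n \near \oo, \int[mu]_x ((f x - f_ n x) ^+ 2) <= e.
  have := cvgr_le _ cv e; rewrite [X in X < _]/Rintegral integral0; exact.
by exists (f_ n); split => //; rewrite f2 lee_fin; exact: Hn (leqnn n).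
Qed.

Lemma approximable_sum (I : Type) (s : seq I) (F : I -> X -> R) :
  (forall i, approximable (F i)) -> approximable (fun x => \sum_(i <- s) F i x).
Proof.
move=> Fa; elim: s => [|i s IH].
  split; first by under eq_fun do rewrite big_nil; exact: measurable_cst.
  rewrite (_ : (fun n => _) = fun=> 0%E); first exact: cvg_cst.
  apply/funext => n; rewrite /dirichlet.
  by under eq_integral do rewrite !big_nil subrr expr0n mul0r; rewrite integral0.
by under eq_fun do rewrite big_cons; exact: approximableD.
Qed.

End approximate_identity.
End dirichlet_form.

(** * Poisson kernels on the line as an approximate identity *)

Section poisson_approximate_identity.
Context (R : realType).
Notation leb := (@lebesgue_measure R).

Definition eps (n : nat) : R := n.+1%:R^-1.

Lemma eps_gt0 n : 0 < eps n.
Proof. by rewrite invr_gt0. Qed.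

Definition poisson_n n : R -> R -> R := poisson (eps n).

Lemma measurable_poisson (e : R) : 0 < e ->
  measurable_fun setT (fun p : R * R => poisson e p.1 p.2).
Proof.
move=> e0; rewrite (_ : (fun p => _) = poisson e 0 \o (fun p : R * R => p.2 - p.1)).
  apply: measurableT_comp; last exact: measurable_funB.
  exact: continuous_measurable_fun (@continuous_poisson R e 0 e0).
by apply/funext => p; rewrite /poisson /= sub0r opprB.
Qed.

Lemma markov_poisson (e : R) : 0 < e -> markov_kernel leb (poisson e).
Proof.
move=> e0; split.
- exact: measurable_poisson.
- by move=> x y; exact: poisson_ge0.
- exact: poissonC.
- by move=> x; have [i E] := poisson_mass x e0; rewrite (integrable1_EFin i) E.
Qed.

Lemma integral_poisson_itvoc (e x a b : R) : 0 < e -> a <= b ->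
  \int[leb]_y (\1_(`]a, b] : set R) y * poisson e x y) =
  (atan ((b - x) / e) - atan ((a - x) / e)) / pi.
Proof.
move=> e0 ab; rewrite /Rintegral.
rewrite -[RHS]/(fine ((atan ((b - x) / e) - atan ((a - x) / e)) / pi)%:E).
rewrite -integral_poisson_itv //.
rewrite -integral_itv_obnd_cbnd; last first.
  apply/measurable_EFinP; apply: measurable_funTS.
  exact: continuous_measurable_fun (@continuous_poisson R e x e0).
congr fine; rewrite [RHS]integral_mkcond; apply: eq_integral => y _.
rewrite indicE /patch; case: ifP => _; by rewrite ?mul1r ?mul0r.
Qed.

(** The squared difference of an indicator is 1 exactly when one point lies in [E] and the other
    outside. By symmetry of [K] both cases weigh the same, so the form is twice the kernel mass that
    leaves [E]. *)
Lemma dirichlet_indic (d : measure_display) (X : measurableType d) (mu : {sigma_finite_measure set X -> \bar R})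
    (K : X -> X -> R) (E : set X) : measurable E -> markov_kernel mu K ->
  dirichlet mu K \1_E = (2%:E * \int[mu]_x \int[mu]_y ((\1_E x * (1 - \1_E y) * K x y)%:E))%E.
Proof.
move=> mE Kk; have [mK K0 Ks K1] := Kk.
have mi : measurable_fun setT (\1_E : X -> R) by exact: measurable_indic.
have i01 (x : X) : 0 <= \1_E x :> R by rewrite indicE.
have i11 (x : X) : 0 <= 1 - \1_E x :> R by rewrite subr_ge0 indicE lern1 leq_b1.
pose h (p : X * X) := \1_E p.1 * (1 - \1_E p.2) * K p.1 p.2.
have mh : measurable_fun setT h.
  apply: measurable_funM => //; apply: measurable_funM.
    exact: measurable_fst1.
  by apply: measurable_funB => //; exact: measurable_snd1.
have mhE : measurable_fun setT (EFin \o h) by exact/measurable_EFinP.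
have h0 p : 0 <= h p by rewrite !mulr_ge0.
pose h' (p : X * X) := \1_E p.2 * (1 - \1_E p.1) * K p.1 p.2.
have mh' : measurable_fun setT h'.
  apply: measurable_funM => //; apply: measurable_funM.
    exact: measurable_snd1.
  by apply: measurable_funB => //; exact: measurable_fst1.
have mhE' : measurable_fun setT (EFin \o h') by exact/measurable_EFinP.
have h'0 p : 0 <= h' p by rewrite !mulr_ge0.
have -> : dirichlet mu K \1_E = (\int[(mu \x mu)%E]_p ((h p)%:E + (h' p)%:E))%E.
  apply: eq_integral => p _; rewrite -EFinD /h /h'; congr EFin.
  by rewrite !indicE; do 2 case: (_ \in _); rewrite /=; ring.
rewrite ge0_integralD //; first last.
- by move=> p _; rewrite lee_fin.
- by move=> p _; rewrite lee_fin.
rewrite (fubini_tonelli1 (EFin \o h)) // (fubini_tonelli2 (EFin \o h')) //.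
rewrite -[2%:E]/(1 + 1)%:E EFinD ge0_muleDl ?lee_fin // !mul1e.
by congr (_ + _)%E; apply: eq_integral => x _; apply: eq_integral => y _; rewrite /= /h /h' /= Ks.
Qed.

Lemma poisson_approximable_itvoc (a b : R) : approximable leb poisson_n \1_(`]a, b]).
Proof.
have Kk n := markov_poisson (eps_gt0 n).
have mi : measurable_fun setT (\1_(`]a, b]) : R -> R) by exact: measurable_indic.
split => //.
have [ab|ba] := leP a b; last first.
  rewrite (_ : `]a, b]%classic = set0); last first.
    by rewrite set_itv_ge // bnd_simp -leNgt ltW.
  rewrite (_ : (fun n => _) = fun=> 0%E); first exact: cvg_cst.
  apply/funext => n; rewrite /dirichlet.
  by under eq_integral do rewrite !indic0 subrr expr0n mul0r; rewrite integral0.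
(* [r n x] is the Poisson mass that leaves []a, b]] from [x]. *)
pose r n x := (1 - (atan ((b - x) / eps n) - atan ((a - x) / eps n)) / pi) : R.
have pi0 := pi_gt0 R.
have at_le (x : R) : atan x <= pi / 2 by rewrite ltW // atan_ltpi2.
have at_ge (x : R) : - (pi / 2) <= atan x by rewrite ltW // atan_gtNpi2.
have pi2 : pi = pi / 2 + pi / 2 :> R by rewrite -splitr.
have r_bnd n x : `|r n x| <= 2.
  rewrite (le_trans (ler_normB _ _)) // normr1 -[leRHS]/(1 + 1 : R) lerD2l.
  rewrite ler_norml ler_pdivlMr // ler_pdivrMr // mulN1r mul1r.
  by apply/andP; split; have := at_le ((b - x) / eps n);
   have := at_le ((a - x) / eps n); have := at_ge ((b - x) / eps n);
   have := at_ge ((a - x) / eps n); lra.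
have mr n : measurable_fun setT (r n).
  apply: measurable_funB => //; apply: measurable_funM => //.
  apply: measurable_funB; apply: (measurableT_comp (f := @atan R));
    try exact: (continuous_measurable_fun (@continuous_atan R));
    by apply: measurable_funM => //; exact: measurable_funB.
pose E : set R := `]a, b]%classic.
have mE : measurable E by exact: measurable_itv.
have miE : measurable_fun setT (\1_E : R -> R) by exact: measurable_indic.
have Ei : integrable1 leb (fun x : R => 2 * \1_E x).
  apply: integrable1Z; exact: (integrable_indic_itv a b false false).
have iE x : 0 <= \1_E x :> R by rewrite indicE.
have DE n : dirichlet leb (poisson_n n) \1_E = (2 * \int[leb]_x (\1_E x * r n x))%:E.
  rewrite (@dirichlet_indic _ _ leb (poisson_n n) E (measurable_itv _) (Kk n)).
  rewrite EFinM -integrable1_EFin; last first.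
    apply: (@integrable1_dom _ _ R leb (fun x => \1_E x * r n x) (fun x => 2 * \1_E x)) => //.
      exact: (measurable_funM miE (mr n)).
    by move=> x; rewrite normrM mulrC (ger0_norm (iE _)) ler_wpM2r.
  congr (_ * _)%E; apply: eq_integral => x _.
  have [pi' P1] := poisson_mass x (eps_gt0 n).
  have ip : integrable1 leb (fun y => \1_E y * poisson (eps n) x y).
    apply: (@integrable1_dom _ _ R leb _ (fun y => poisson (eps n) x y)) => //.
      by exact: (measurable_funM miE (integrable1_meas pi')).
    move=> y; have p0 := poisson_ge0 x y (eps_gt0 n).
    rewrite (ger0_norm (mulr_ge0 (iE y) p0)).
    by rewrite indicE; case: (_ \in _); rewrite ?mul1r ?mul0r.
  have -> : r n x = \int[leb]_y (poisson (eps n) x y - \1_E y * poisson (eps n) x y).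
    by rewrite RintegralB // P1 integral_poisson_itvoc ?eps_gt0.
  rewrite -RintegralZl //; last exact: integrable1B.
  rewrite -integrable1_EFin; last by apply: integrable1Z; exact: integrable1B.
  by apply: eq_integral => y _; congr EFin; rewrite /poisson_n; ring.
have cv : \int[leb]_x (\1_E x * r n x) @[n --> \oo] --> \int[leb]_x (0 : R).
  apply: (@Rint_dct _ _ R leb (fun n x => \1_E x * r n x) (fun=> 0) (fun x => 2 * \1_E x)) => //.
  - by move=> n; exact: (measurable_funM miE (mr n)).
  (* At [x = b] half of the mass escapes at every small scale in the limit, so this point is removed
     as a null set. *)
  - exists [set b]; split => //; first exact: lebesgue_measure_set1.
    move=> x /= H; apply: contrapT => xb; apply: H.
    rewrite indicE; have [/set_mem|_] := boolP (x \in E); last first.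
      by under eq_fun do rewrite mul0r; exact: cvg_cst.
    rewrite /E /= in_itv /= => /andP[ax xb'].
    have bx : 0 < b - x by rewrite subr_gt0 lt_neqAle xb' andbT; apply/eqP.
    have xa : 0 < x - a by rewrite subr_gt0.
    under eq_fun do rewrite mul1r.
    have atc c : 0 < c -> atan (c / eps n) @[n --> \oo] --> pi / 2.
      move=> c0; have ci : 0 < c^-1 by rewrite invr_gt0.
      have := @atan_cvg R (- 1) c^-1 ci.
      rewrite (_ : (fun n : nat => atan ((n%:R - -1) / c^-1)) = (fun n => atan (c / eps n))); first exact.
      by apply/funext => n; rewrite !invrK opprK mulrC -natr1.
    have -> : (r^~ x) = (fun n => 1 - (atan ((b - x) / eps n) + atan ((x - a) / eps n)) / pi).
      by apply/funext => n; rewrite /r -[a - x]opprB mulNr atanN opprK.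
    have c1 : (atan ((b - x) / eps n) + atan ((x - a) / eps n)) / pi @[n --> \oo] --> (pi / 2 + pi / 2) / pi.
      by apply: cvgM; [apply: cvgD; exact: atc|exact: cvg_cst].
    rewrite -pi2 divff ?gt_eqF // in c1.
    have c2 : 1 - (atan ((b - x) / eps n) + atan ((x - a) / eps n)) / pi @[n --> \oo] --> (1 - 1 : R).
      by apply: cvgB => //; exact: cvg_cst.
    by rewrite subrr in c2; exact: c2.
  - by move=> n x; rewrite normrM mulrC (ger0_norm (iE _)) ler_wpM2r.
apply/cvge0_nnegP; first by move=> n; apply: dirichlet_ge0; exact: Kk.
move=> e e0.
have I0 : \int[leb]_x (0 : R) = 0 by rewrite /Rintegral integral0.
rewrite I0 in cv; have e2 : 0 < e / 2 by rewrite divr_gt0.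
have h := @cvgr_le R nat \oo _ _ _ cv (e / 2) e2.
near=> n; rewrite DE lee_fin mulrC -ler_pdivlMr //; near: n; exact: h.
Unshelve. all: by end_near. Qed.

(** A Dynkin class argument starting from half-open intervals. The bounded window [J] keeps
    complements integrable, as differences of indicators, and dominates the partial unions. *)
Lemma poisson_approximable_indic (E : set R) (m : nat) : measurable E ->
  approximable leb poisson_n \1_(E `&` `]- m%:R, m%:R]).
Proof.
have Kk n : markov_kernel leb (poisson_n n) := markov_poisson (eps_gt0 n).
set J : set R := `]- m%:R, m%:R]%classic.
have mJ : measurable J by exact: measurable_itv.
have iJ : integrable1 leb (\1_J : R -> R) by exact: (integrable_indic_itv _ _ false false).
pose P (A : set R) := approximable leb poisson_n \1_(A `&` J).
move=> mE; apply: (@dynkin_induction _ R (@ocitv R) P) => //.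
- exact: ocitvI.
- by rewrite /P setTI; exact: poisson_approximable_itvoc.
- move=> A oA; rewrite /P.
  have /= [z _ <-] : ocitv (A `&` J) by apply: ocitvI => //; exists (- m%:R, m%:R).
  exact: poisson_approximable_itvoc.
- move=> A mA PA; rewrite /P.
  rewrite (_ : \1_(~` A `&` J) = (fun x => \1_J x + (-1) * \1_(A `&` J) x)).
    by apply: (approximableD Kk (poisson_approximable_itvoc _ _)); exact: (approximableZ Kk).
  apply/funext => x; rewrite !indicE !in_setI in_setC.
  by do 2 case: (_ \in _); rewrite /=; ring.
- move=> F mF tF PF; rewrite /P.
  pose f n x : R := \sum_(k < n) \1_(F k `&` J) x.
  have fE n x : f n x = \1_(\bigcup_(k < n) F k `&` J) x.
    rewrite /f indicE in_setI.
    have [xJ|xJ] := boolP (x \in J); last first.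
      by rewrite andbF big1 // => k _; rewrite indicE in_setI (negbTE xJ) andbF.
    rewrite andbT.
    have [/set_mem[k kn Fkx]|xF] := boolP (x \in \bigcup_(k < n) F k).
      rewrite (bigD1 (Ordinal kn)) //= indicE in_setI mem_set // xJ big1 ?addr0 //.
      move=> i ik; rewrite indicE in_setI xJ andbT; apply/eqP; rewrite pnatr_eq0 eqb0.
      apply/negP => /set_mem Fix; move/eqP: ik; apply; apply: val_inj => /=.
      by apply: (tF i k) => //; exists x.
    rewrite big1 // => i _; rewrite indicE in_setI xJ andbT; apply/eqP; rewrite pnatr_eq0 eqb0.
    apply/negP => /set_mem Fix; move/negP: xF; apply; apply/mem_set.
    by exists i => //=; exact: ltn_ord.
  have mI (B : set R) : measurable B -> measurable_fun setT (\1_B : R -> R) by move=> mB; exact: measurable_indic.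
  apply: (@approximable_dct _ _ R leb poisson_n Kk f _ (\1_J)).
  + by move=> n; apply: (approximable_sum Kk) => k; exact: PF.
  + by apply: mI; apply: measurableI => //; exact: bigcup_measurable.
  + move=> x; apply: cvg_near_cst.
    have [[k _ Fkx]|xF] := pselect ((\bigcup_k F k) x).
      near=> n; rewrite fE !indicE !in_setI; congr ((_ && _)%:R).
      rewrite !mem_set //; first by exists k.
      by exists k => //=; near: n; exists k.+1.
    near=> n; rewrite fE !indicE !in_setI; congr ((_ && _)%:R).
    by rewrite !memNset //; apply: contra_not xF => -[k _ Fkx]; exists k.
  + exact: mI.
  + rewrite (_ : (fun x => _) = \1_J) //; apply/funext => x.
    by rewrite indicE; case: (_ \in _); rewrite /= ?expr1n ?expr0n.
  + move=> n x; rewrite fE ger0_norm ?indicE // in_setI.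
    by case: (_ \in _); case: (_ \in _) => /=; rewrite ?ler01.
Unshelve. all: by end_near. Qed.

Import HBNNSimple.

Lemma poisson_approximable_ge0 (f : R -> R) : measurable_fun setT f -> (forall x, 0 <= f x) ->
  integrable1 leb (fun x => f x ^+ 2) -> approximable leb poisson_n f.
Proof.
have Kk n : markov_kernel leb (poisson_n n) := markov_poisson (eps_gt0 n).
move=> mf f0 fi.
have mfE : measurable_fun setT (EFin \o f) by exact/measurable_EFinP.
pose g := nnsfun_approx measurableT mfE.
have gcv x : g n x @[n --> \oo] --> f x.
  have := @cvg_nnsfun_approx _ _ R setT measurableT (EFin \o f) mfE (fun x _ => f0 x) x I.
  by move/fine_cvgP => [].
have gle n x : g n x <= f x.
  have nd : nondecreasing_seq (fun n => g n x).
    by move=> p q pq; exact/lefP/nd_nnsfun_approx.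
  have := nondecreasing_cvgn_le nd (cvgP _ (gcv x)) n.
  by rewrite (cvg_lim _ (gcv x)).
(* The simple functions are cut off to []- n, n]], since the level sets of a simple function may
   have infinite measure. *)
apply: (@approximable_dct _ _ R leb poisson_n Kk (fun n x => g n x * \1_(`]- n%:R, n%:R] : set R) x) f f) => //.
- move=> n; pose s := finmap.enum_fset (fset_set (range (g n))).
  rewrite (_ : (fun x => _) = (fun x => \sum_(y <- s) (y * \1_(g n @^-1` [set y] `&` `]- n%:R, n%:R]) x))).
    apply: (approximable_sum Kk) => y; apply: (approximableZ Kk).
    by apply: poisson_approximable_indic; exact: measurable_funPTI.
  apply/funext => x; rewrite [in LHS](fimfunE (g n)) fsbig_finite //= mulr_suml.
  by apply: eq_bigr => y _; rewrite indicI mulrA.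
- move=> x; rewrite -[X in _ --> X]mulr1; apply: cvgM; first exact: gcv.
  apply: cvg_near_cst.
  have : \forall n \near \oo, `|x| < n%:R.
    by exists (Num.bound `|x|) => // n /= bn; rewrite (lt_le_trans (archi_boundP _)) ?ler_nat.
  apply: filterS => n; rewrite ltr_norml => /andP[a b].
  by rewrite indicE mem_set //= in_itv /= a ltW.
- move=> n x; rewrite ger0_norm ?mulr_ge0 ?indicE //.
  by case: (_ \in _); rewrite ?mulr1 ?mulr0.
Qed.

Lemma poisson_approximable (f : R -> R) : measurable_fun setT f ->
  integrable1 leb (fun x => f x ^+ 2) -> approximable leb poisson_n f.
Proof.
have Kk n : markov_kernel leb (poisson_n n) := markov_poisson (eps_gt0 n).
move=> mf fi.
have h (g : R -> R) : measurable_fun setT g -> (forall x, 0 <= g x <= `|f x|) ->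
    approximable leb poisson_n g.
  move=> mg gf; apply: poisson_approximable_ge0 => //; first by move=> x; case/andP: (gf x).
  apply: (integrable1_dom _ _ fi); first exact: measurable_funX.
  move=> x; have /andP[g0 gx] := gf x.
  by rewrite ger0_norm ?sqr_ge0 // -[leRHS]real_normK ?num_real // ler_sqr ?nnegrE.
rewrite (_ : f = fun x => Num.max (f x) 0 + (-1) * Num.max (- f x) 0).
  apply: (approximableD Kk); last apply: (approximableZ Kk); apply: h.
  - exact: measurable_maxr.
  - by move=> x; rewrite le_max lexx orbT /= ge_max normr_ge0 ler_norm.
  - by apply: measurable_maxr => //; exact: measurableT_comp.
  - by move=> x; rewrite le_max lexx orbT /= ge_max normr_ge0 -normrN ler_norm.
apply/funext => x; rewrite mulN1r oppr_max oppr0 opprK.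
by have [x0|x0] := leP 0 (f x); rewrite ?addr0 ?add0r // ltW.
Qed.
End poisson_approximate_identity.

(** * Sigma-finite product measures and product kernels *)

Section sigma_finite_packing.
Context d (X : measurableType d) (R : realType).
Variables (mu : {measure set X -> \bar R}) (mu_sf : sigma_finite setT mu).

(* The measures of lebn carry no sigma-finite structure, only a proof can be supplied. *)
Definition sf_measure_of (_ : sigma_finite setT mu) : set X -> \bar R := mu.

HB.instance Definition _ := Measure.on (sf_measure_of mu_sf).
HB.instance Definition _ := Measure_isSigmaFinite.Build d X R (sf_measure_of mu_sf) mu_sf.

Definition sf_measure : {sigma_finite_measure set X -> \bar R} := sf_measure_of mu_sf.
End sigma_finite_packing.

Lemma product_measure1_sigma_finite d1 d2 (X : measurableType d1) (Y : measurableType d2)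
    (R : realType) (mu : {sigma_finite_measure set X -> \bar R})
    (nu : {sigma_finite_measure set Y -> \bar R}) :
  sigma_finite setT (product_measure1 mu nu).
Proof.
have /sigma_finiteP[F [TF ndF Foo]] := sigma_finiteT mu.
have /sigma_finiteP[G [TG ndG Goo]] := sigma_finiteT nu.
exists (fun n => F n `*` G n).
  apply/seteqP; split => // -[x y] _.
  have [n _ Fnx] : (\bigcup_i F i) x by rewrite -TF.
  have [k _ Gky] : (\bigcup_i G i) y by rewrite -TG.
  exists (maxn n k) => //; split => /=.
  - by move: x Fnx; exact/subsetPset/ndF/leq_maxl.
  - by move: y Gky; exact/subsetPset/ndG/leq_maxr.
move=> k; have [mF Fk] := Foo k; have [mG Gk] := Goo k; split; first exact: measurableX.
by rewrite product_measure1E // lte_mul_pinfty // ge0_fin_numE.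
Qed.

(** The measure [\x] together with its sigma-finiteness, so that Fubini applies to products of
    products. *)
Definition prodm d1 d2 (X : measurableType d1) (Y : measurableType d2) (R : realType)
    (mu : {sigma_finite_measure set X -> \bar R})
    (nu : {sigma_finite_measure set Y -> \bar R}) :
    {sigma_finite_measure set (X * Y)%type -> \bar R} :=
  sf_measure (product_measure1_sigma_finite mu nu).

Section product_kernel.
Context d1 d2 (X : measurableType d1) (Y : measurableType d2) (R : realType).
Variables (mu : {sigma_finite_measure set X -> \bar R})
  (nu : {sigma_finite_measure set Y -> \bar R}).

Local Notation munu := (prodm mu nu).

Definition prod_kernel (K1 : X -> X -> R) (K2 : Y -> Y -> R) (p q : X * Y) :=
  K1 p.1 q.1 * K2 p.2 q.2.

Lemma measurable_kernel_comp d (Z : measurableType d) (d' : measure_display)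
    (U : measurableType d') (K : U -> U -> R) (a b : Z -> U) :
  measurable_fun setT (fun p : U * U => K p.1 p.2) ->
  measurable_fun setT a -> measurable_fun setT b ->
  measurable_fun setT (fun z => K (a z) (b z)).
Proof.
move=> mK ma mb; apply: (measurableT_comp mK (g := fun z => (a z, b z))).
exact: measurable_fun_pair.
Qed.

Lemma markov_prod K1 K2 : markov_kernel mu K1 -> markov_kernel nu K2 ->
  markov_kernel munu (prod_kernel K1 K2).
Proof.
move=> [mK1 K10 K1s K11] [mK2 K20 K2s K21]; split.
- apply: measurable_funM.
    by apply: (measurable_kernel_comp mK1); exact: measurableT_comp.
  by apply: (measurable_kernel_comp mK2); exact: measurableT_comp.
- by move=> x y; exact: mulr_ge0.
- by move=> x y; rewrite /prod_kernel K1s K2s.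
- move=> [x s]; rewrite (fubini_tonelli1 (fun q => (prod_kernel K1 K2 (x, s) q)%:E)).
  + rewrite -[RHS](K11 x); apply: eq_integral => y _; rewrite /fubini_F /prod_kernel /=.
    under eq_integral do rewrite EFinM.
    rewrite ge0_integralZl_EFin ?K21 ?mule1 //.
    * by move=> t _; rewrite lee_fin.
    * by apply/measurable_EFinP; apply: (measurable_kernel_comp mK2).
  + apply/measurable_EFinP; apply: measurable_funM => /=.
      by apply: (measurable_kernel_comp mK1).
    by apply: (measurable_kernel_comp mK2).
  + by move=> q; rewrite lee_fin mulr_ge0.
Qed.

(** Pass from (x, s) to (y, t) through the corner (y, s). Each of the two differences involves a
    single factor of the kernel; the other factor integrates to one. *)
Lemma dirichlet_prod_le K1 K2 f : markov_kernel mu K1 -> markov_kernel nu K2 ->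
  measurable_fun setT f ->
  (dirichlet munu (prod_kernel K1 K2) f <=
   2%:E * (\int[nu]_s dirichlet mu K1 (fun x => f (x, s)) +
           \int[mu]_x dirichlet nu K2 (fun s => f (x, s))))%E.
Proof.
move=> Kk1 Kk2 mf; have [mK1 K10 K1s K11] := Kk1; have [mK2 K20 K2s K21] := Kk2.
pose G (p : (X * Y) * X) := (f (p.1.1, p.1.2) - f (p.2, p.1.2)) ^+ 2 * K1 p.1.1 p.2.
pose H (p : (X * Y) * Y) := (f (p.1.1, p.2) - f (p.1.1, p.1.2)) ^+ 2 * K2 p.2 p.1.2.
have mfc d (Z : measurableType d) (a : Z -> X) (b : Z -> Y) : measurable_fun setT a ->
    measurable_fun setT b -> measurable_fun setT (fun z => f (a z, b z)).
  move=> ma mb; apply: (measurableT_comp mf (g := fun z => (a z, b z))).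
  exact: measurable_fun_pair.
have mG : measurable_fun setT G.
  apply: measurable_funM; last by apply: (measurable_kernel_comp mK1) => //; exact: measurableT_comp.
  apply: measurable_funX; apply: measurable_funB; apply: mfc => //; by apply: measurableT_comp.
have mH : measurable_fun setT H.
  apply: measurable_funM; last by apply: (measurable_kernel_comp mK2) => //; exact: measurableT_comp.
  apply: measurable_funX; apply: measurable_funB; apply: mfc => //; by apply: measurableT_comp.
have G0 p : 0 <= G p by rewrite mulr_ge0 ?sqr_ge0.
have H0 p : 0 <= H p by rewrite mulr_ge0 ?sqr_ge0.
pose GK (p : (X * Y) * (X * Y)) := (G (p.1, p.2.1) * K2 p.1.2 p.2.2)%:E.
pose HK (p : (X * Y) * (X * Y)) := (H (p.2, p.1.2) * K1 p.1.1 p.2.1)%:E.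
have mGK : measurable_fun setT GK.
  apply/measurable_EFinP; apply: measurable_funM.
    apply: (measurableT_comp mG (g := fun p : (X * Y) * (X * Y) => (p.1, p.2.1))).
    by apply: measurable_fun_pair => //; exact: measurableT_comp.
  by apply: (measurable_kernel_comp mK2); exact: measurableT_comp.
have mHK : measurable_fun setT HK.
  apply/measurable_EFinP; apply: measurable_funM.
    apply: (measurableT_comp mH (g := fun p : (X * Y) * (X * Y) => (p.2, p.1.2))).
    by apply: measurable_fun_pair => //; exact: measurableT_comp.
  by apply: (measurable_kernel_comp mK1); exact: measurableT_comp.
have GK0 p : (0 <= GK p)%E by rewrite lee_fin mulr_ge0.
have HK0 p : (0 <= HK p)%E by rewrite lee_fin mulr_ge0.
have EG : (\int[(munu \x munu)]_p GK p = \int[nu]_s dirichlet mu K1 (fun x => f (x, s)))%E.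
  rewrite (fubini_tonelli1 GK) //.
  transitivity (\int[munu]_p \int[mu]_y (G (p, y))%:E)%E.
    apply: eq_integral => -[x s] _; rewrite /fubini_F.
    rewrite (fubini_tonelli1 (fun q => GK ((x, s), q))) //; last exact: measurableT_comp.
    apply: eq_integral => y _; rewrite /fubini_F /GK /=.
    under eq_integral do rewrite EFinM.
    rewrite ge0_integralZl_EFin ?K21 ?mule1 //.
    + by move=> t _; rewrite lee_fin.
    + by apply/measurable_EFinP; apply: (measurable_kernel_comp mK2).
  rewrite (fubini_tonelli2 (fun p => \int[mu]_y (G (p, y))%:E)%E); last 2 first.
  + by apply: (measurable_fun_fubini_tonelli_F (EFin \o G)) => //; exact/measurable_EFinP.
  + by move=> p; apply: integral_ge0 => y _; rewrite lee_fin.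
  apply: eq_integral => s _; rewrite /fubini_G /dirichlet.
  rewrite (fubini_tonelli1 (fun q : X * X => ((f (q.1, s) - f (q.2, s)) ^+ 2 * K1 q.1 q.2)%:E)) //.
  + apply/measurable_EFinP; apply: (measurable_dirichlet Kk1 (f := fun x => f (x, s))).
    by apply: mfc.
  + by move=> q; rewrite lee_fin mulr_ge0 ?sqr_ge0.
have EH : (\int[(munu \x munu)]_p HK p = \int[mu]_x dirichlet nu K2 (fun s => f (x, s)))%E.
  rewrite (fubini_tonelli2 HK) //.
  transitivity (\int[munu]_p \int[nu]_s (H (p, s))%:E)%E.
    apply: eq_integral => -[y t] _; rewrite /fubini_G.
    rewrite (fubini_tonelli2 (fun q => HK (q, (y, t)))) //; last exact: measurableT_comp.
    apply: eq_integral => s _; rewrite /fubini_G /HK /=.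
    under eq_integral do rewrite EFinM K1s.
    rewrite ge0_integralZl_EFin ?K11 ?mule1 //.
    + by move=> x _; rewrite lee_fin.
    + by apply/measurable_EFinP; apply: (measurable_kernel_comp mK1).
  rewrite (fubini_tonelli1 (fun p => \int[nu]_s (H (p, s))%:E)%E); last 2 first.
  + by apply: (measurable_fun_fubini_tonelli_F (EFin \o H)) => //; exact/measurable_EFinP.
  + by move=> p; apply: integral_ge0 => y _; rewrite lee_fin.
  apply: eq_integral => y _; rewrite /fubini_F /dirichlet.
  rewrite (fubini_tonelli2 (fun q : Y * Y => ((f (y, q.1) - f (y, q.2)) ^+ 2 * K2 q.1 q.2)%:E)) //.
  + apply/measurable_EFinP; apply: (measurable_dirichlet Kk2 (f := fun s => f (y, s))).
    by apply: mfc.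
  + by move=> q; rewrite lee_fin mulr_ge0 ?sqr_ge0.
rewrite -EG -EH -ge0_integralD // -ge0_integralZl_EFin //; last 2 first.
- by move=> p _; exact: adde_ge0.
- exact: emeasurable_funD.
apply: ge0_le_integral => //.
- by move=> p _; rewrite lee_fin mulr_ge0 ?sqr_ge0 // /prod_kernel mulr_ge0.
- by apply/measurable_EFinP; apply: (measurable_dirichlet (markov_prod Kk1 Kk2) mf).
- by apply: emeasurable_funM => //; exact: emeasurable_funD.
- move=> [[x s] [y t]] _; rewrite /GK /HK /G /H /prod_kernel /= -EFinD -EFinM lee_fin.
  rewrite (_ : 2 * _ = (2 * (f (x, s) - f (y, s)) ^+ 2 + 2 * (f (y, s) - f (y, t)) ^+ 2) * (K1 x y * K2 s t)); last by ring.
  rewrite ler_wpM2r ?mulr_ge0 // (_ : f (x, s) - f (y, t) = (f (x, s) - f (y, s)) + (f (y, s) - f (y, t))); last by ring.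
  exact: sqrD_le.
Qed.

(** Almost every section of [f] is square-integrable, so its form tends to 0. [dirichlet_le] on
    sections gives an integrable majorant, and [dirichlet_prod_le] recombines the two directions. *)
Lemma approximable_prod (K1 : nat -> X -> X -> R) (K2 : nat -> Y -> Y -> R) :
  (forall n, markov_kernel mu (K1 n)) -> (forall n, markov_kernel nu (K2 n)) ->
  (forall f : X -> R, measurable_fun setT f -> integrable1 mu (fun x => f x ^+ 2) -> approximable mu K1 f) ->
  (forall f : Y -> R, measurable_fun setT f -> integrable1 nu (fun x => f x ^+ 2) -> approximable nu K2 f) ->
  forall f : X * Y -> R, measurable_fun setT f -> integrable1 munu (fun x => f x ^+ 2) ->
  approximable munu (fun n => prod_kernel (K1 n) (K2 n)) f.
Proof.
move=> Kk1 Kk2 A1 A2 f mf fi; split => //.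
have mfc d (Z : measurableType d) (a : Z -> X) (b : Z -> Y) : measurable_fun setT a ->
    measurable_fun setT b -> measurable_fun setT (fun z => f (a z, b z)).
  move=> ma mb; apply: (measurableT_comp mf (g := fun z => (a z, b z))).
  exact: measurable_fun_pair.
have mf1 s : measurable_fun setT (fun x => f (x, s)) by exact: measurableT_comp.
have mf2 x : measurable_fun setT (fun s => f (x, s)) by exact: measurableT_comp.
have mfX : measurable_fun setT (fun p => f p ^+ 2) by exact: measurable_funX.
have iE : (\int[mu \x nu]_p (f p ^+ 2)%:E < +oo)%E.
  by rewrite (integrable1_EFin fi) ltry.
have mE1 n : measurable_fun setT (fun s => dirichlet mu (K1 n) (fun x => f (x, s))).
  (* By definition the form of a section is itself a Fubini integral over the pairs, so Tonelli
     gives its measurability in [s]. *)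
  have -> : (fun s => dirichlet mu (K1 n) (fun x => f (x, s))) =
    fubini_G (prodm mu mu) (fun q : (X * X) * Y => ((f (q.1.1, q.2) - f (q.1.2, q.2)) ^+ 2 * K1 n q.1.1 q.1.2)%:E) by [].
  apply: measurable_fun_fubini_tonelli_G.
    have [mK _ _ _] := Kk1 n.
    apply/measurable_EFinP; apply: measurable_funM; last first.
      by apply: (measurable_kernel_comp mK); exact: measurableT_comp.
    by apply: measurable_funX; apply: measurable_funB; apply: mfc => //; exact: measurableT_comp.
  by move=> q; have [_ K0 _ _] := Kk1 n; rewrite lee_fin mulr_ge0 ?sqr_ge0.
have mE2 n : measurable_fun setT (fun x => dirichlet nu (K2 n) (fun s => f (x, s))).
  have -> : (fun x => dirichlet nu (K2 n) (fun s => f (x, s))) =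
    fubini_F (prodm nu nu) (fun q : X * (Y * Y) => ((f (q.1, q.2.1) - f (q.1, q.2.2)) ^+ 2 * K2 n q.2.1 q.2.2)%:E) by [].
  apply: measurable_fun_fubini_tonelli_F.
    have [mK _ _ _] := Kk2 n.
    apply/measurable_EFinP; apply: measurable_funM; last first.
      by apply: (measurable_kernel_comp mK); exact: measurableT_comp.
    by apply: measurable_funX; apply: measurable_funB; apply: mfc => //; exact: measurableT_comp.
  by move=> q; have [_ K0 _ _] := Kk2 n; rewrite lee_fin mulr_ge0 ?sqr_ge0.
have mfXE : measurable_fun setT (fun p => (f p ^+ 2)%:E) by exact/measurable_EFinP.
have fXE0 p : (0 <= (f p ^+ 2)%:E)%E by rewrite lee_fin sqr_ge0.
have c1 : (\int[nu]_s dirichlet mu (K1 n) (fun x => f (x, s)) @[n --> \oo] --> 0)%E.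
  have [|||||_ _] := @dominated_convergence _ Y R nu setT measurableT
    (fun n s => dirichlet mu (K1 n) (fun x => f (x, s))) (cst 0%E)
    (fun s => 4%:E * \int[mu]_x (f (x, s) ^+ 2)%:E)%E.
  - exact: mE1.
  - exact: measurable_cst.
  - apply: filterS (integrable1_ae2 fi) => s fsi _.
    by have [] := A1 _ (mf1 s) fsi.
  - apply: integrableZl => //; apply/integrableP; split.
      exact: (measurable_fun_fubini_tonelli_G (fun p => (f p ^+ 2)%:E)).
    under eq_integral do rewrite gee0_abs ?integral_ge0 //.
    by rewrite -(fubini_tonelli2 (fun p => (f p ^+ 2)%:E)).
  - apply: aeW => s n _; rewrite gee0_abs ?dirichlet_ge0 //.
    exact: dirichlet_le.
  by rewrite integral_cst // mul0e.
have c2 : (\int[mu]_x dirichlet nu (K2 n) (fun s => f (x, s)) @[n --> \oo] --> 0)%E.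
  have [|||||_ _] := @dominated_convergence _ X R mu setT measurableT
    (fun n x => dirichlet nu (K2 n) (fun s => f (x, s))) (cst 0%E)
    (fun x => 4%:E * \int[nu]_s (f (x, s) ^+ 2)%:E)%E.
  - exact: mE2.
  - exact: measurable_cst.
  - apply: filterS (integrable1_ae1 fi) => x fxi _.
    by have [] := A2 _ (mf2 x) fxi.
  - apply: integrableZl => //; apply/integrableP; split.
      exact: (measurable_fun_fubini_tonelli_F (fun p => (f p ^+ 2)%:E)).
    under eq_integral do rewrite gee0_abs ?integral_ge0 //.
    by rewrite -(fubini_tonelli1 (fun p => (f p ^+ 2)%:E)).
  - apply: aeW => x n _; rewrite gee0_abs ?dirichlet_ge0 //.
    exact: dirichlet_le.
  by rewrite integral_cst // mul0e.
apply: (@squeeze_cvge _ _ _ _ (cst 0%E) _ (fun n => 2%:E *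
   (\int[nu]_s dirichlet mu (K1 n) (fun x => f (x, s)) +
    \int[mu]_x dirichlet nu (K2 n) (fun s => f (x, s)))))%E.
- apply: nearW => n; rewrite dirichlet_ge0 ?dirichlet_prod_le //.
  exact: markov_prod.
- exact: cvg_cst.
- have c12 := cvgeD (isT : ((0 : \bar R) +? 0)%E) c1 c2.
  by have := cvgeZl (y := 2%:E) isT (c12 _); rewrite adde0 mule0; exact.
Qed.
End product_kernel.

(** * Poisson kernels in several variables *)

Section lebesgue_Rd.
Context (R : realType).
Notation X n := (mT (lebn R n)).

Lemma lebn_sigma_finite n : sigma_finite setT (mmu (lebn R n)).
Proof.
elim: n => [|n IH] /=.
  exists (fun=> setT); first by rewrite bigcup_const.
  by move=> i; split => //; rewrite diracT ltry.
exact: (product_measure1_sigma_finite (sf_measure IH) (@lebesgue_measure R)).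
Qed.

Definition Leb n : {sigma_finite_measure set X n -> \bar R} := sf_measure (lebn_sigma_finite n).

Definition co n (x : X n) (j : 'I_n) : R := fromcoord x 0 j.

Lemma co_max n (x : X n.+1) : co x ord_max = x.2.
Proof. by rewrite /co /= mxE unlift_none. Qed.

Lemma co_lift n (x : X n.+1) (j : 'I_n) : co x (lift ord_max j) = co (x.1 : X n) j.
Proof. by rewrite /co /= mxE liftK. Qed.

Lemma measurable_co n (j : 'I_n) : measurable_fun setT (fun x : X n => co x j).
Proof.
elim: n j => [[]//|n IH] j; have [k ->|->] := unliftP ord_max j.
  under eq_fun do rewrite co_lift.
  exact: (measurableT_comp (IH k) (@measurable_fst _ _ (X n) R)).
by under eq_fun do rewrite co_max; exact: (@measurable_snd _ _ (X n) R).
Qed.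

Definition dotn n (x y : X n) : R := \sum_j co x j * co y j.

Lemma dotnS n (x y : X n.+1) : dotn x y = dotn (x.1 : X n) (y.1 : X n) + x.2 * y.2.
Proof.
rewrite /dotn big_ord_recr /=; congr (_ + _); last by rewrite !co_max.
apply: eq_bigr => j _; rewrite -!co_lift.
by rewrite (_ : widen_ord _ j = lift ord_max j) //; apply: ord_inj; rewrite lift_max.
Qed.

Lemma measurable_dotn n d (Z : measurableType d) (a b : Z -> X n) :
  measurable_fun setT a -> measurable_fun setT b ->
  measurable_fun setT (fun z => dotn (a z) (b z)).
Proof.
move=> ma mb; apply: measurable_sum => j; apply: measurable_funM.
  exact: (measurableT_comp (measurable_co j) (g := a)).
exact: (measurableT_comp (measurable_co j) (g := b)).
Qed.

Fixpoint weight n (e : R) : X n -> R :=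
  match n return X n -> R with
  | 0 => fun=> 1
  | n'.+1 => fun x => @weight n' e x.1 * laplace_weight e x.2
  end.

Fixpoint kernel n (e : R) : X n -> X n -> R :=
  match n return X n -> X n -> R with
  | 0 => fun _ _ => 1
  | n'.+1 => fun x y => @kernel n' e x.1 y.1 * poisson e x.2 y.2
  end.

Lemma weight_ge0 n e (x : X n) : 0 <= weight e x.
Proof.
elim: n x => [|n IH] x //=; apply: mulr_ge0; [exact: IH|exact: laplace_weight_ge0].
Qed.

Lemma weight_le n e e' (x : X n) : e <= e' -> weight e' x <= weight e x.
Proof.
move=> ee; elim: n x => [|n IH] x //=.
by apply: ler_pM; rewrite ?weight_ge0 ?laplace_weight_ge0 ?IH ?laplace_weight_le.
Qed.

Lemma weight_gt0 n e (x : X n) : 0 < weight e x.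
Proof.
elim: n x => [|n IH] x //=; apply: mulr_gt0; first exact: IH.
by rewrite divr_gt0 ?expR_gt0 ?mulr_gt0 ?pi_gt0.
Qed.

Lemma integrable1_weight n e : 0 < e -> integrable1 (Leb n) (@weight n e).
Proof.
move=> e0; elim: n => [|n IH].
  have -> : @weight 0 e = fun=> 1 by [].
  apply/integrableP; split; first exact: measurable_cst.
  by rewrite integral_cst //= normr1 diracT mule1 ltry.
exact: (integrable1_tensor IH (integrable1_laplace e0)).
Qed.

Lemma markov_kerneln n e : 0 < e -> markov_kernel (Leb n) (@kernel n e).
Proof.
move=> e0; elim: n => [|n IH]; last exact: (markov_prod IH (markov_poisson e0)).
have -> : @kernel 0 e = fun _ _ => 1 by [].
by split => // x; rewrite integral_cst //= diracT mule1.
Qed.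

(** Induction on the dimension with a general phase [c]: the last coordinate is integrated first,
    and what the others contribute to the argument acts as a constant phase. *)
Lemma weight_fourier n e (x y : X n) c : 0 < e ->
  \int[Leb n]_z (weight e z * cos (c + (dotn z x - dotn z y))) = cos c * kernel e x y.
Proof.
move=> e0; elim: n x y c => [|n IH] x y c.
  transitivity (\int[Leb 0]_z (cos c)).
    by apply: eq_Rintegral => z _; rewrite /dotn !big_ord0 subr0 addr0 mul1r.
  have L1 : (Leb 0) setT = 1%E by exact: diracT.
  by rewrite Rintegral_cst //; congr (_ * _); exact: (congr1 fine L1).
pose A (z : X n) := dotn z (x.1 : X n) - dotn z (y.1 : X n).
pose h (z : X n * measurableTypeR R) := weight e z.1 * laplace_weight e z.2 *
  cos ((c + A z.1) + z.2 * (x.2 - y.2)).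
transitivity (\int[(Leb n \x @lebesgue_measure R)%E]_z h z).
  apply: eq_Rintegral => z _; rewrite /h /= !dotnS /A; congr (_ * cos _); ring.
have iw := integrable1_weight n e0; have il := integrable1_laplace e0.
have mA : measurable_fun setT A.
  by apply: measurable_funB; apply: measurable_dotn.
have mh : measurable_fun setT h.
  apply: measurable_funM.
    apply: measurable_funM.
      exact: (measurableT_comp (integrable1_meas iw) measurable_fst).
    exact: (measurableT_comp (integrable1_meas il) measurable_snd).
  apply: (measurableT_comp (f := @cos R)).
    exact: continuous_measurable_fun (@continuous_cos R).
  apply: measurable_funD; last by apply: measurable_funM.
  by apply: measurable_funD => //; exact: (measurableT_comp mA measurable_fst).
have hi : integrable1 (Leb n \x @lebesgue_measure R)%E h.
  apply: (integrable1_dom mh _ (integrable1_tensor iw il)) => z.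
  have w0 := mulr_ge0 (weight_ge0 e z.1) (laplace_weight_ge0 e z.2).
  by rewrite /h normrM (ger0_norm w0); apply: ler_piMr; rewrite ?norm_cos_le1.
rewrite (Rint_fubini1 hi).
transitivity (\int[Leb n]_z (poisson e x.2 y.2 * (weight e z * cos (c + A z)))).
  apply: eq_Rintegral => z _; rewrite /h /=.
  under eq_Rintegral do rewrite -mulrA.
  rewrite RintegralZl //.
    by rewrite laplace_fourier // /poisson; ring.
  apply: (integrable1_dom _ _ il).
    apply: measurable_funM; first exact: integrable1_meas il.
    apply: (measurableT_comp (f := @cos R)).
      exact: continuous_measurable_fun (@continuous_cos R).
    by apply: measurable_funD => //; apply: measurable_funM.
  move=> t; rewrite normrM ger0_norm ?laplace_weight_ge0 //.
  by apply: ler_piMr; rewrite ?norm_cos_le1 ?laplace_weight_ge0.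
rewrite RintegralZl //.
  by rewrite IH /=; ring.
apply: (integrable1_dom _ _ iw).
  apply: measurable_funM; first exact: integrable1_meas iw.
  apply: (measurableT_comp (f := @cos R)).
    exact: continuous_measurable_fun (@continuous_cos R).
  by apply: measurable_funD.
move=> t; rewrite normrM ger0_norm ?weight_ge0 //.
by apply: ler_piMr; rewrite ?norm_cos_le1 ?weight_ge0.
Qed.

Lemma kernel_approximable n (f : X n -> R) : measurable_fun setT f ->
  integrable1 (Leb n) (fun x => f x ^+ 2) ->
  approximable (Leb n) (fun m => @kernel n (eps R m)) f.
Proof.
(* In dimension 0 the space is a single point, so all differences vanish. *)
elim: n f => [|n IH] f mf fi.
  split => //; rewrite (_ : (fun m => _) = fun=> 0%E); first exact: cvg_cst.
  apply/funext => m; rewrite /dirichlet.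
  under eq_integral => p _.
    rewrite (_ : p.1 = p.2) ?subrr ?expr0n ?mul0r; last by case: p => -[] [].
    over.
  by rewrite integral0.
have K1 m := @markov_kerneln n _ (eps_gt0 R m).
have K2 m := markov_poisson (eps_gt0 R m).
have := approximable_prod K1 K2 IH (@poisson_approximable R) mf fi.
exact.
Qed.
End lebesgue_Rd.

(** * Cosine and sine transforms *)

Section transform.
Context dX dY (X : measurableType dX) (Y : measurableType dY) (R : realType).
Variables (mu : {sigma_finite_measure set X -> \bar R})
  (nu : {sigma_finite_measure set Y -> \bar R}).
Variable (th : Y -> X -> R).
Hypothesis mth : measurable_fun setT (fun p : Y * X => th p.1 p.2).
Implicit Types (f g h : X -> R) (K : X -> X -> R).

(** Cosine and sine transforms for an abstract phase [th]. Later the phase is the scalar product;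
    its only link to the kernels is the identity [WK]. *)
Definition hc f (xi : Y) : R := \int[mu]_x (f x * cos (th xi x)).
Definition hs f (xi : Y) : R := \int[mu]_x (f x * sin (th xi x)).

Lemma measurable_cosf d (Z : measurableType d) (a : Z -> R) : measurable_fun setT a ->
  measurable_fun setT (fun z => cos (a z)).
Proof.
move=> ma; apply: (measurableT_comp (f := @cos R)) => //.
exact: continuous_measurable_fun (@continuous_cos R).
Qed.

Lemma measurable_sinf d (Z : measurableType d) (a : Z -> R) : measurable_fun setT a ->
  measurable_fun setT (fun z => sin (a z)).
Proof.
move=> ma; apply: (measurableT_comp (f := @sin R)) => //.
exact: continuous_measurable_fun (@continuous_sin R).
Qed.

Lemma measurable_th2 xi : measurable_fun setT (th xi).
Proof. exact: (measurable_prod1 xi mth). Qed.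

Lemma measurable_th_comp d (Z : measurableType d) (a : Z -> Y) (b : Z -> X) :
  measurable_fun setT a -> measurable_fun setT b ->
  measurable_fun setT (fun z => th (a z) (b z)).
Proof.
move=> ma mb; apply: (measurableT_comp mth (g := fun z => (a z, b z))).
exact: measurable_fun_pair.
Qed.

Lemma integrable1_cos f xi : integrable1 mu f -> integrable1 mu (fun x => f x * cos (th xi x)).
Proof.
apply: (@integrable1_bndMr _ _ _ _ 1) => [|x]; last exact: norm_cos_le1.
by apply: measurable_cosf; exact: measurable_th2.
Qed.

Lemma integrable1_sin f xi : integrable1 mu f -> integrable1 mu (fun x => f x * sin (th xi x)).
Proof.
apply: (@integrable1_bndMr _ _ _ _ 1) => [|x]; last exact: norm_sin_le1.
by apply: measurable_sinf; exact: measurable_th2.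
Qed.

Lemma norm_hc f xi : integrable1 mu f -> `|hc f xi| <= \int[mu]_x `|f x|.
Proof.
move=> fi; apply: Rint_norm_le; first exact: integrable1_norm.
  exact: integrable1_meas (integrable1_cos xi fi).
by move=> x; rewrite normrM ler_piMr ?norm_cos_le1.
Qed.

Lemma norm_hs f xi : integrable1 mu f -> `|hs f xi| <= \int[mu]_x `|f x|.
Proof.
move=> fi; apply: Rint_norm_le; first exact: integrable1_norm.
  exact: integrable1_meas (integrable1_sin xi fi).
by move=> x; rewrite normrM ler_piMr ?norm_sin_le1.
Qed.

Lemma measurable_hc_family d (Z : measurableType d) (F : Z -> X -> R) (a : Z -> Y) :
  measurable_fun setT (fun p : Z * X => F p.1 p.2) -> measurable_fun setT a ->
  measurable_fun setT (fun z => hc (F z) (a z)).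
Proof.
move=> mF ma.
apply: (@measurable_Rint2 _ _ Z X R mu (fun p => F p.1 p.2 * cos (th (a p.1) p.2))).
apply: measurable_funM => //; apply: measurable_cosf.
by apply: measurable_th_comp => //; exact: (measurableT_comp ma measurable_fst).
Qed.

Lemma measurable_hs_family d (Z : measurableType d) (F : Z -> X -> R) (a : Z -> Y) :
  measurable_fun setT (fun p : Z * X => F p.1 p.2) -> measurable_fun setT a ->
  measurable_fun setT (fun z => hs (F z) (a z)).
Proof.
move=> mF ma.
apply: (@measurable_Rint2 _ _ Z X R mu (fun p => F p.1 p.2 * sin (th (a p.1) p.2))).
apply: measurable_funM => //; apply: measurable_sinf.
by apply: measurable_th_comp => //; exact: (measurableT_comp ma measurable_fst).
Qed.

Lemma measurable_hc f : measurable_fun setT f -> measurable_fun setT (hc f).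
Proof.
move=> mf; apply: (@measurable_hc_family _ Y (fun=> f) id) => //.
exact: (measurableT_comp mf measurable_snd).
Qed.

Lemma measurable_hs f : measurable_fun setT f -> measurable_fun setT (hs f).
Proof.
move=> mf; apply: (@measurable_hs_family _ Y (fun=> f) id) => //.
exact: (measurableT_comp mf measurable_snd).
Qed.

Section weighted.
Variables (W : Y -> R) (K : X -> X -> R).
Hypotheses (W0 : forall xi, 0 <= W xi) (Wi : integrable1 nu W).
Hypothesis Kk : markov_kernel mu K.
Hypothesis WK : forall x y, \int[nu]_xi (W xi * cos (th xi x - th xi y)) = K x y.

(** Real part of the weighted Hermitian product of the transforms of [f] and [g]. *)
Definition spectral f g := \int[nu]_xi (W xi * (hc f xi * hc g xi + hs f xi * hs g xi)).

Lemma spectralC f g : spectral f g = spectral g f.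
Proof. by apply: eq_Rintegral => xi _; rewrite (mulrC (hc f xi)) (mulrC (hs f xi)). Qed.

Lemma integrable1_spectral f g : integrable1 mu f -> integrable1 mu g ->
  integrable1 nu (fun xi => W xi * (hc f xi * hc g xi + hs f xi * hs g xi)).
Proof.
move=> fi gi; have mf := integrable1_meas fi; have mg := integrable1_meas gi.
set a := \int[mu]_x `|f x|; set b := \int[mu]_x `|g x|.
have b0 : 0 <= b by apply: Rintegral_ge0.
apply: (@integrable1_bndMr _ _ _ _ (a * b + a * b)) => //.
  apply: measurable_funD.
    exact: measurable_funM (measurable_hc mf) (measurable_hc mg).
  exact: measurable_funM (measurable_hs mf) (measurable_hs mg).
move=> xi; apply: (le_trans (ler_normD _ _)); rewrite !normrM; apply: lerD.
  exact: ler_pM (normr_ge0 _) (normr_ge0 _) (norm_hc xi fi) (norm_hc xi gi).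
exact: ler_pM (normr_ge0 _) (normr_ge0 _) (norm_hs xi fi) (norm_hs xi gi).
Qed.

(** The formula for cos(a - b) turns the product of transforms into a double integral over X, and
    Fubini then lets [WK] carry out the integral in frequency. *)
Lemma spectral_kernel f g : integrable1 mu f -> integrable1 mu g ->
  integrable1 (mu \x mu)%E (fun p => f p.1 * g p.2 * K p.1 p.2) /\
  spectral f g = \int[(mu \x mu)%E]_p (f p.1 * g p.2 * K p.1 p.2).
Proof.
move=> fi gi; have mf := integrable1_meas fi; have mg := integrable1_meas gi.
have fgi := integrable1_tensor fi gi.
pose H (q : (X * X) * Y) := f q.1.1 * g q.1.2 * W q.2 * cos (th q.2 q.1.1 - th q.2 q.1.2).
have mH : measurable_fun setT H.
  apply: measurable_funM.
    apply: measurable_funM; last exact: (measurableT_comp (integrable1_meas Wi) measurable_snd).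
    exact: (measurableT_comp (integrable1_meas fgi) measurable_fst).
  by apply: measurable_cosf; apply: measurable_funB; apply: measurable_th_comp => //;
    exact: measurableT_comp.
have Hi : integrable1 (prodm mu mu \x nu)%E H.
  have ti := integrable1_tensor (mu := prodm mu mu) (integrable1_norm fgi) Wi.
  apply: (integrable1_dom mH _ ti) => q; rewrite /H normrM.
  rewrite (le_trans (ler_piMr _ (norm_cos_le1 _))) // normrM (ger0_norm (W0 _)) //.
have E1 (p : X * X) : \int[nu]_xi H (p, xi) = f p.1 * g p.2 * K p.1 p.2.
  rewrite -WK -RintegralZl //.
    by apply: eq_Rintegral => xi _; rewrite /H /= !mulrA.
  apply: (integrable1_bndMr _ (fun _ => norm_cos_le1 _)) => //.
  by apply: measurable_cosf; apply: measurable_funB; apply: measurable_th_comp.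
have E2 xi : \int[(mu \x mu)%E]_p H (p, xi) = W xi * (hc f xi * hc g xi + hs f xi * hs g xi).
  rewrite /hc /hs -!Rint_tensor; try by [exact: integrable1_cos|exact: integrable1_sin].
  rewrite -RintegralD //; last 2 first.
  - exact: (integrable1_tensor (integrable1_cos xi fi) (integrable1_cos xi gi)).
  - exact: (integrable1_tensor (integrable1_sin xi fi) (integrable1_sin xi gi)).
  rewrite -RintegralZl //; last first.
    exact: (integrable1D (integrable1_tensor (integrable1_cos xi fi) (integrable1_cos xi gi))
      (integrable1_tensor (integrable1_sin xi fi) (integrable1_sin xi gi))).
  by apply: eq_Rintegral => p _; rewrite /H /= cosB; ring.
split.
  have [mK K0 _ _] := Kk.
  (* [WK] bounds the kernel by the mass of the weight, so integrability follows from that of the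
     tensor product of [f] and [g]. *)
  apply: (@integrable1_bndMr _ _ _ _ (\int[nu]_xi W xi)) => // p.
  rewrite -WK; apply: Rint_norm_le => //.
    apply: measurable_funM; first exact: integrable1_meas Wi.
    by apply: measurable_cosf; apply: measurable_funB; apply: measurable_th_comp.
  by move=> xi; rewrite normrM (ger0_norm (W0 _)) ler_piMr ?norm_cos_le1.
transitivity (\int[nu]_xi \int[(mu \x mu)%E]_p H (p, xi)).
  by apply: eq_Rintegral => xi _; rewrite E2.
rewrite -[LHS](Rint_fubini2 (mu := prodm mu mu) Hi) (Rint_fubini1 (mu := prodm mu mu) Hi).
by apply: eq_Rintegral => p _; rewrite E1.
Qed.

Lemma markov_fst_real h : integrable1 mu h ->
  integrable1 (mu \x mu)%E (fun p => h p.1 * K p.1 p.2) /\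
  \int[(mu \x mu)%E]_p (h p.1 * K p.1 p.2) = \int[mu]_x h x.
Proof.
move=> hi; have mh := integrable1_meas hi; have [mK K0 Ks K1] := Kk.
have mhK : measurable_fun setT (fun p : X * X => h p.1 * K p.1 p.2).
  by apply: measurable_funM => //; exact: measurable_fst1.
have i1 : integrable1 (mu \x mu)%E (fun p => h p.1 * K p.1 p.2).
  apply: (integrable1_dom (g := fun p : X * X => `|h p.1| * K p.1 p.2)) => //.
    by move=> p; rewrite normrM (ger0_norm (K0 _ _)).
  apply: ge0_integrable1.
  - by apply: measurable_funM => //; apply: (measurable_fst1 (f := fun x => `|h x|)); exact: measurableT_comp.
  - by move=> p; rewrite mulr_ge0.
  - rewrite (markov_fst Kk (h := fun x => `|h x|)) //; last exact: measurableT_comp.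
    by rewrite (integrable1_EFin (integrable1_norm hi)) ltry.
split => //; rewrite (Rint_fubini1 i1); apply: eq_Rintegral => x _ /=.
have Ki : integrable1 mu (K x).
  apply: ge0_integrable1 => //; last by rewrite K1 ltry.
  exact: (measurable_prod1 x (h := fun p => K p.1 p.2)).
rewrite RintegralZl // /Rintegral K1 mulr1 //.
Qed.

Lemma markov_snd_real h : integrable1 mu h ->
  integrable1 (mu \x mu)%E (fun p => h p.2 * K p.1 p.2) /\
  \int[(mu \x mu)%E]_p (h p.2 * K p.1 p.2) = \int[mu]_x h x.
Proof.
move=> hi; have mh := integrable1_meas hi; have [mK K0 Ks K1] := Kk.
have mhK : measurable_fun setT (fun p : X * X => h p.2 * K p.1 p.2).
  by apply: measurable_funM => //; exact: measurable_snd1.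
have i1 : integrable1 (mu \x mu)%E (fun p => h p.2 * K p.1 p.2).
  apply: (integrable1_dom (g := fun p : X * X => `|h p.2| * K p.1 p.2)) => //.
    by move=> p; rewrite normrM (ger0_norm (K0 _ _)).
  apply: ge0_integrable1.
  - by apply: measurable_funM => //; apply: (measurable_snd1 (f := fun x => `|h x|)); exact: measurableT_comp.
  - by move=> p; rewrite mulr_ge0.
  - rewrite (markov_snd Kk (h := fun x => `|h x|)) //; last exact: measurableT_comp.
    by rewrite (integrable1_EFin (integrable1_norm hi)) ltry.
split => //; rewrite (Rint_fubini2 i1); apply: eq_Rintegral => y _ /=.
have Ki : integrable1 mu (K y).
  apply: ge0_integrable1 => //; last by rewrite K1 ltry.
  exact: (measurable_prod1 y (h := fun p => K p.1 p.2)).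
under eq_Rintegral do rewrite Ks.
rewrite RintegralZl // /Rintegral K1 mulr1 //.
Qed.

Lemma integrable1_sqr_bnd M f : integrable1 mu f -> (forall x, `|f x| <= M) ->
  integrable1 mu (fun x => f x ^+ 2).
Proof.
move=> fi fM; under [X in EFin \o X]eq_fun do rewrite expr2.
by apply: (integrable1_bndMl _ fM) => //; exact: integrable1_meas fi.
Qed.

Definition dirichletR f := fine (dirichlet mu K f).

Lemma dirichlet_real f : measurable_fun setT f -> integrable1 mu (fun x => f x ^+ 2) ->
  [/\ integrable1 (mu \x mu)%E (fun p => (f p.1 - f p.2) ^+ 2 * K p.1 p.2),
    dirichletR f = \int[(mu \x mu)%E]_p ((f p.1 - f p.2) ^+ 2 * K p.1 p.2),
    0 <= dirichletR f & dirichletR f <= 4 * \int[mu]_x (f x ^+ 2)].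
Proof.
move=> mf f2; have [mK K0 Ks K1] := Kk.
have D := dirichlet_le Kk mf; rewrite (integrable1_EFin f2) in D.
have Dfin : dirichlet mu K f \is a fin_num.
  by rewrite ge0_fin_numE ?dirichlet_ge0 // (le_lt_trans D) // -EFinM ltry.
split => //.
- apply: ge0_integrable1; first exact: measurable_dirichlet.
    by move=> p; rewrite mulr_ge0 ?sqr_ge0.
  by rewrite -ge0_fin_numE //; exact: dirichlet_ge0.
- by rewrite fine_ge0 // dirichlet_ge0.
- by rewrite -lee_fin fineK // (le_trans D).
Qed.

(** The upper half of Plancherel: f(x) f(y) <= (f(x)^2 + f(y)^2) / 2, and the kernel has mass one in
    each variable. *)
Lemma spectral_le f M : integrable1 mu f -> (forall x, `|f x| <= M) ->
  spectral f f <= \int[mu]_x (f x ^+ 2).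
Proof.
move=> fi fM; have [i1 ->] := spectral_kernel fi fi; have [mK K0 Ks K1] := Kk.
have f2 := integrable1_sqr_bnd fi fM.
have [j1 E1] := markov_fst_real f2; have [j2 E2] := markov_snd_real f2.
apply: (@le_trans _ _ (\int[(mu \x mu)%E]_p (2^-1 * (f p.1 ^+ 2 * K p.1 p.2 + f p.2 ^+ 2 * K p.1 p.2)))).
  apply: Rint_le => //; first by apply: integrable1Z; exact: integrable1D.
  move=> p; rewrite -mulrDl mulrA ler_wpM2r //.
  rewrite -subr_ge0 (_ : _ - _ = 2^-1 * (f p.1 - f p.2) ^+ 2); last by field.
  by rewrite mulr_ge0 ?sqr_ge0 ?invr_ge0.
rewrite RintegralZl //; last exact: integrable1D.
rewrite RintegralD // E1 E2; lra.
Qed.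

(** The lower half of Plancherel. Symmetrized, f(x) g(y) + g(x) f(y) equals f(x) g(x) + f(y) g(y) -
    (f(x) - f(y)) (g(x) - g(y)), and the last product is at most half the sum of the squares.
    Halving the symmetrized inequality gives the factor 1/4. *)
Lemma spectral_ge f g M : integrable1 mu f -> integrable1 mu g ->
  (forall x, `|f x| <= M) -> (forall x, `|g x| <= M) ->
  \int[mu]_x (f x * g x) - (dirichletR f + dirichletR g) / 4 <= spectral f g.
Proof.
move=> fi gi fM gM; have mf := integrable1_meas fi; have mg := integrable1_meas gi.
have [mK K0 Ks K1] := Kk.
have [i1 E1] := spectral_kernel fi gi; have [i2 E2] := spectral_kernel gi fi.
have fg : integrable1 mu (fun x => f x * g x) by apply: (integrable1_bndMl mf fM).
have [j1 F1] := markov_fst_real fg; have [j2 F2] := markov_snd_real fg.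
have [q1 Q1 _ _] := dirichlet_real mf (integrable1_sqr_bnd fi fM).
have [q2 Q2 _ _] := dirichlet_real mg (integrable1_sqr_bnd gi gM).
have H : \int[(mu \x mu)%E]_p ((f p.1 * g p.1 * K p.1 p.2 + f p.2 * g p.2 * K p.1 p.2)
   - 2^-1 * ((f p.1 - f p.2) ^+ 2 * K p.1 p.2 + (g p.1 - g p.2) ^+ 2 * K p.1 p.2)) <=
   \int[(mu \x mu)%E]_p (f p.1 * g p.2 * K p.1 p.2 + g p.1 * f p.2 * K p.1 p.2).
  apply: Rint_le; [|exact: integrable1D|].
    apply: integrable1B; first exact: integrable1D.
    by apply: integrable1Z; exact: integrable1D.
  move=> p; rewrite -!mulrDl mulrA -mulrBl ler_wpM2r // -subr_ge0.
  rewrite (_ : _ - _ = 2^-1 * ((f p.1 - f p.2) - (g p.1 - g p.2)) ^+ 2); last by field.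
  by rewrite mulr_ge0 ?sqr_ge0 ?invr_ge0.
have jj := integrable1D j1 j2; have qq := integrable1D q1 q2.
move: H; rewrite RintegralB //; last exact: integrable1Z.
rewrite RintegralD // RintegralZl // RintegralD // RintegralD // -E1 -E2 -Q1 -Q2 F1 F2.
rewrite (spectralC g f).
move: (spectral f g) (dirichletR f + dirichletR g) (\int[mu]_x (f x * g x)) => s q i h; lra.
Qed.
End weighted.
End transform.

(** * Injectivity of the transform on L^1 *)

Section injectivity.
Context dX dY (X : measurableType dX) (Y : measurableType dY) (R : realType).
Variables (mu : {sigma_finite_measure set X -> \bar R})
  (nu : {sigma_finite_measure set Y -> \bar R}).
Variable (th : Y -> X -> R).
Hypothesis mth : measurable_fun setT (fun p : Y * X => th p.1 p.2).
Variables (W : nat -> Y -> R) (K : nat -> X -> X -> R).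
Hypotheses (W0 : forall m xi, 0 <= W m xi) (Wi : forall m, integrable1 nu (W m)).
Hypothesis Kk : forall m, markov_kernel mu (K m).
Hypothesis WK : forall m x y, \int[nu]_xi (W m xi * cos (th xi x - th xi y)) = K m x y.
Hypothesis Ka : forall f : X -> R, measurable_fun setT f ->
  integrable1 mu (fun x => f x ^+ 2) -> approximable mu K f.
Implicit Types f g h : X -> R.

Lemma dirichletR_cvg f M : integrable1 mu f -> (forall x, `|f x| <= M) ->
  dirichletR mu (K m) f @[m --> \oo] --> 0.
Proof.
move=> fi fM; have [_ /fine_cvgP[_ h]] := Ka (integrable1_meas fi) (integrable1_sqr_bnd fi fM).
exact: h.
Qed.

(** The bound is uniform in [m] because each kernel has mass one. It controls the L^1 error made
    when an unbounded function is clamped. *)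
Lemma spectral_bnd m f g M : integrable1 mu f -> integrable1 mu g ->
  (forall x, `|g x| <= M) ->
  `|spectral mu nu th (W m) f g| <= M * \int[mu]_x `|f x|.
Proof.
move=> fi gi gM; have mf := integrable1_meas fi; have mg := integrable1_meas gi.
have [i1 ->] := spectral_kernel mth (W0 m) (Wi m) (Kk m) (@WK m) fi gi.
have [mK K0 _ _] := Kk m.
have [j1 <-] := markov_fst_real (Kk m) (integrable1_norm fi).
rewrite -RintegralZl //; apply: Rint_norm_le => //.
- exact: integrable1Z.
- exact: integrable1_meas i1.
- move=> p; rewrite !normrM (ger0_norm (K0 _ _)) mulrA ler_wpM2r // mulrC.
  by rewrite ler_wpM2r.
Qed.

Definition clamp (M y : R) : R := Num.max (- M) (Num.min M y).

Lemma clamp_le M y : 0 <= M -> `|clamp M y| <= M.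
Proof.
move=> M0; rewrite ler_norml /clamp le_max lexx /= ge_max ge_min lexx /= andbT.
by rewrite (le_trans _ M0) // oppr_le0.
Qed.

Lemma clamp_id M y : `|y| <= M -> clamp M y = y.
Proof.
by rewrite ler_norml /clamp => /andP[a b]; rewrite (min_idPr b) (max_idPr a).
Qed.

Lemma clamp_gt M y : 0 <= M -> M < y -> clamp M y = M.
Proof.
move=> M0 My; rewrite /clamp (min_idPl (ltW My)) (max_idPr _) //.
by rewrite (le_trans _ M0) // oppr_le0.
Qed.

Lemma clamp_lt M y : 0 <= M -> y < - M -> clamp M y = - M.
Proof.
move=> M0 yM; rewrite /clamp (min_idPr _) ?(max_idPl (ltW yM)) //.
by rewrite (le_trans (ltW yM)) // (le_trans _ M0) // oppr_le0.
Qed.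

Lemma clampP M y : 0 <= M ->
  [\/ M < y /\ clamp M y = M, y < - M /\ clamp M y = - M | `|y| <= M /\ clamp M y = y].
Proof.
move=> M0; have [a|a] := ltP M y; first by constructor 1; rewrite clamp_gt.
have [b|b] := ltP y (- M); first by constructor 2; rewrite clamp_lt.
by constructor 3; have yM : `|y| <= M; rewrite ?clamp_id // ler_norml b.
Qed.

Lemma clamp_norm_le M y : 0 <= M -> `|clamp M y| <= `|y|.
Proof.
move=> M0; case: (clampP y M0) => -[a ->] //; rewrite ?normrN (ger0_norm M0).
  by rewrite (le_trans (ltW a)) // ler_norm.
by rewrite -(normrN y) (le_trans _ (ler_norm _)) // lerNr ltW.
Qed.

(** The two clamped values have the same sign, and the one at the higher level is the larger in
    absolute value. *)
Lemma clamp_mul M N y : 0 <= M -> M <= N -> clamp M y ^+ 2 <= clamp N y * clamp M y.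
Proof.
move=> M0 MN; have N0 := le_trans M0 MN; rewrite expr2.
case: (clampP y M0) => -[a ->].
- by rewrite ler_wpM2r // /clamp le_max le_min MN (ltW a) orbT.
- rewrite -subr_ge0 (_ : _ - _ = (- M - clamp N y) * M); last by ring.
  by rewrite mulr_ge0 // subr_ge0 /clamp ge_max lerN2 MN ge_min (ltW a) orbT.
- by rewrite clamp_id // (le_trans a).
Qed.

Lemma measurable_clamp M f : measurable_fun setT f -> measurable_fun setT (fun x => clamp M (f x)).
Proof. by move=> mf; apply: measurable_maxr => //; exact: measurable_minr. Qed.

(** [spectral_ge] needs bounded functions while [f] is only in L^1. So [f] is paired with g = clamp
    1 f, and f_k = clamp (k+1) f stands in for [f]. As the pairing of [f] with [g] is zero, |g|_2^2
    <= <f_k, g> is at most the L^1 norm of f - f_k plus Dirichlet forms. Letting first m and then k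
    tend to infinity gives g = 0, hence f = 0. *)
Lemma transform_inj f : integrable1 mu f ->
  {ae nu, forall xi, hc mu th f xi = 0 /\ hs mu th f xi = 0} ->
  {ae mu, forall x, f x = 0}.
Proof.
move=> fi f0; have mf := integrable1_meas fi.
have cli M : 0 <= M -> integrable1 mu (fun x => clamp M (f x)).
  move=> M0; apply: (integrable1_dom _ _ (integrable1_norm fi)).
    exact: measurable_clamp.
  by move=> x; exact: clamp_norm_le.
pose g x := clamp 1 (f x); have gi : integrable1 mu g by exact: cli.
have g1 x : `|g x| <= 1 by exact: clamp_le.
have g2 := integrable1_sqr_bnd gi g1.
have S0 m : spectral mu nu th (W m) f g = 0.
  rewrite -[RHS](_ : \int[nu]_xi 0 = 0); last by rewrite /Rintegral integral0.
  apply: Rint_ae => //; first exact: integrable1_meas (integrable1_spectral mth (Wi m) fi gi).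
  by apply: filterS f0 => xi [-> ->]; rewrite !mul0r addr0 mulr0.
have key (k : nat) : \int[mu]_x (g x ^+ 2) <= \int[mu]_x `|f x - clamp k.+1%:R (f x)|.
  have k0 : 0 <= k.+1%:R :> R by [].
  pose fk x := clamp k.+1%:R (f x).
  have fki : integrable1 mu fk by exact: cli.
  have fkM x : `|fk x| <= k.+1%:R by exact: clamp_le.
  have gk x : `|g x| <= k.+1%:R by rewrite (le_trans (g1 x)) // ler1n.
  have dI : integrable1 mu (fun x => f x - fk x) by exact: integrable1B.
  have fkg : integrable1 mu (fun x => fk x * g x) by apply: (integrable1_bndMl _ fkM) => //; exact: integrable1_meas fki.
  have B m : \int[mu]_x (g x ^+ 2) - (dirichletR mu (K m) fk + dirichletR mu (K m) g) / 4 <=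
      \int[mu]_x `|f x - fk x|.
    have H1 := spectral_ge mth (W0 m) (Wi m) (Kk m) (@WK m) fki gi fkM gk.
    have H2 := spectral_bnd m dI gi g1; rewrite mul1r in H2.
    have H3 : spectral mu nu th (W m) (fun x => f x - fk x) g = - spectral mu nu th (W m) fk g.
      rewrite -[RHS]add0r -(S0 m) /spectral -RintegralB //; last 2 first.
      - exact: integrable1_spectral.
      - exact: integrable1_spectral.
      apply: eq_Rintegral => xi _; rewrite /hc /hs.
      under eq_Rintegral do rewrite mulrBl.
      under [X in _ + X * _]eq_Rintegral do rewrite mulrBl.
      rewrite !RintegralB //; try by [exact: integrable1_cos|exact: integrable1_sin].
      ring.
    have H4 : \int[mu]_x (g x ^+ 2) <= \int[mu]_x (fk x * g x).
      by apply: Rint_le => // x; apply: clamp_mul => //; rewrite ler1n.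
    move: H2; rewrite H3 normrN => /(le_trans (ler_norm _)) H2; lra.
  have c : \int[mu]_x (g x ^+ 2) - (dirichletR mu (K m) fk + dirichletR mu (K m) g) / 4 @[m --> \oo]
      --> \int[mu]_x (g x ^+ 2) - (0 + 0) / 4.
    apply: cvgB; first exact: cvg_cst.
    apply: cvgM; last exact: cvg_cst.
    by apply: cvgD; [exact: (dirichletR_cvg fki fkM)|exact: (dirichletR_cvg gi g1)].
  rewrite addr0 mul0r subr0 in c.
  by apply: (cvgr_to_le c); exact: nearW.
have g00 : \int[mu]_x (g x ^+ 2) <= 0.
  have c : \int[mu]_x `|f x - clamp k.+1%:R (f x)| @[k --> \oo] --> \int[mu]_x (0 : R).
    apply: (@Rint_dct _ _ R mu (fun k x => `|f x - clamp k.+1%:R (f x)|) (fun=> 0) (fun x => 2 * `|f x|)).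
    - by move=> k; apply: measurableT_comp => //; apply: measurable_funB => //; exact: measurable_clamp.
    - exact: measurable_cst.
    - apply: aeW => x; apply: cvg_near_cst.
      exists (Num.bound `|f x|) => // k /= bk.
      rewrite clamp_id ?subrr ?normr0 // (le_trans (ltW (archi_boundP _))) // ler_nat.
      exact: leqW.
    - by apply: integrable1Z; exact: integrable1_norm.
    - move=> k x; rewrite normr_id (le_trans (ler_normB _ _)) // mulr2n mulrDl mul1r lerD //.
      exact: clamp_norm_le.
  rewrite [X in _ --> X](_ : _ = 0) in c; last by rewrite /Rintegral integral0.
  by apply: (cvgr_to_ge c); apply: nearW => k; exact: key.
have := Rint_eq0_ae g2 (fun x => sqr_ge0 _) g00.
apply: filterS => x /eqP; rewrite sqrf_eq0 => /eqP gx0.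
case: (clampP (f x) (@ler01 R)) => -[_ E]; move: gx0; rewrite /g E // => /eqP.
- by rewrite oner_eq0.
- by rewrite oppr_eq0 oner_eq0.
Qed.
End injectivity.

(** * The energy estimate *)

Lemma aeS d (X : measurableType d) (R : realType) (mu : {measure set X -> \bar R})
    (P Q : X -> Prop) : (forall x, P x -> Q x) ->
  {ae mu, forall x, P x} -> {ae mu, forall x, Q x}.
Proof. by move=> PQ; apply: filterS. Qed.

Lemma ae_and d (X : measurableType d) (R : realType) (mu : {measure set X -> \bar R})
    (P Q : X -> Prop) :
  {ae mu, forall x, P x} -> {ae mu, forall x, Q x} -> {ae mu, forall x, P x /\ Q x}.
Proof. by move=> hP hQ; apply: filterS2 hP hQ. Qed.

(** * Integrals in time and Gronwall's lemma *)

Section time_integrals.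
Context (R : realType).
Notation leb := (@lebesgue_measure R).
Notation RT := (measurableTypeR R).

(** Integrals over [0, t] are written on the whole line with this factor, so that a single product
    measure serves for all [t]. It is zero for t < 0. *)
Definition ind (t s : R) : R := \1_(`[0, t] : set R) s.

Lemma indE t s : ind t s = (0 <= s <= t)%R%:R.
Proof. by rewrite /ind indicE mem_setE in_itv. Qed.

Lemma ind_ge0 t s : 0 <= ind t s.
Proof. by rewrite indE ler0n. Qed.

Lemma norm_ind t s : `|ind t s| = ind t s.
Proof. exact/ger0_norm/ind_ge0. Qed.

Lemma integrable1_ind t : integrable1 leb (ind t).
Proof. exact: (integrable_indic_itv 0 t true false). Qed.

Lemma measurable_ind t : measurable_fun setT (ind t : RT -> R).
Proof. exact: integrable1_meas (integrable1_ind t). Qed.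

Lemma Rint_ind t : 0 <= t -> \int[leb]_s ind t s = t.
Proof.
move=> t0; rewrite /Rintegral integral_indic // setIT.
have /= -> := lebesgue_measure_itv `[0, t]; rewrite lte_fin.
by move: t0; rewrite le_eqVlt => /predU1P[<-|->]; rewrite ?ltxx ?oppr0 ?addr0 ?subr0.
Qed.

Lemma integrable1_ind_bnd t c (g : R -> R) : measurable_fun setT (g : RT -> R) ->
  (forall s, `|g s| <= c) -> integrable1 leb (fun s => ind t s * g s).
Proof. by move=> mg gc; apply: (integrable1_bndMr mg gc); exact: integrable1_ind. Qed.

Lemma measurable_le2 : measurable_fun setT (fun p : RT * RT => ((p.2 : R) <= p.1)%R%:R : R).
Proof.
rewrite (_ : (fun p => _) = (fun p : RT * RT => if (p.2 : R) <= p.1 then 1 else 0)).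
  by apply: measurable_fun_ifT => //; exact: measurable_fun_ler.
by apply/funext => p; case: ifP.
Qed.

Lemma measurable_lt2 : measurable_fun setT (fun p : RT * RT => ((p.1 : R) < p.2)%R%:R : R).
Proof.
rewrite (_ : (fun p => _) = (fun p : RT * RT => if (p.1 : R) < p.2 then 1 else 0)).
  by apply: measurable_fun_ifT => //; exact: measurable_fun_ltr.
by apply/funext => p; case: ifP.
Qed.

(* Split the square [0,t]^2 along its diagonal; the two halves contribute equally. *)
Lemma sqr_primitive t c (g : R -> R) : measurable_fun setT (g : RT -> R) ->
  (forall s, `|g s| <= c) ->
  (\int[leb]_s (ind t s * g s)) ^+ 2 =
  2 * \int[leb]_s (ind t s * (g s * \int[leb]_r (ind s r * g r))).
Proof.
move=> mg gc; pose u (s : R) := ind t s * g s.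
have ui : integrable1 leb u by exact: integrable1_ind_bnd gc.
have mu_ := integrable1_meas ui.
have uu := integrable1_tensor ui ui.
have muu := integrable1_meas uu.
have i1 : integrable1 (leb \x leb)%E (fun p => u p.1 * u p.2 * ((p.2 : R) <= p.1)%R%:R).
  apply: (@integrable1_bndMr _ _ _ _ 1) => //; first exact: measurable_le2.
  by move=> p; rewrite ger0_norm ?ler0n // lern1 leq_b1.
have i2 : integrable1 (leb \x leb)%E (fun p => u p.1 * u p.2 * ((p.1 : R) < p.2)%R%:R).
  apply: (@integrable1_bndMr _ _ _ _ 1) => //; first exact: measurable_lt2.
  by move=> p; rewrite ger0_norm ?ler0n // lern1 leq_b1.
have -> : (\int[leb]_s (ind t s * g s)) ^+ 2 =
   \int[(leb \x leb)%E]_p (u p.1 * u p.2 * ((p.2 : R) <= p.1)%R%:R) +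
   \int[(leb \x leb)%E]_p (u p.1 * u p.2 * ((p.1 : R) < p.2)%R%:R).
  rewrite expr2 -[LHS](Rint_tensor ui ui) -RintegralD //.
  apply: eq_Rintegral => p _ /=; rewrite -mulrDr.
  by rewrite ltNge; case: (_ <= _); rewrite /= ?addr0 ?add0r mulr1.
rewrite (Rint_fubini1 i1) (Rint_fubini2 i2) mulr_natl mulr2n; congr (_ + _).
- apply: eq_Rintegral => s _ /=.
  under eq_Rintegral do rewrite -mulrA.
  rewrite RintegralZl //; last first.
    apply: (integrable1_dom _ _ (integrable1_norm ui)).
      apply: measurable_funM => //.
      exact: (measurable_prod1 (s : RT) measurable_le2).
    by move=> r; rewrite normrM ler_piMr // ger0_norm ?ler0n // lern1 leq_b1.
  rewrite [u s]/u -mulrA indE; case: (boolP (0 <= s <= t)) => [/andP[s0 st]|]; last by rewrite !mul0r.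
  congr (_ * (_ * _)); apply: eq_Rintegral => r _; rewrite /u !indE.
  have [r0|] := boolP (0 <= r); last by rewrite /= !mul0r.
  have [rs|] := boolP (r <= s); last by rewrite /= mulr0 mul0r.
  by rewrite (le_trans rs st) /= !mul1r mulr1.
- apply: eq_Rintegral => r _ /=.
  under eq_Rintegral do rewrite [u _ * u r]mulrC -mulrA.
  have ilt : integrable1 leb (fun s => u s * (s < r)%R%:R).
    apply: (integrable1_dom _ _ (integrable1_norm ui)).
      apply: measurable_funM => //.
      exact: (measurable_prod2 (r : RT) measurable_lt2).
    by move=> s; rewrite normrM ler_piMr // ger0_norm ?ler0n // lern1 leq_b1.
  rewrite RintegralZl //.
  rewrite [u r]/u -mulrA indE; case: (boolP (0 <= r <= t)) => [/andP[r0 rt]|]; last by rewrite !mul0r.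
  congr (_ * (_ * _)); apply: Rint_ae.
  + exact: integrable1_meas ilt.
  + by apply: measurable_funM => //; exact: measurable_ind.
  (* The strict and the large inequality differ only at [s = r]. *)
  + exists [set r]; split => //; first exact: lebesgue_measure_set1.
    move=> s /= H; apply: contrapT => sr; apply: H; rewrite /u !indE.
    have [s0|] := boolP (0 <= s); last by rewrite /= !mul0r.
    have -> : (s <= r) = (s < r) by rewrite lt_neqAle; move/eqP: sr => ->.
    have [lsr|] := boolP (s < r); last by rewrite /= mulr0 mul0r.
    by rewrite (le_trans (ltW lsr) rt) /= !mul1r mulr1.
Qed.

Lemma Rint_ind_expR (l t : R) : 0 < l -> 0 <= t ->
  \int[leb]_s (ind t s * expR (l * s)) = (expR (l * t) - 1) / l.
Proof.
move=> l0 t0; rewrite /Rintegral.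
transitivity (fine (\int[leb]_(s in `[0%R, t]) (expR (l * s))%:E)%E).
  congr fine; rewrite [RHS]integral_mkcond; apply: eq_integral => s _.
  by rewrite /ind indicE /patch; case: ifP; rewrite ?mul1r ?mul0r.
have dF (x : R) : is_derive x (1:R) (fun s => expR (l * s) / l) (expR (l * x)).
  have d1 : is_derive x (1:R) (fun s => expR (l * s)) (expR (l * x) * l).
    apply: is_derive1_comp.
    by apply: is_derive_eq; rewrite /GRing.scale /=; ring.
  by apply: is_derive_eq; rewrite /GRing.scale /=; field; rewrite gt_eqF.
have cF : continuous (fun s : R => expR (l * s)).
  move=> x; apply: (cvg_comp _ (@expR R) _ (@continuous_expR R _)).
  by apply: cvgM; [exact: cvg_cst|exact: cvg_id].
by rewrite (@integral_FTC R _ _ 0 t dF cF t0) /= mulr0 expR0 mulrBl.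
Qed.

(** [e] is only bounded and measurable, so the estimate is iterated. If e <= A E with E(s) = exp(2 c
    s) and A = 2 r + M / 2^k, then integration gives r + (A / 2) (E - 1), which is at most (2 r + M
    / 2^(k+1)) E. The part coming from the crude bound [M] is halved at each round and disappears in
    the limit. *)
Lemma gronwall_ae (T c r M : R) (e : R -> R) : 0 < c -> 0 <= T -> 0 <= r ->
  measurable_fun setT (e : RT -> R) -> (forall s, 0 <= e s <= M) ->
  {ae leb, forall s, 0 <= s <= T -> e s <= r + c * \int[leb]_q (ind s q * e q)} ->
  forall t, 0 <= t <= T -> \int[leb]_s (ind t s * e s) <= 2 * r * (expR (2 * c * T) * T).
Proof.
move=> c0 T0 r0 me eM H.
have l0 : 0 < 2 * c by rewrite mulr_gt0.
have e0 s : 0 <= e s by case/andP: (eM s).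
have M0 : 0 <= M by case/andP: (eM 0) => a b; exact: le_trans a b.
have en s : `|e s| <= M by rewrite ger0_norm //; case/andP: (eM s).
have iexp t : integrable1 leb (fun s => ind t s * expR (2 * c * s)).
  have [t0|t0] := leP 0 t; last first.
    apply: (@integrable1_dom _ _ R leb _ (fun=> 0)).
    - apply: measurable_funM; first exact: measurable_ind.
      apply: (measurableT_comp (f := @expR R)); first exact: measurable_expR.
      exact: measurable_funM.
    - move=> s; rewrite indE; case: (boolP (0 <= s <= t)) => [/andP[s0 st]|]; last by rewrite mul0r normr0.
      by move: (le_lt_trans s0 (le_lt_trans st t0)); rewrite ltxx.
    - exact: (integrable0 leb setT).
  apply: (@integrable1_dom _ _ R leb _ (fun s => expR (2 * c * t) * ind t s)).
  - apply: measurable_funM; first exact: measurable_ind.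
    apply: (measurableT_comp (f := @expR R)); first exact: measurable_expR.
    exact: measurable_funM.
  - move=> s; rewrite normrM norm_ind mulrC (ger0_norm (expR_ge0 _)) indE.
    case: (boolP (0 <= s <= t)) => [/andP[s0 st]|]; last by rewrite !mulr0.
    by rewrite !mulr1 ler_expR ler_wpM2l // ltW.
  - by apply: integrable1Z; exact: integrable1_ind.
have step k : {ae leb, forall s, 0 <= s <= T -> e s <= (2 * r + M / 2 ^+ k) * expR (2 * c * s)}.
  elim: k => [|k IH].
    apply: aeW => s /andP[s0 _]; case/andP: (eM s) => _ es; apply: (le_trans es).
    rewrite expr0 divr1 (le_trans (_ : M <= 2 * r + M)) ?lerDr ?mulr_ge0 //.
    rewrite ler_peMr ?addr_ge0 ?mulr_ge0 // -[leLHS]expR0 ler_expR.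
    by rewrite !mulr_ge0 // ltW.
  set A := 2 * r + M / 2 ^+ k in IH.
  have A0 : 0 <= A by rewrite addr_ge0 ?mulr_ge0 // divr_ge0 // exprn_ge0.
  have mexp : measurable_fun setT ((fun q => expR (2 * c * q)) : RT -> R).
    apply: (measurableT_comp (f := @expR R)); first exact: measurable_expR.
    exact: measurable_funM.
  apply: aeS H => s Hs sT; have /andP[s0 sT'] := sT.
  apply: (le_trans (Hs sT)).
  have H1 : \int[leb]_q (ind s q * e q) <= \int[leb]_q (A * (ind s q * expR (2 * c * q))).
    apply: Rint_le_ae.
    - exact: integrable1_ind_bnd en.
    - by apply: integrable1Z; exact: iexp.
    - apply: aeS IH => q IHq; rewrite mulrCA indE.
      case: (boolP (0 <= q <= s)) => [/andP[q0 qs]|]; last by rewrite !mul0r.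
      by rewrite !mul1r IHq // q0 (le_trans qs).
  rewrite (RintegralZl A measurableT (iexp s)) (Rint_ind_expR l0 s0) in H1.
  have H2 := ler_wpM2l (ltW c0) H1.
  have E0 : 1 <= expR (2 * c * s) by rewrite -[leLHS]expR0 ler_expR !mulr_ge0 // ltW.
  have E3 : c * (A * ((expR (2 * c * s) - 1) / (2 * c))) = A / 2 * (expR (2 * c * s) - 1).
    by field; rewrite gt_eqF.
  rewrite E3 in H2.
  have A2 : A / 2 = r + M / 2 ^+ k.+1.
    rewrite /A exprS invfM; move: (2 ^+ k)^-1 => y; by field.
  rewrite A2 in H2.
  have M2 : 0 <= M / 2 ^+ k.+1 by rewrite divr_ge0 // exprn_ge0.
  move: (\int[leb]_q (ind s q * e q)) (expR (2 * c * s)) (M / 2 ^+ k.+1) E0 H2 M2 => I E m E0 H2 M2.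
  nra.
move=> t /andP[t0 tT].
have bnd k : \int[leb]_s (ind t s * e s) <= (2 * r + M / 2 ^+ k) * (expR (2 * c * T) * T).
  have A0 : 0 <= 2 * r + M / 2 ^+ k by rewrite addr_ge0 ?mulr_ge0 // divr_ge0 // exprn_ge0.
  apply: (@le_trans _ _ (\int[leb]_s ((2 * r + M / 2 ^+ k) * expR (2 * c * T) * ind t s))).
    apply: Rint_le_ae.
    - exact: integrable1_ind_bnd en.
    - by apply: integrable1Z; exact: integrable1_ind.
    - apply: aeS (step k) => s Hs; rewrite indE.
      case: (boolP (0 <= s <= t)) => [/andP[s0 st]|]; last by rewrite mul0r mulr0.
      rewrite mul1r mulr1; have sT : 0 <= s <= T by rewrite s0 (le_trans st).
      by rewrite (le_trans (Hs sT)) // ler_wpM2l // ler_expR ler_wpM2l ?(ltW l0) // (le_trans st).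
  rewrite RintegralZl //; last exact: integrable1_ind.
  rewrite Rint_ind // -mulrA ler_wpM2l // ler_wpM2l //; exact: expR_ge0.
have cv : (2 * r + M / 2 ^+ k) * (expR (2 * c * T) * T) @[k --> \oo] --> (2 * r + M * 0) * (expR (2 * c * T) * T).
  apply: cvgM; last exact: cvg_cst.
  apply: cvgD; first exact: cvg_cst.
  apply: cvgM; first exact: cvg_cst.
  have := @cvg_geometric R 1 (2^-1).
  rewrite ger0_norm ?invr_ge0 // invf_lt1 // ltr1n => /(_ isT).
  apply: cvg_trans; apply: near_eq_cvg; apply: nearW => k.
  by rewrite /geometric /= mul1r exprVn.
rewrite mulr0 addr0 in cv.
by apply: (cvgr_to_ge cv); apply: nearW.
Qed.
End time_integrals.

(** * The regularized H^-1 energy *)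

Section energy.
Context dX dY (X : measurableType dX) (Y : measurableType dY) (R : realType).
Variables (mu : {sigma_finite_measure set X -> \bar R})
  (nu : {sigma_finite_measure set Y -> \bar R}).
Notation leb := (@lebesgue_measure R).
Notation RT := (measurableTypeR R).
Variable (th : Y -> X -> R).
Hypothesis mth : measurable_fun setT (fun p : Y * X => th p.1 p.2).
Variables (W : nat -> Y -> R) (K : nat -> X -> X -> R).
Hypotheses (W0 : forall m xi, 0 <= W m xi) (Wi : forall m, integrable1 nu (W m)).
Hypotheses (Wle : forall m xi, W 0%N xi <= W m xi) (Wgt0 : forall xi, 0 < W 0%N xi).
Hypothesis Kk : forall m, markov_kernel mu (K m).
Hypothesis WK : forall m x y, \int[nu]_xi (W m xi * cos (th xi x - th xi y)) = K m x y.
Hypothesis Ka : forall f : X -> R, measurable_fun setT f ->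
  integrable1 mu (fun x => f x ^+ 2) -> approximable mu K f.
Variables (n : nat) (fr : 'I_n -> Y -> R).
Hypothesis mfr : forall j, measurable_fun setT (fr j).

Variables (z w : R -> X -> R) (B : 'I_n -> R -> X -> R) (M C L gam T : R).
Hypotheses (mz : measurable_fun setT (fun p : RT * X => z p.1 p.2))
  (mw : measurable_fun setT (fun p : RT * X => w p.1 p.2))
  (mB : forall j, measurable_fun setT (fun p : RT * X => B j p.1 p.2)).
Hypotheses (zM : forall t x, `|z t x| <= M) (zi : forall t, integrable1 mu (z t))
  (zC : forall t, \int[mu]_x `|z t x| <= C) (L0 : 0 <= L)
  (wL : forall t x, `|w t x| <= L * `|z t x|)
  (BL : forall j t x, `|B j t x| <= L * `|z t x|) (gam0 : 0 < gam)
  (zw : forall t x, gam * z t x ^+ 2 <= w t x * z t x).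

Definition freq2 xi := \sum_j fr j xi ^+ 2.
(** Real form of the transformed right-hand side. The flux terms exchange the two transforms because
    a derivative in x exchanges cosine and sine. *)
Definition rhs_cos xi s := - freq2 xi * hc mu th (w s) xi - \sum_j fr j xi * hs mu th (B j s) xi.
Definition rhs_sin xi s := - freq2 xi * hs mu th (w s) xi + \sum_j fr j xi * hc mu th (B j s) xi.
Definition prim (G : Y -> R -> R) xi t := \int[leb]_s (ind t s * G xi s).

Hypotheses (T0 : 0 <= T) (zprim : {ae leb, forall s, 0 <= s <= T -> forall xi,
  hc mu th (z s) xi = prim rhs_cos xi s /\ hs mu th (z s) xi = prim rhs_sin xi s}).

Let mf1 (F : R -> X -> R) s : measurable_fun setT (fun p : RT * X => F p.1 p.2) ->
  measurable_fun setT (F s).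
Proof. by move=> mF; exact: (measurable_prod1 (s : RT) mF). Qed.

Let wi t : integrable1 mu (w t).
Proof.
apply: (@integrable1_dom _ _ _ _ _ (fun x => L * `|z t x|)) => //; first exact: mf1.
by apply: integrable1Z; exact: integrable1_norm.
Qed.

Let Bi j t : integrable1 mu (B j t).
Proof.
apply: (@integrable1_dom _ _ _ _ _ (fun x => L * `|z t x|)) => //; first exact: (mf1 t (mB j)).
by apply: integrable1Z; exact: integrable1_norm.
Qed.

Let C0 : 0 <= C.
Proof. by apply: le_trans (zC 0); exact: Rintegral_ge0. Qed.

Let intL (f : X -> R) t : integrable1 mu f -> (forall x, `|f x| <= L * `|z t x|) ->
  \int[mu]_x `|f x| <= L * C.
Proof.
move=> fi fL; apply: (@le_trans _ _ (\int[mu]_x (L * `|z t x|))).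
  apply: Rint_le => //; first exact: integrable1_norm.
  by apply: integrable1Z; exact: integrable1_norm.
by rewrite RintegralZl ?ler_wpM2l //; exact: integrable1_norm.
Qed.

Let hcz xi t : `|hc mu th (z t) xi| <= C.
Proof. exact: le_trans (norm_hc mth xi (zi t)) (zC t). Qed.
Let hsz xi t : `|hs mu th (z t) xi| <= C.
Proof. exact: le_trans (norm_hs mth xi (zi t)) (zC t). Qed.
Let hcw xi t : `|hc mu th (w t) xi| <= L * C.
Proof. exact: le_trans (norm_hc mth xi (wi t)) (intL (wi t) (wL t)). Qed.
Let hsw xi t : `|hs mu th (w t) xi| <= L * C.
Proof. exact: le_trans (norm_hs mth xi (wi t)) (intL (wi t) (wL t)). Qed.
Let hcB j xi t : `|hc mu th (B j t) xi| <= L * C.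
Proof. exact: le_trans (norm_hc mth xi (Bi j t)) (intL (Bi j t) (BL j t)). Qed.
Let hsB j xi t : `|hs mu th (B j t) xi| <= L * C.
Proof. exact: le_trans (norm_hs mth xi (Bi j t)) (intL (Bi j t) (BL j t)). Qed.

Let freq2_ge0 xi : 0 <= freq2 xi.
Proof. by apply: sumr_ge0 => j _; exact: sqr_ge0. Qed.

Let fr_le j xi : fr j xi ^+ 2 <= freq2 xi.
Proof.
by rewrite /freq2 (bigD1 j) //= lerDl; apply: sumr_ge0 => k _; exact: sqr_ge0.
Qed.

Let measurable_freq2 : measurable_fun setT freq2.
Proof. by apply: measurable_sum => j; exact: measurable_funX. Qed.

(** Growth constant of the right-hand side relative to 1 + |xi|^2: one share L C for the term in
    [w], and one for each of the [n] fluxes since |xi_j| <= 1 + |xi|^2. *)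
Let cG := (n.+1%:R : R) * (L * C).

Let sum_bnd xi (a : 'I_n -> R) : (forall j, `|a j| <= L * C) ->
  `|\sum_j fr j xi * a j| <= n%:R * (L * C) * (1 + freq2 xi).
Proof.
move=> aB; apply: (le_trans (ler_norm_sum _ _ _)).
have -> : n%:R * (L * C) * (1 + freq2 xi) = \sum_(j < n) (L * C * (1 + freq2 xi)).
  by rewrite sumr_const card_ord -[RHS]mulr_natl !mulrA.
apply: ler_sum => j _; rewrite normrM mulrC ler_pM //.
have := fr_le j xi; rewrite -[fr j xi ^+ 2]real_normK ?num_real // => h.
have := sqr_ge0 (`|fr j xi| - 1); move: (`|fr j xi|) h => y h h2; nra.
Qed.

Let rhs_bnd (a : R) (c : 'I_n -> R) xi (sg : R) : `|sg| = 1 -> `|a| <= L * C -> (forall j, `|c j| <= L * C) ->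
  `|- freq2 xi * a + sg * \sum_j fr j xi * c j| <= cG * (1 + freq2 xi).
Proof.
move=> sg1 ha hc'; apply: (le_trans (ler_normD _ _)).
rewrite /cG -natr1 !mulrDl mul1r addrC lerD //.
  by rewrite normrM sg1 mul1r; exact: sum_bnd.
rewrite normrM normrN (ger0_norm (freq2_ge0 xi)) mulrC ler_pM //.
by rewrite lerDr.
Qed.

Let rhs_cos_bnd xi s : `|rhs_cos xi s| <= cG * (1 + freq2 xi).
Proof.
rewrite /rhs_cos -[X in _ + X]mulN1r; apply: rhs_bnd => //; by rewrite normrN normr1.
Qed.

Let rhs_sin_bnd xi s : `|rhs_sin xi s| <= cG * (1 + freq2 xi).
Proof.
rewrite /rhs_sin -[X in _ + X]mul1r; apply: rhs_bnd => //; by rewrite normr1.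
Qed.

Notation YT := (Y * RT)%type.
Let mhcF (F : R -> X -> R) : measurable_fun setT (fun p : RT * X => F p.1 p.2) ->
  measurable_fun setT (fun q : YT => hc mu th (F q.2) q.1).
Proof.
move=> mF; apply: (@measurable_hc_family _ _ _ _ _ _ _ mth _ (Y * RT)%type (fun q => F q.2) (fun q => q.1)) => //.
  apply: (measurableT_comp mF (g := fun p : (Y * RT) * X => (p.1.2, p.2))).
  by apply: measurable_fun_pair => //; exact: measurableT_comp.
exact: measurable_fst.
Qed.

Let mhsF (F : R -> X -> R) : measurable_fun setT (fun p : RT * X => F p.1 p.2) ->
  measurable_fun setT (fun q : YT => hs mu th (F q.2) q.1).
Proof.
move=> mF; apply: (@measurable_hs_family _ _ _ _ _ _ _ mth _ (Y * RT)%type (fun q => F q.2) (fun q => q.1)) => //.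
  apply: (measurableT_comp mF (g := fun p : (Y * RT) * X => (p.1.2, p.2))).
  by apply: measurable_fun_pair => //; exact: measurableT_comp.
exact: measurable_fst.
Qed.

Let mN1 : measurable_fun setT (fun q : YT => freq2 q.1).
Proof. exact: (measurableT_comp measurable_freq2 measurable_fst). Qed.
Let mfr1 j : measurable_fun setT (fun q : YT => fr j q.1).
Proof. exact: (measurableT_comp (mfr j) measurable_fst). Qed.

Let mrhs_cos : measurable_fun setT (fun q : YT => rhs_cos q.1 q.2).
Proof.
apply: measurable_funB.
  apply: measurable_funM; last exact: mhcF.
  by apply: measurableT_comp.
by apply: measurable_sum => j; apply: measurable_funM => //; exact: (mhsF (mB j)).
Qed.

Let mrhs_sin : measurable_fun setT (fun q : YT => rhs_sin q.1 q.2).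
Proof.
apply: measurable_funD.
  apply: measurable_funM; last exact: mhsF.
  by apply: measurableT_comp.
by apply: measurable_sum => j; apply: measurable_funM => //; exact: (mhcF (mB j)).
Qed.

Let q1 xi := (1 + freq2 xi)^-1.
Let q1_gt0 xi : 0 < q1 xi.
Proof. by rewrite invr_gt0 ltr_pwDl. Qed.
Let mq1 : measurable_fun setT q1.
Proof.
rewrite (_ : q1 = (fun xi => expR (- ln (1 + freq2 xi)))).
  apply: (measurableT_comp (f := @expR R)); first exact: measurable_expR.
  apply: measurableT_comp => //; apply: (measurableT_comp (f := @ln R)) => //.
  exact: measurable_funD.
by apply/funext => xi; rewrite expRN lnK // posrE ltr_pwDl.
Qed.

(** Formally half the time derivative of [energy]; the integrated form of this relation is
    [prim_energyE]. *)
Definition dissip m s := \int[nu]_xi (W m xi * q1 xi *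
  (rhs_cos xi s * hc mu th (z s) xi + rhs_sin xi s * hs mu th (z s) xi)).
Definition energy m s := \int[nu]_xi (W m xi * q1 xi *
  (hc mu th (z s) xi ^+ 2 + hs mu th (z s) xi ^+ 2)).

(* Young's inequality with parameter k; 1/(1+|xi|^2) absorbs the factor xi_j. *)
Lemma young_frequency (k q N x y : R) (f a b : 'I_n -> R) (u v : R) : 0 < k ->
  0 < q -> q * (1 + N) = 1 -> (forall j, f j ^+ 2 <= N) -> 0 <= N ->
  q * ((- N * x - \sum_j f j * a j) * u + (- N * y + \sum_j f j * b j) * v) <=
  - (x * u + y * v) + n.+1%:R / (4 * k) * (q * (u ^+ 2 + v ^+ 2))
  + k * (x ^+ 2 + y ^+ 2) + k * \sum_j (b j ^+ 2 + a j ^+ 2).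
Proof.
move=> k0 q0 qN fN N0.
have q1' : q <= 1 by rewrite -qN; apply: ler_peMr; rewrite ?lerDl // ltW.
have YI (g c d : R) : g ^+ 2 * q <= 1 -> q * (g * c * d) <= (4 * k)^-1 * (q * d ^+ 2) + k * c ^+ 2.
  move=> gq; rewrite -subr_ge0.
  have -> : (4 * k)^-1 * (q * d ^+ 2) + k * c ^+ 2 - q * (g * c * d) =
     (4 * k)^-1 * (q * d ^+ 2 * (1 - g ^+ 2 * q) + (q * g * d - 2 * k * c) ^+ 2).
    by field; rewrite gt_eqF.
  apply: mulr_ge0; first by rewrite invr_ge0 mulr_ge0 // ltW.
  apply: addr_ge0; last exact: sqr_ge0.
  apply: mulr_ge0; last by rewrite subr_ge0.
  by rewrite mulr_ge0 ?sqr_ge0 // ltW.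
have fq j : f j ^+ 2 * q <= 1.
  by rewrite mulrC -qN ler_wpM2l ?(ltW q0) // (le_trans (fN j)) // lerDr.
(* Since q N = 1 - q, the second-order term gives - (x u + y v) plus the remainder q (x u + y v).
   This remainder is treated like a flux with frequency factor 1, whence [n.+1] instead of [n] in
   the constant. *)
have -> : q * ((- N * x - \sum_j f j * a j) * u + (- N * y + \sum_j f j * b j) * v) =
  - (x * u + y * v) + (q * (1 * x * u) + q * (1 * y * v))
  + \sum_j (q * (f j * (- a j) * u) + q * (f j * b j * v)).
  have E1 : q * (\sum_j f j * a j * u) = - \sum_j (q * (f j * (- a j) * u)).
    rewrite mulr_sumr -sumrN; apply: eq_bigr => j _; ring.
  have E2 : q * (\sum_j f j * b j * v) = \sum_j (q * (f j * b j * v)).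
    by rewrite mulr_sumr.
  rewrite big_split /= -E2 -[X in _ + (X + _)]opprK -E1 -!mulr_suml.
  have E : 1 + N = q^-1 by apply: (mulfI (lt0r_neq0 q0)); rewrite qN mulfV ?gt_eqF.
  have -> : N = q^-1 - 1 by rewrite -E; ring.
  by field; rewrite gt_eqF.
have H1 : q * (1 * x * u) <= (4 * k)^-1 * (q * u ^+ 2) + k * x ^+ 2.
  by apply: YI; rewrite expr1n mul1r.
have H2 : q * (1 * y * v) <= (4 * k)^-1 * (q * v ^+ 2) + k * y ^+ 2.
  by apply: YI; rewrite expr1n mul1r.
have H3 : \sum_j (q * (f j * (- a j) * u) + q * (f j * b j * v)) <=
  \sum_(j < n) ((4 * k)^-1 * (q * (u ^+ 2 + v ^+ 2)) + k * (b j ^+ 2 + a j ^+ 2)).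
  apply: ler_sum => j _.
  have := YI _ (- a j) u (fq j); have := YI _ (b j) v (fq j).
  rewrite sqrrN => h1 h2; lra.
have E4 : \sum_(j < n) ((4 * k)^-1 * (q * (u ^+ 2 + v ^+ 2)) + k * (b j ^+ 2 + a j ^+ 2)) =
  n%:R * ((4 * k)^-1 * (q * (u ^+ 2 + v ^+ 2))) + k * \sum_j (b j ^+ 2 + a j ^+ 2).
  by rewrite big_split /= sumr_const card_ord -mulr_sumr -[X in X + _]mulr_natl.
rewrite E4 in H3; move: H1 H2 H3; rewrite -[n.+1%:R]natr1.
move: (\sum_j _) (\sum_(i < n) _) => S1 S2 h1 h2 h3.
have -> : (n%:R + 1) / (4 * k) * (q * (u ^+ 2 + v ^+ 2)) =
  n%:R * ((4 * k)^-1 * (q * (u ^+ 2 + v ^+ 2))) + (4 * k)^-1 * (q * u ^+ 2) + (4 * k)^-1 * (q * v ^+ 2).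
  by field; rewrite gt_eqF.
lra.
Qed.

(** Chosen so that (n + 1) kY L^2 <= gam: the terms of Young's inequality in [w] and in the [n]
    fluxes are together absorbed by gam |z|_2^2. The summand 1 keeps the quotient meaningful when
    [L] is 0. *)
Let kY := gam / (n.+1%:R * (L ^+ 2 + 1)).
Let kY_gt0 : 0 < kY.
Proof. by rewrite divr_gt0 // mulr_gt0 // ltr_wpDl // sqr_ge0. Qed.
Let c0 := n.+1%:R / (4 * kY).
Let c0_gt0 : 0 < c0.
Proof. by rewrite divr_gt0 // mulr_gt0. Qed.

Let Wq_bnd m xi (a c : R) : `|a| <= c * (1 + freq2 xi) -> `|W m xi * q1 xi * a| <= c * W m xi.
Proof.
move=> ac; rewrite !normrM (ger0_norm (W0 m xi)) (gtr0_norm (q1_gt0 xi)) -mulrA mulrC.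
rewrite ler_wpM2r // mulrC /q1 ler_pdivrMr //.
by rewrite ltr_pwDl.
Qed.

Let le_1N xi (c : R) : 0 <= c -> c <= c * (1 + freq2 xi).
Proof. by move=> c0'; apply: ler_peMr; rewrite ?lerDl. Qed.

Let diss_bnd xi s : `|rhs_cos xi s * hc mu th (z s) xi + rhs_sin xi s * hs mu th (z s) xi| <=
  2 * cG * C * (1 + freq2 xi).
Proof.
apply: (le_trans (ler_normD _ _)); rewrite !normrM.
have -> : 2 * cG * C * (1 + freq2 xi) = cG * (1 + freq2 xi) * C + cG * (1 + freq2 xi) * C by ring.
by rewrite lerD // ler_pM.
Qed.

Let ener_bnd xi s : `|hc mu th (z s) xi ^+ 2 + hs mu th (z s) xi ^+ 2| <= 2 * C ^+ 2.
Proof.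
apply: (le_trans (ler_normD _ _)); rewrite !normrX mulr2n mulrDl mul1r.
by rewrite lerD // ler_sqr ?nnegrE.
Qed.

Let mW m : measurable_fun setT (W m). Proof. exact: integrable1_meas (Wi m). Qed.

Let mdiss : measurable_fun setT (fun q : YT => rhs_cos q.1 q.2 * hc mu th (z q.2) q.1 + rhs_sin q.1 q.2 * hs mu th (z q.2) q.1).
Proof.
by apply: measurable_funD; apply: measurable_funM => //; [exact: mhcF|exact: mhsF].
Qed.

Let mener : measurable_fun setT (fun q : YT => hc mu th (z q.2) q.1 ^+ 2 + hs mu th (z q.2) q.1 ^+ 2).
Proof.
by apply: measurable_funD; apply: measurable_funX; [exact: mhcF|exact: mhsF].
Qed.

Let mWq m : measurable_fun setT (fun xi => W m xi * q1 xi).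
Proof. exact: measurable_funM. Qed.

Let integrable1_diss m s : integrable1 nu (fun xi => W m xi * q1 xi *
  (rhs_cos xi s * hc mu th (z s) xi + rhs_sin xi s * hs mu th (z s) xi)).
Proof.
apply: (@integrable1_dom _ _ _ _ _ (fun xi => 2 * cG * C * W m xi)).
- by apply: measurable_funM => //; exact: (measurable_prod2 (s : RT) mdiss).
- by move=> xi; apply: Wq_bnd; exact: diss_bnd.
- exact: integrable1Z.
Qed.

Let integrable1_ener m s : integrable1 nu (fun xi => W m xi * q1 xi *
  (hc mu th (z s) xi ^+ 2 + hs mu th (z s) xi ^+ 2)).
Proof.
apply: (@integrable1_dom _ _ _ _ _ (fun xi => 2 * C ^+ 2 * W m xi)).
- by apply: measurable_funM => //; exact: (measurable_prod2 (s : RT) mener).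
- move=> xi; apply: Wq_bnd; apply: (le_trans (ener_bnd xi s)); apply: le_1N.
  by rewrite mulr_ge0 ?sqr_ge0.
- exact: integrable1Z.
Qed.

(** One sup bound for [z], [w] and all the fluxes at once. *)
Let M' := `|M| + L * `|M|.
Let zM' t x : `|z t x| <= M'.
Proof. by rewrite (le_trans (zM t x)) // (le_trans (ler_norm _)) // lerDl mulr_ge0. Qed.
Let wM' t x : `|w t x| <= M'.
Proof.
rewrite (le_trans (wL t x)) // (@le_trans _ _ (L * `|M|)) ?lerDr //.
by rewrite ler_wpM2l // (le_trans (zM t x)) // ler_norm.
Qed.
Let BM' j t x : `|B j t x| <= M'.
Proof.
rewrite (le_trans (BL j t x)) // (@le_trans _ _ (L * `|M|)) ?lerDr //.
by rewrite ler_wpM2l // (le_trans (zM t x)) // ler_norm.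
Qed.

(** [young_frequency] is integrated against the weight. By [spectral_ge] and monotonicity the main
    term is at most - gam |z|_2^2 plus a quarter of the Dirichlet forms; by [spectral_le] and the
    choice of [kY] the quadratic terms are at most gam |z|_2^2. They cancel, and only the energy and
    the Dirichlet forms remain. *)
Lemma dissip_le m s : dissip m s <=
  c0 * energy m s + (dirichletR mu (K m) (w s) + dirichletR mu (K m) (z s)) / 4.
Proof.
pose sp f g xi := W m xi * (hc mu th f xi * hc mu th g xi + hs mu th f xi * hs mu th g xi).
have spi f g : integrable1 mu f -> integrable1 mu g -> integrable1 nu (sp f g).
  by move=> fi gi; exact: (integrable1_spectral mth (Wi m) fi gi).
have i1 := integrable1N (spi _ _ (wi s) (zi s)).
have i2 := integrable1Z c0 (integrable1_ener m s).
have i3 := integrable1Z kY (spi _ _ (wi s) (wi s)).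
have i4' : integrable1 nu (fun xi => \sum_j sp (B j s) (B j s) xi).
  by apply: integrable1_sum => j; exact: spi.
have i4 := integrable1Z kY i4'.
have i12 := integrable1D i1 i2; have i123 := integrable1D i12 i3.
have pw xi : W m xi * q1 xi * (rhs_cos xi s * hc mu th (z s) xi + rhs_sin xi s * hs mu th (z s) xi) <=
   - sp (w s) (z s) xi + c0 * (W m xi * q1 xi * (hc mu th (z s) xi ^+ 2 + hs mu th (z s) xi ^+ 2))
   + kY * sp (w s) (w s) xi + kY * \sum_j sp (B j s) (B j s) xi.
  have qN : q1 xi * (1 + freq2 xi) = 1 by rewrite mulVf // gt_eqF // ltr_pwDl.
  have YI := @young_frequency kY (q1 xi) (freq2 xi) (hc mu th (w s) xi) (hs mu th (w s) xi)
    (fun j => fr j xi) (fun j => hs mu th (B j s) xi)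
    (fun j => hc mu th (B j s) xi) (hc mu th (z s) xi) (hs mu th (z s) xi) kY_gt0 (q1_gt0 xi)
    qN (fun j => fr_le j xi) (freq2_ge0 xi).
  have := ler_wpM2l (W0 m xi) YI; rewrite mulrA -/(rhs_cos xi s) -/(rhs_sin xi s) -/c0.
  have -> : \sum_j sp (B j s) (B j s) xi = W m xi * \sum_j (hc mu th (B j s) xi ^+ 2 + hs mu th (B j s) xi ^+ 2).
    by rewrite mulr_sumr; apply: eq_bigr => j _; rewrite /sp !expr2.
  by move=> h; apply: (le_trans h); rewrite le_eqVlt; apply/orP; left; apply/eqP; rewrite /sp; ring.
have := Rint_le (integrable1_diss m s) (integrable1D i123 i4) pw.
rewrite -/(dissip m s) (RintegralD measurableT i123 i4) (RintegralD measurableT i12 i3).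
rewrite (RintegralD measurableT i1 i2) (RintN (spi _ _ (wi s) (zi s))).
rewrite (RintegralZl c0 measurableT (integrable1_ener m s)) -/(energy m s).
rewrite (RintegralZl kY measurableT (spi _ _ (wi s) (wi s))) (RintegralZl kY measurableT i4').
rewrite (Rint_sum _ (fun j => spi _ _ (Bi j s) (Bi j s))) => HD.
have S1 : \int[mu]_x (w s x * z s x) - (dirichletR mu (K m) (w s) + dirichletR mu (K m) (z s)) / 4
    <= \int[nu]_xi sp (w s) (z s) xi.
  exact: (spectral_ge mth (W0 m) (Wi m) (Kk m) (@WK m) (wi s) (zi s) (wM' s) (zM' s)).
have z2 := integrable1_sqr_bnd (zi s) (zM' s).
have bL (f : X -> R) : integrable1 mu f -> (forall x, `|f x| <= L * `|z s x|) -> (forall x, `|f x| <= M') ->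
    \int[nu]_xi sp f f xi <= L ^+ 2 * \int[mu]_x (z s x ^+ 2).
  move=> fi fL fM.
  apply: (le_trans (spectral_le mth (W0 m) (Wi m) (Kk m) (@WK m) fi fM)).
  rewrite -RintegralZl //; apply: Rint_le; [exact: integrable1_sqr_bnd fM|exact: integrable1Z|].
  move=> x; rewrite -[f x ^+ 2]real_normK ?num_real // -[z s x ^+ 2]real_normK ?num_real // -exprMn.
  by rewrite ler_sqr ?nnegrE // mulr_ge0.
have S2 := bL _ (wi s) (wL s) (wM' s).
have S3 : \sum_j \int[nu]_xi sp (B j s) (B j s) xi <= n%:R * (L ^+ 2 * \int[mu]_x (z s x ^+ 2)).
  have -> : n%:R * (L ^+ 2 * \int[mu]_x (z s x ^+ 2)) = \sum_(j < n) (L ^+ 2 * \int[mu]_x (z s x ^+ 2)).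
    by rewrite sumr_const card_ord -[RHS]mulr_natl.
  by apply: ler_sum => j _; exact: (bL _ (Bi j s) (BL j s) (BM' j s)).
have wzi : integrable1 mu (fun x => w s x * z s x).
  by apply: (integrable1_bndMl _ (wM' s)) => //; exact: integrable1_meas (wi s).
have S4 : gam * \int[mu]_x (z s x ^+ 2) <= \int[mu]_x (w s x * z s x).
  by rewrite -RintegralZl //; apply: Rint_le => //; exact: integrable1Z.
have I0 : 0 <= \int[mu]_x (z s x ^+ 2) by apply: Rintegral_ge0 => x _; exact: sqr_ge0.
have S5 : kY * (L ^+ 2 * \int[mu]_x (z s x ^+ 2)) + kY * (n%:R * (L ^+ 2 * \int[mu]_x (z s x ^+ 2))) <=
    gam * \int[mu]_x (z s x ^+ 2).
  have -> : kY * (L ^+ 2 * \int[mu]_x (z s x ^+ 2)) + kY * (n%:R * (L ^+ 2 * \int[mu]_x (z s x ^+ 2))) =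
    kY * (n.+1%:R * L ^+ 2) * \int[mu]_x (z s x ^+ 2) by rewrite -[n.+1%:R]natr1; ring.
  rewrite ler_wpM2r // /kY -mulrA ler_piMr ?(ltW gam0) // mulrC ler_pdivrMr.
    by rewrite mul1r ler_wpM2l // lerDl.
  by rewrite mulr_gt0 // ltr_wpDl // sqr_ge0.
have S6 := ler_wpM2l (ltW kY_gt0) S2; have S7 := ler_wpM2l (ltW kY_gt0) S3.
lra.
Qed.

Let mind2 : measurable_fun setT (fun p : RT * RT => ind p.1 p.2).
Proof.
rewrite (_ : (fun p => _) = (fun p : RT * RT => ((p.2 : R) <= p.1)%R%:R * \1_(`[0, +oo[ : set R) p.2)).
  apply: measurable_funM; first exact: measurable_le2.
  by apply: (measurableT_comp (f := (\1_(`[0, +oo[ : set R) : RT -> R))) => //.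
apply/funext => p; rewrite indE indicE mem_setE in_itv /= andbT.
by case: (0 <= _); rewrite /= ?mulr1 ?mulr0.
Qed.

Let mprim G xi : measurable_fun setT (fun q : YT => G q.1 q.2) ->
  measurable_fun setT (fun s : RT => prim G xi s).
Proof.
move=> mG; apply: (@measurable_Rint2 _ _ RT RT R leb (fun p => ind p.1 p.2 * G xi p.2)).
apply: measurable_funM => //.
apply: (measurableT_comp mG (g := fun p : RT * RT => (xi, p.2))).
exact: measurable_fun_pair.
Qed.

(** The inner primitive produced by [sqr_primitive] is replaced by [hz], which equals it at almost
    every time. *)
Let prim_sqr (G : Y -> R -> R) (hz : Y -> R -> R) xi t :
  measurable_fun setT (fun q : YT => G q.1 q.2) -> measurable_fun setT (fun q : YT => hz q.1 q.2) ->
  (forall s, `|G xi s| <= cG * (1 + freq2 xi)) -> 0 <= t <= T ->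
  {ae leb, forall s, 0 <= s <= T -> hz xi s = prim G xi s} ->
  prim G xi t ^+ 2 = 2 * \int[leb]_s (ind t s * (G xi s * hz xi s)).
Proof.
move=> mG mh Gb /andP[t0 tT] H.
have mGx : measurable_fun setT (G xi : RT -> R) by exact: (measurable_prod1 xi mG).
have mhx : measurable_fun setT (hz xi : RT -> R) by exact: (measurable_prod1 xi mh).
rewrite /prim (sqr_primitive t mGx Gb); congr (_ * _); apply: Rint_ae.
- apply: measurable_funM; first exact: measurable_ind.
  by apply: measurable_funM => //; exact: (mprim xi mG).
- by apply: measurable_funM; [exact: measurable_ind|exact: measurable_funM].
- apply: aeS H => s Hs; rewrite indE.
  case: (boolP (0 <= s <= t)) => [/andP[s0 st]|]; last by rewrite !mul0r.
  by rewrite Hs // s0 (le_trans st).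
Qed.

(** The energy computed from the primitives. It agrees with [energy] at almost every time, but its
    estimates hold at every [t]. *)
Definition prim_energy m t := \int[nu]_xi (W m xi * q1 xi * (prim rhs_cos xi t ^+ 2 + prim rhs_sin xi t ^+ 2)).

(** The energy identity in integrated form: [prim_sqr] at each frequency, then Fubini between
    frequency and time. The bound on the integrand uses that 1 + |xi|^2 cancels against [q1]. *)
Lemma prim_energyE m t : 0 <= t <= T ->
  prim_energy m t = \int[leb]_s (ind t s * (2 * dissip m s)).
Proof.
move=> tT; pose H (q : YT) := ind t q.2 * (2 * (W m q.1 * q1 q.1 *
  (rhs_cos q.1 q.2 * hc mu th (z q.2) q.1 + rhs_sin q.1 q.2 * hs mu th (z q.2) q.1))).
have mH : measurable_fun setT H.
  apply: measurable_funM; first exact: (measurableT_comp (@measurable_ind R t) measurable_snd).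
  apply: measurable_funM => //; apply: measurable_funM => //.
  exact: (measurableT_comp (mWq m) measurable_fst).
have Hi : integrable1 (nu \x leb)%E H.
  apply: (integrable1_bound mH (integrable1Z (2 * (2 * cG * C)) (Wi m)) (integrable1_ind t)) => xi s.
  rewrite /H /= normrM norm_ind mulrC ler_wpM2r ?ind_ge0 //.
  rewrite normrM (ger0_norm (ler0n R 2)) -[leRHS]mulrA ler_wpM2l //.
  exact: Wq_bnd (diss_bnd xi s).
transitivity (\int[nu]_xi \int[leb]_s H (xi, s)).
  apply: eq_Rintegral => xi _; rewrite /H /=.
  have h1 : {ae leb, forall s, 0 <= s <= T -> hc mu th (z s) xi = prim rhs_cos xi s}.
    by apply: aeS zprim => s Hs sT; have [] := Hs sT xi.
  have h2 : {ae leb, forall s, 0 <= s <= T -> hs mu th (z s) xi = prim rhs_sin xi s}.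
    by apply: aeS zprim => s Hs sT; have [] := Hs sT xi.
  rewrite (@prim_sqr rhs_cos (fun xi s => hc mu th (z s) xi) xi t mrhs_cos (mhcF mz) (rhs_cos_bnd xi) tT h1).
  rewrite (@prim_sqr rhs_sin (fun xi s => hs mu th (z s) xi) xi t mrhs_sin (mhsF mz) (rhs_sin_bnd xi) tT h2).
  have ii (G hz : Y -> R -> R) : measurable_fun setT (fun q : YT => G q.1 q.2) ->
      measurable_fun setT (fun q : YT => hz q.1 q.2) ->
      (forall s, `|G xi s| <= cG * (1 + freq2 xi)) -> (forall s, `|hz xi s| <= C) ->
      integrable1 leb (fun s => ind t s * (G xi s * hz xi s)).
    move=> mG mh Gb hb; apply: (@integrable1_ind_bnd R t (cG * (1 + freq2 xi) * C)).
      by apply: measurable_funM; [exact: (measurable_prod1 xi mG)|exact: (measurable_prod1 xi mh)].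
    by move=> s; rewrite normrM ler_pM.
  have i1 := ii rhs_cos (fun xi s => hc mu th (z s) xi) mrhs_cos (mhcF mz) (rhs_cos_bnd xi) (hcz xi).
  have i2 := ii rhs_sin (fun xi s => hs mu th (z s) xi) mrhs_sin (mhsF mz) (rhs_sin_bnd xi) (hsz xi).
  have i12 := integrable1D i1 i2.
  rewrite -mulrDr -(RintegralD measurableT i1 i2) -(RintegralZl 2 measurableT i12).
  rewrite -(RintegralZl (W m xi * q1 xi) measurableT (integrable1Z 2 i12)).
  by apply: eq_Rintegral => s _; ring.
rewrite (Rint_swap Hi); apply: eq_Rintegral => s _; rewrite /H /=.
rewrite RintegralZl //; last by apply: integrable1Z; exact: integrable1_diss.
by rewrite RintegralZl //; exact: integrable1_diss.
Qed.

Let fC := C + L * C.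

Let sqr_int (f : X -> R) : integrable1 mu f -> (forall x, `|f x| <= M') ->
  \int[mu]_x `|f x| <= fC -> \int[mu]_x (f x ^+ 2) <= M' * fC.
Proof.
move=> fi fM fl; have M'0 : 0 <= M' by rewrite addr_ge0 ?mulr_ge0.
apply: (@le_trans _ _ (\int[mu]_x (M' * `|f x|))).
  apply: Rint_le; [exact: integrable1_sqr_bnd fM|apply: integrable1Z; exact: integrable1_norm|].
  by move=> x; rewrite -[f x ^+ 2]real_normK ?num_real // expr2 ler_wpM2r.
by rewrite RintegralZl ?ler_wpM2l //; exact: integrable1_norm.
Qed.

Let dir_bnd m (f : X -> R) : integrable1 mu f -> (forall x, `|f x| <= M') ->
  \int[mu]_x `|f x| <= fC -> 0 <= dirichletR mu (K m) f <= 4 * (M' * fC).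
Proof.
move=> fi fM fl; have f2 := integrable1_sqr_bnd fi fM.
have [_ _ -> h] := dirichlet_real (Kk m) (integrable1_meas fi) f2.
by rewrite (le_trans h) // ler_wpM2l // sqr_int.
Qed.

Let zfC s : \int[mu]_x `|z s x| <= fC.
Proof. by rewrite (le_trans (zC s)) // lerDl mulr_ge0. Qed.
Let wfC s : \int[mu]_x `|w s x| <= fC.
Proof. by rewrite (le_trans (intL (wi s) (wL s))) // lerDr. Qed.

Let mdir m (F : R -> X -> R) : measurable_fun setT (fun p : RT * X => F p.1 p.2) ->
  measurable_fun setT (fun s : RT => dirichletR mu (K m) (F s)).
Proof.
move=> mF; rewrite /dirichletR; apply: (measurableT_comp (f := fine)) => //.
have -> : (fun s => dirichlet mu (K m) (F s)) =
  fubini_F (prodm mu mu) (fun q : RT * (X * X) => ((F q.1 q.2.1 - F q.1 q.2.2) ^+ 2 * K m q.2.1 q.2.2)%:E) by [].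
have [mK K0 _ _] := Kk m.
apply: measurable_fun_fubini_tonelli_F; last by move=> q; rewrite lee_fin mulr_ge0 ?sqr_ge0.
apply/measurable_EFinP; apply: measurable_funM; last first.
  by apply: (measurable_kernel_comp mK); exact: measurableT_comp.
apply: measurable_funX; apply: measurable_funB.
  apply: (measurableT_comp mF (g := fun q : RT * (X * X) => (q.1, q.2.1))).
  by apply: measurable_fun_pair => //; exact: measurableT_comp.
apply: (measurableT_comp mF (g := fun q : RT * (X * X) => (q.1, q.2.2))).
by apply: measurable_fun_pair => //; exact: measurableT_comp.
Qed.

(** Twice the quarter of the Dirichlet forms in [dissip_le], because the energy identity contains 2
    [dissip]. *)
Let dsum m s := (dirichletR mu (K m) (w s) + dirichletR mu (K m) (z s)) / 2.
Let err m := \int[leb]_s (ind T s * dsum m s).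

Let mdsum m : measurable_fun setT (dsum m : RT -> R).
Proof. by apply: measurable_funM => //; apply: measurable_funD; exact: mdir. Qed.

Let dsum_bnd m s : `|dsum m s| <= 4 * (M' * fC).
Proof.
have /andP[a1 b1] := dir_bnd m (wi s) (wM' s) (wfC s).
have /andP[a2 b2] := dir_bnd m (zi s) (zM' s) (zfC s).
by rewrite ger0_norm ?divr_ge0 ?addr_ge0 // /dsum ler_pdivrMr // mulr2n mulrDr mulr1 lerD.
Qed.

(** At each time the forms tend to 0, since z(s) and w(s) are bounded and integrable. [dirichlet_le]
    supplies a majorant that is constant on [0, T]. *)
Let err_cvg : err m @[m --> \oo] --> 0.
Proof.
have -> : (0 : R) = \int[leb]_s (0 : R) by rewrite /Rintegral integral0.
apply: (@Rint_dct _ _ R leb (fun m s => ind T s * dsum m s) (fun=> 0) (fun s => 4 * (M' * fC) * ind T s)).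
- by move=> m; apply: measurable_funM => //; exact: measurable_ind.
- exact: measurable_cst.
- apply: aeW => s.
  have -> : (0 : R) = ind T s * ((0 + 0) / 2) by rewrite addr0 mul0r mulr0.
  apply: cvgM; first exact: cvg_cst.
  apply: cvgM; last exact: cvg_cst.
  by apply: cvgD; [exact: (dirichletR_cvg Ka (wi s) (wM' s))|exact: (dirichletR_cvg Ka (zi s) (zM' s))].
- by apply: integrable1Z; exact: integrable1_ind.
- by move=> m s; rewrite normrM norm_ind mulrC ler_wpM2r ?ind_ge0.
Qed.

Let err_ge0 m : 0 <= err m.
Proof.
apply: Rintegral_ge0 => s _; rewrite mulr_ge0 ?ind_ge0 // divr_ge0 // addr_ge0 //.
  by have /andP[] := dir_bnd m (wi s) (wM' s) (wfC s).
by have /andP[] := dir_bnd m (zi s) (zM' s) (zfC s).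
Qed.

Let wt m := \int[nu]_xi W m xi.

Let menergy m : measurable_fun setT (energy m : RT -> R).
Proof.
apply: (@measurable_Rint1 _ _ Y RT R nu (fun q => W m q.1 * q1 q.1 * (hc mu th (z q.2) q.1 ^+ 2 + hs mu th (z q.2) q.1 ^+ 2))).
apply: measurable_funM => //; exact: (measurableT_comp (mWq m) measurable_fst).
Qed.

Let mdissip m : measurable_fun setT (dissip m : RT -> R).
Proof.
apply: (@measurable_Rint1 _ _ Y RT R nu (fun q => W m q.1 * q1 q.1 * (rhs_cos q.1 q.2 * hc mu th (z q.2) q.1 + rhs_sin q.1 q.2 * hs mu th (z q.2) q.1))).
apply: measurable_funM => //; exact: (measurableT_comp (mWq m) measurable_fst).
Qed.

Let energy_bnd m s : 0 <= energy m s <= 2 * C ^+ 2 * wt m.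
Proof.
apply/andP; split.
  apply: Rintegral_ge0 => xi _; rewrite mulr_ge0 ?addr_ge0 ?sqr_ge0 // mulr_ge0 //.
  exact: ltW.
rewrite -RintegralZl //; apply: Rint_le; [exact: integrable1_ener|exact: integrable1Z|].
move=> xi; apply: (le_trans (ler_norm _)); apply: Wq_bnd.
apply: (le_trans (ener_bnd xi s)); apply: le_1N.
by rewrite mulr_ge0 ?sqr_ge0.
Qed.

Let dissip_bnd m s : `|dissip m s| <= 2 * cG * C * wt m.
Proof.
rewrite -RintegralZl //; apply: Rint_norm_le.
- exact: integrable1Z.
- exact: integrable1_meas (integrable1_diss m s).
- by move=> xi; apply: Wq_bnd; exact: diss_bnd.
Qed.

Let prim_energy_le m t : 0 <= t <= T ->
  prim_energy m t <= err m + 2 * c0 * \int[leb]_s (ind t s * energy m s).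
Proof.
move=> tT; rewrite prim_energyE //; have /andP[t0 tT'] := tT.
have ie : integrable1 leb (fun s => ind t s * energy m s).
  apply: (@integrable1_ind_bnd R t (2 * C ^+ 2 * wt m)) => // s.
  by have /andP[a b] := energy_bnd m s; rewrite ger0_norm.
have id : integrable1 leb (fun s => ind T s * dsum m s) by exact: (integrable1_ind_bnd T (@mdsum m) (dsum_bnd m)).
rewrite -RintegralZl // -RintegralD //; last exact: integrable1Z.
apply: Rint_le; [|by apply: integrable1D => //; exact: integrable1Z|].
  apply: (@integrable1_ind_bnd R t (2 * (2 * cG * C * wt m))); first exact: measurable_funM.
  by move=> s; rewrite normrM ger0_norm // ler_wpM2l.
move=> s; have D := dissip_le m s.
have ds0 : 0 <= dsum m s.
  have /andP[a1 _] := dir_bnd m (wi s) (wM' s) (wfC s).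
  have /andP[a2 _] := dir_bnd m (zi s) (zM' s) (zfC s).
  by rewrite divr_ge0 // addr_ge0.
have i1 := ind_ge0 t s; have iT : ind t s <= ind T s.
  rewrite !indE; case: (boolP (0 <= s <= t)) => [/andP[s0 st]|_]; last by rewrite ler0n.
  by rewrite s0 (le_trans st).
apply: (@le_trans _ _ (ind t s * (dsum m s + 2 * c0 * energy m s))).
  rewrite ler_wpM2l // /dsum; lra.
by rewrite mulrDr lerD ?ler_wpM2r // mulrCA.
Qed.

Let prim_energy_energy m : {ae leb, forall s, 0 <= s <= T -> energy m s = prim_energy m s}.
Proof.
apply: aeS zprim => s Hs sT; apply: eq_Rintegral => xi _.
by have [-> ->] := Hs sT xi.
Qed.

(** Gronwall's lemma bounds the time integral of the energy; put back into [prim_energy_le], this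
    yields a bound at every [t] instead of almost every one. *)
Let prim_energy0 m t : 0 <= t <= T ->
  prim_energy m t <= err m * (1 + 2 * c0 * (2 * (expR (2 * (2 * c0) * T) * T))).
Proof.
move=> tT; apply: (le_trans (prim_energy_le m tT)).
have H : \int[leb]_s (ind t s * energy m s) <= 2 * err m * (expR (2 * (2 * c0) * T) * T).
  apply: (@gronwall_ae R T (2 * c0) (err m) (2 * C ^+ 2 * wt m) (energy m)) => //.
  - by rewrite mulr_gt0.
  - apply: aeS (prim_energy_energy m) => s Hs sT.
    by rewrite Hs //; exact: prim_energy_le.
have cc : 0 <= 2 * c0 by rewrite mulr_ge0 // ltW.
have := ler_wpM2l cc H; lra.
Qed.

Let mprim2 G t : measurable_fun setT (fun q : YT => G q.1 q.2) ->
  measurable_fun setT (fun xi => prim G xi t).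
Proof.
move=> mG; apply: (@measurable_Rint2 _ _ Y RT R leb (fun q => ind t q.2 * G q.1 q.2)).
apply: measurable_funM => //; exact: (measurableT_comp (@measurable_ind R t) measurable_snd).
Qed.

Let prim_sqr_bnd (G : Y -> R -> R) (hz : Y -> R -> R) xi t :
  measurable_fun setT (fun q : YT => G q.1 q.2) -> measurable_fun setT (fun q : YT => hz q.1 q.2) ->
  (forall s, `|G xi s| <= cG * (1 + freq2 xi)) -> (forall s, `|hz xi s| <= C) -> 0 <= t <= T ->
  {ae leb, forall s, 0 <= s <= T -> hz xi s = prim G xi s} ->
  `|prim G xi t ^+ 2| <= 2 * (cG * C * t) * (1 + freq2 xi).
Proof.
move=> mG mh Gb hb tT H; have /andP[t0 _] := tT; rewrite (prim_sqr mG mh Gb tT H).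
have -> : 2 * (cG * C * t) * (1 + freq2 xi) = 2 * \int[leb]_s (cG * (1 + freq2 xi) * C * ind t s).
  by rewrite RintegralZl ?Rint_ind //; [ring|exact: integrable1_ind].
rewrite normrM ger0_norm // ler_wpM2l //.
apply: Rint_norm_le.
- by apply: integrable1Z; exact: integrable1_ind.
- apply: measurable_funM; first exact: measurable_ind.
  by apply: measurable_funM; [exact: (measurable_prod1 xi mG)|exact: (measurable_prod1 xi mh)].
- move=> s; rewrite normrM norm_ind mulrC ler_wpM2r ?ind_ge0 // normrM ler_pM //.
Qed.

Theorem energy_vanishes t : 0 <= t <= T ->
  {ae nu, forall xi, prim rhs_cos xi t = 0 /\ prim rhs_sin xi t = 0}.
Proof.
move=> tT; have /andP[t0 _] := tT.
have ipe m : integrable1 nu (fun xi => W m xi * q1 xi * (prim rhs_cos xi t ^+ 2 + prim rhs_sin xi t ^+ 2)).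
  apply: (@integrable1_dom _ _ _ _ _ (fun xi => (2 * (cG * C * t) + 2 * (cG * C * t)) * W m xi)).
  - apply: measurable_funM => //.
    by apply: measurable_funD; apply: measurable_funX; exact: mprim2.
  - move=> xi; apply: Wq_bnd; rewrite mulrDl; apply: (le_trans (ler_normD _ _)); apply: lerD.
      apply: (@prim_sqr_bnd rhs_cos (fun xi s => hc mu th (z s) xi) xi t mrhs_cos (mhcF mz)) => //.
      by apply: aeS zprim => s Hs sT; have [] := Hs sT xi.
    apply: (@prim_sqr_bnd rhs_sin (fun xi s => hs mu th (z s) xi) xi t mrhs_sin (mhsF mz)) => //.
    by apply: aeS zprim => s Hs sT; have [] := Hs sT xi.
  - exact: integrable1Z.
have i0 xi : 0 <= W 0%N xi * q1 xi * (prim rhs_cos xi t ^+ 2 + prim rhs_sin xi t ^+ 2).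
  by rewrite mulr_ge0 ?addr_ge0 ?sqr_ge0 // mulr_ge0 // ltW.
have E0 : prim_energy 0 t <= 0.
  (* [A] does not depend on [m], as neither the weight nor the kernel enters [c0] and [T]; hence
     [err m * A] still tends to 0. *)
  set A := 1 + 2 * c0 * (2 * (expR (2 * (2 * c0) * T) * T)).
  have c : err m * A @[m --> \oo] --> 0 * A by apply: cvgM => //; exact: cvg_cst.
  rewrite mul0r in c; apply: (cvgr_to_ge c); apply: nearW => m.
  apply: le_trans (prim_energy0 m tT); apply: Rint_le => // xi.
  by rewrite ler_wpM2r ?addr_ge0 ?sqr_ge0 // ler_wpM2r // ltW.
apply: aeS (Rint_eq0_ae (ipe 0%N) i0 E0) => xi /eqP.
rewrite mulf_eq0 gt_eqF ?mulr_gt0 //= paddr_eq0 ?sqr_ge0 // !sqrf_eq0.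
by move=> /andP[/eqP -> /eqP ->].
Qed.
End energy.

(** * Plane-wave test functions *)

Section smooth_functions.
Context (R : realType).
Implicit Types f g : R -> R.

Definition deriv_closed (S : set (R -> R)) :=
  forall f, S f -> exists f', S f' /\ forall x, is_derive x (1:R) f (f' x).
(* Infinite differentiability, coinductively: membership in some class of functions that
   contains a derivative of each of its members. *)
Definition smooth f := exists S, deriv_closed S /\ S f.

Lemma smooth_derivE f : smooth f ->
  exists f', smooth f' /\ forall x, is_derive x (1:R) f (f' x).
Proof.
by move=> [S [dS Sf]]; have [f' [Sf' df]] := dS _ Sf; exists f'; split => //; exists S.
Qed.

Lemma smooth_continuous f : smooth f -> continuous f.
Proof. by move=> /smooth_derivE[f' [_ df]]; exact: is_derive_continuous df. Qed.

(** The closure of the smooth functions under algebraic operations and affine substitution. It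
    contains a derivative of each member, hence is itself a witness of smoothness, and the closure
    properties of [smooth] follow without any formula for higher derivatives. *)
Inductive smooth_hull : (R -> R) -> Prop :=
| hull_base f : smooth f -> smooth_hull f
| hull_add f g : smooth_hull f -> smooth_hull g -> smooth_hull (fun x => f x + g x)
| hull_mul f g : smooth_hull f -> smooth_hull g -> smooth_hull (fun x => f x * g x)
| hull_cst c : smooth_hull (fun=> c)
| hull_inv f : smooth_hull f -> (forall x, f x != 0) -> smooth_hull (fun x => (f x)^-1)
| hull_aff f a b : smooth_hull f -> smooth_hull (fun x => f (a * x + b)).

Lemma deriv_closed_hull : deriv_closed [set f | smooth_hull f].
Proof.
move=> f; elim => {f}.
- by move=> f /smooth_derivE[f' [sf' df]]; exists f'; split => //; exact: hull_base.
- move=> f g _ [f' [hf' df]] _ [g' [hg' dg]]; exists (fun x => f' x + g' x).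
  by split; [exact: hull_add|move=> x; exact: is_deriveD].
- move=> f g hf [f' [hf' df]] hg [g' [hg' dg]]; exists (fun x => f x * g' x + g x * f' x).
  split; first by apply: hull_add; exact: hull_mul.
  by move=> x; apply: is_derive_eq; rewrite /GRing.scale /=.
- by move=> c; exists (fun=> 0); split => [|x]; [exact: hull_cst|exact: is_derive_cst].
- move=> f hf [f' [hf' df]] f0; exists (fun x => (-1) * f' x * ((f x)^-1 * (f x)^-1)).
  split.
    apply: hull_mul; first by apply: hull_mul => //; exact: hull_cst.
    by apply: hull_mul; exact: hull_inv.
  move=> x; have h := is_deriveV (f0 x) (df x).
  by apply: (is_derive_eq h); rewrite /GRing.scale /= expr2 invfM; ring.
- move=> f a b hf [f' [hf' df]]; exists (fun x => a * f' (a * x + b)).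
  split; first by apply: hull_mul; [exact: hull_cst|exact: hull_aff].
  move=> x; have dl : is_derive x (1:R) (fun x => a * x + b) a.
    by apply: is_derive_eq; rewrite /GRing.scale /=; ring.
  have := is_derive1_comp (f := f) (g := fun x => a * x + b) (x := x) (df _) dl.
  by rewrite mulrC.
Qed.

Lemma hull_smooth f : smooth_hull f -> smooth f.
Proof. by move=> hf; exists [set f | smooth_hull f]; split => //; exact: deriv_closed_hull. Qed.

Lemma smoothD f g : smooth f -> smooth g -> smooth (fun x => f x + g x).
Proof. by move=> /hull_base hf /hull_base hg; exact/hull_smooth/hull_add. Qed.

Lemma smoothM f g : smooth f -> smooth g -> smooth (fun x => f x * g x).
Proof. by move=> /hull_base hf /hull_base hg; exact/hull_smooth/hull_mul. Qed.

Lemma smooth_cst c : smooth (fun=> c).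
Proof. exact/hull_smooth/hull_cst. Qed.

Lemma smoothV f : smooth f -> (forall x, f x != 0) -> smooth (fun x => (f x)^-1).
Proof. by move=> /hull_base hf f0; exact/hull_smooth/hull_inv. Qed.

Lemma smooth_aff f a b : smooth f -> smooth (fun x => f (a * x + b)).
Proof. by move=> /hull_base hf; exact/hull_smooth/hull_aff. Qed.

Lemma smooth_cos : smooth (@cos R).
Proof.
exists [set f | exists a b, f = (fun x => a * cos x + b * sin x)]; split; last first.
  by exists 1, 0; apply/funext => x; rewrite mul1r mul0r addr0.
move=> f [a [b ->]]; exists (fun x => b * cos x + (- a) * sin x); split; first by exists b, (- a).
by move=> x; apply: is_derive_eq; rewrite /GRing.scale /=; ring.
Qed.

(** The classical flat function exp(-1/x) with an arbitrary polynomial factor in 1/x, which makes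
    the family closed under differentiation. *)
Definition flat (p : {poly R}) (x : R) : R := if 0 < x then p.[x^-1] * expR (- x^-1) else 0.

Lemma horner_pow_bound (p : {poly R}) : exists c, 0 <= c /\
  forall y, 1 <= y -> `|p.[y]| <= c * y ^+ size p.
Proof.
exists (\sum_(i < size p) `|p`_i|); split; first exact: sumr_ge0.
move=> y y1; rewrite horner_coef mulr_suml; apply: (le_trans (ler_norm_sum _ _ _)).
apply: ler_sum => i _; rewrite normrM ler_wpM2l // normrX ger0_norm ?(le_trans ler01) //.
by rewrite ler_weXn2l // ltnW.
Qed.

(** With y = 1/x and n = [size p], |p(y)| <= c y^n while exp(y) >= y^(n+2) / (n+2)!, and the
    quotient is at most a constant times x^2. The two spare powers give a zero derivative at the
    origin. *)
Lemma flat_bound (p : {poly R}) : exists c, 0 <= c /\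
  forall x, `|x| <= 1 -> `|flat p x| <= c * x ^+ 2.
Proof.
have [c [c0 H]] := horner_pow_bound p; exists (c * (size p).+2`!%:R); split.
  by rewrite mulr_ge0.
move=> x x1; rewrite /flat; case: ifP => x0; last first.
  by rewrite normr0 mulr_ge0 ?sqr_ge0 // mulr_ge0.
move: x1; rewrite (gtr0_norm x0) => x1.
have y1 : 1 <= x^-1 by rewrite invf_ge1.
have y0 : 0 < x^-1 by rewrite invr_gt0.
rewrite normrM (ger0_norm (expR_ge0 _)) expRN.
have E := expR_ge1Dxn (size p).+1 (ltW y0).
have E' : x^-1 ^+ (size p).+2 / (size p).+2`!%:R <= expR x^-1.
  by apply: le_trans E; rewrite lerDr.
have f0 : 0 < (size p).+2`!%:R :> R by rewrite ltr0n fact_gt0.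
have yn : 0 < x^-1 ^+ (size p).+2 by rewrite exprn_gt0.
rewrite ler_pdivrMr ?expR_gt0 //; apply: (le_trans (H _ y1)).
apply: (@le_trans _ _ (c * (size p).+2`!%:R * x ^+ 2 * (x^-1 ^+ (size p).+2 / (size p).+2`!%:R))).
  rewrite le_eqVlt; apply/orP; left; apply/eqP.
  rewrite -[(size p).+2]addn2 exprD; move: (x^-1 ^+ size p) => q.
  by field; rewrite gt_eqF // gt_eqF //= addn2.
by rewrite ler_wpM2l // mulr_ge0 ?sqr_ge0 // mulr_ge0.
Qed.

Lemma is_derive_quadratic f c : (forall x, `|x| <= 1 -> `|f x| <= c * x ^+ 2) ->
  is_derive (0:R) (1:R) f 0.
Proof.
move=> H; have f0 : f 0 = 0.
  by apply/normr0_eq0/eqP; rewrite eq_le normr_ge0 andbT (le_trans (H 0 _)) ?normr0 // expr0n mulr0.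
have cv : h^-1 *: (f (h *: 1 + 0) - f 0) @[h --> 0^'] --> (0 : R).
  apply/cvgr0Pnorm_le => e e0; near=> h.
  have h0 : h != 0 by near: h; exact: nbhs_dnbhs_neq.
  have hn : 0 < `|h| by rewrite normr_gt0.
  have h1 : `|h| <= 1 by apply/ltW; near: h; apply: dnbhs0_lt.
  rewrite f0 subr0 addr0 /GRing.scale /= mulr1 normrM normfV mulrC ler_pdivrMr //.
  apply: (le_trans (H h h1)); rewrite -real_normK ?num_real // expr2 mulrA ler_wpM2r //.
  have c1 : c * `|h| <= (`|c| + 1) * `|h|.
    by rewrite ler_wpM2r // (le_trans (ler_norm c)) // lerDl.
  apply: (le_trans c1); rewrite mulrC -ler_pdivlMr ?ltr_wpDl //.
  apply/ltW; near: h; apply: dnbhs0_lt; rewrite divr_gt0 // ltr_wpDl //.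
by apply: DeriveDef; [exact: cvgP cv|exact: (cvg_lim _ cv)].
Unshelve. all: by end_near. Qed.

Lemma is_derive_horner (p : {poly R}) (x : R) : is_derive x (1:R) (horner p) p^`().[x].
Proof.
elim/poly_ind: p => [|p c IH].
  rewrite deriv0 horner0; apply: (@near_eq_is_derive R R R (fun=> 0)).
  by near=> y; rewrite horner0.
apply: (@near_eq_is_derive R R R (fun y => p.[y] * y + c)).
  by near=> y; rewrite !hornerE.
by apply: is_derive_eq; rewrite /GRing.scale /= derivD derivM derivX derivC !hornerE; ring.
Unshelve. all: by end_near. Qed.

(* With y = 1/x, d/dx (p(y) exp(-y)) = y^2 (p - p')(y) exp(-y). *)
Lemma is_derive_flat (p : {poly R}) (x : R) :
  is_derive x (1:R) (flat p) (flat ('X^2 * (p - p^`())) x).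
Proof.
have [x0|x0|->] := ltrgtP x 0.
- have -> : flat ('X^2 * (p - p^`())) x = 0 by rewrite /flat ltNge (ltW x0).
  apply: (@near_eq_is_derive R R R (fun=> 0)).
  near=> y; have yl : y <= 0 by apply/ltW; near: y; exact: lt_nbhsl.
  by rewrite /flat ltNge yl.
- rewrite /flat x0.
  apply: (@near_eq_is_derive R R R (fun y => p.[y^-1] * expR (- y^-1))).
    near=> y; have yl : 0 < y by near: y; exact: lt_nbhsr.
    by rewrite yl.
  have di : is_derive x (1:R) (fun y : R => y^-1) (- x^-1 ^+ 2).
    apply: (is_derive_eq (is_deriveV (lt0r_neq0 x0) (is_derive_id x (1:R)))).
    by rewrite /GRing.scale /= mulr1 exprVn.
  have dp : is_derive x (1:R) (fun y : R => p.[y^-1]) (p^`().[x^-1] * - x^-1 ^+ 2).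
    exact: (is_derive1_comp (is_derive_horner p _) di).
  have de : is_derive x (1:R) (fun y : R => expR (- y^-1)) (expR (- x^-1) * (x^-1 ^+ 2)).
    have dn : is_derive x (1:R) (fun y : R => - y^-1) (x^-1 ^+ 2).
      by apply: is_derive_eq; rewrite opprK.
    exact: (is_derive1_comp (is_derive_expR _) dn).
  apply: is_derive_eq; rewrite /GRing.scale /= hornerM hornerXn hornerD hornerN; ring.
- have -> : flat ('X^2 * (p - p^`())) 0 = 0 by rewrite /flat ltxx.
  by have [c [_ H]] := flat_bound p; exact: is_derive_quadratic H.
Unshelve. all: by end_near. Qed.

Lemma smooth_flat p : smooth (flat p).
Proof.
exists [set f | exists q, f = flat q]; split; last by exists p.
move=> f [q ->]; exists (flat ('X^2 * (q - q^`()))); split; first by eexists.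
exact: is_derive_flat.
Qed.

Lemma flat1_gt0 x : 0 < x -> 0 < flat 1 x.
Proof. by move=> x0; rewrite /flat x0 hornerE mul1r expR_gt0. Qed.

Lemma flat1_ge0 x : 0 <= flat 1 x.
Proof. by rewrite /flat; case: ifP => // _; rewrite hornerE mul1r expR_ge0. Qed.

(** Smooth transition from 0 on x <= 0 to 1 on x >= 1. The denominator never vanishes because x > 0
    or 1 - x > 0; the argument is written in the shape of [smooth_aff]. *)
Definition step (x : R) : R := flat 1 x * (flat 1 x + flat 1 (- 1 * x + 1))^-1.

Let step_den (x : R) : 0 < flat 1 x + flat 1 (- 1 * x + 1).
Proof.
have [x0|x0] := ltP 0 x; first by rewrite ltr_pwDl ?flat1_gt0 ?flat1_ge0.
rewrite ltr_wpDl ?flat1_ge0 ?flat1_gt0 //; lra.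
Qed.

Lemma smooth_step : smooth step.
Proof.
apply: smoothM; first exact: smooth_flat.
apply: smoothV; last by move=> x; rewrite gt_eqF.
by apply: smoothD; [exact: smooth_flat|apply: smooth_aff; exact: smooth_flat].
Qed.

Lemma step_le0 x : x <= 0 -> step x = 0.
Proof. by move=> x0; rewrite /step {1}/flat ltNge x0 mul0r. Qed.

Lemma step_ge1 x : 1 <= x -> step x = 1.
Proof.
move=> x1; rewrite /step [flat 1 (- 1 * x + 1)]/flat (_ : 0 < _ = false).
  by rewrite addr0 mulfV // gt_eqF // flat1_gt0 // (lt_le_trans ltr01).
by apply/negbTE; rewrite -leNgt; lra.
Qed.

Lemma step_01 x : 0 <= step x <= 1.
Proof.
rewrite /step mulr_ge0 ?flat1_ge0 ?invr_ge0 ?(ltW (step_den _)) //=.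
by rewrite ler_pdivrMr // mul1r lerDl flat1_ge0.
Qed.

(** A smooth cut-off equal to 1 on [-1, 1] and to 0 outside [-2, 2]. *)
Definition plateau (x : R) : R := step (1 * x + 2) * step (- 1 * x + 2).

Lemma smooth_plateau : smooth plateau.
Proof. by apply: smoothM; apply: smooth_aff; exact: smooth_step. Qed.

Lemma plateau_01 x : 0 <= plateau x <= 1.
Proof.
have /andP[a b] := step_01 (1 * x + 2); have /andP[c d] := step_01 (- 1 * x + 2).
by rewrite /plateau mulr_ge0 //= mulr_ile1.
Qed.

Lemma plateau_out x : 2 < `|x| -> plateau x = 0.
Proof.
rewrite ltNge ler_norml negb_and -!ltNge => /orP[h|h]; rewrite /plateau.
  by rewrite step_le0 ?mul0r //; lra.
by rewrite [step (- 1 * _ + _)]step_le0 ?mulr0 //; lra.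
Qed.

Lemma plateau_in x : `|x| <= 1 -> plateau x = 1.
Proof.
by rewrite ler_norml => /andP[a b]; rewrite /plateau !step_ge1 ?mulr1 //; lra.
Qed.

Lemma compact_support_bounded f (a : R) : continuous f -> (forall x, a < `|x| -> f x = 0) ->
  exists c, 0 <= c /\ forall x, `|f x| <= c.
Proof.
move=> cf fa; have ab : - `|a| <= `|a| by rewrite ge0_cp.
have cn : {within `[- `|a|, `|a|], continuous (fun x => `|f x|)}.
  apply: continuous_subspaceT => x; apply: (cvg_comp _ _ (cf x)); exact: norm_continuous.
have [c _ H] := EVT_max ab cn; exists `|f c|; split => // x.
have [xa|xa] := leP `|x| `|a|.
  by apply: H; rewrite in_itv /= -ler_norml.
by rewrite fa ?normr0 // (le_lt_trans (ler_norm a)).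
Qed.

Lemma deriv_out f f' (a : R) : (forall x, is_derive x (1:R) f (f' x)) ->
  (forall x, a < `|x| -> f x = 0) -> forall x, a < `|x| -> f' x = 0.
Proof.
move=> df fa x xa.
have d0 : is_derive x (1:R) f 0.
  apply: (@near_eq_is_derive R R R (fun=> 0)).
  near=> y; rewrite fa //; near: y.
  have cn : `|y| @[y --> x] --> `|x| by exact: norm_continuous.
  exact: (cvgr_gt _ cn).
by have [_ <-] := df x; have [_ ->] := d0.
Unshelve. all: by end_near. Qed.
End smooth_functions.

(** * Admissible test functions in time and space *)

Section test_functions.
Context (R : realType) (d : nat).
Notation V := 'rV[R]_d.
Implicit Types f g : R -> V -> R.

(** Treats the time and space derivatives alike: [line] restricts [f] to the line in direction [k],
    and [base] is the parameter of the point (t, x) on it, namely [t] in time and 0 in space. *)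
Definition line (k : option 'I_d) f (t : R) (x : V) : R -> R :=
  match k with
  | None => fun s => f s x
  | Some j => fun h => f t (x + h *: delta_mx 0 j)
  end.
Definition base (k : option 'I_d) (t : R) : R := if k is None then t else 0.

Lemma line_base k f t x : line k f t x (base k t) = f t x.
Proof. by case: k => [j|] //=; rewrite scale0r addr0. Qed.

Definition has_pd k f g := forall t x, is_derive (base k t) (1:R) (line k f t x) (g t x).

Lemma has_pd_pd k f g : has_pd k f g -> pd k f = g.
Proof.
move=> H; apply/funext => t; apply/funext => x; have [_ E] := H t x.
by case: k H E => [j|] H E; rewrite /= derive1E.
Qed.

Lemma has_pd_pderivable k f g : has_pd k f g -> forall t x, pderivable k f t x.
Proof. by move=> H t x; have [] := H t x; case: k H. Qed.

Definition lin (a : R) (c : V) (b t : R) (x : V) : R := a * t + \sum_j c 0 j * x 0 j + b.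

Definition lin_coef (a : R) (c : V) (k : option 'I_d) : R := if k is Some j then c 0 j else a.

Lemma sum_shift (c x : V) (h : R) j :
  \sum_i c 0 i * (x + h *: delta_mx 0 j) 0 i = \sum_i c 0 i * x 0 i + h * c 0 j.
Proof.
have -> : h * c 0 j = \sum_i c 0 i * (h *: delta_mx 0 j : V) 0 i.
  rewrite (bigD1 j) //= big1 ?addr0; first by rewrite !mxE !eqxx mulr1 mulrC.
  by move=> i ij; rewrite !mxE eqxx (negbTE ij) !mulr0.
by rewrite -big_split /=; apply: eq_bigr => i _; rewrite mxE mulrDr.
Qed.

Lemma is_derive_lin a c b k t x :
  is_derive (base k t) (1:R) (line k (lin a c b) t x) (lin_coef a c k).
Proof.
case: k => [j|] /=.
  rewrite (_ : (fun h => _) = (fun h => lin a c b t x + h * c 0 j)).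
    by apply: is_derive_eq; rewrite /GRing.scale /=; ring.
  apply/funext => h; rewrite /lin.
  rewrite sum_shift.
  ring.
by apply: is_derive_eq; rewrite /GRing.scale /=; ring.
Qed.

Lemma continuous_lin a c b : continuous (fun p : R * V => lin a c b p.1 p.2).
Proof.
move=> p; apply: cvgD; last exact: cvg_cst.
apply: cvgD.
  by apply: cvgM; [exact: cvg_cst|exact: cvg_fst].
elim: (index_enum _) => [|j s IH].
  by rewrite big_nil; under eq_fun do rewrite big_nil; exact: cvg_cst.
rewrite big_cons; under eq_fun do rewrite big_cons.
apply: cvgD => //; apply: cvgM; first exact: cvg_cst.
apply: (cvg_comp (fun p : R * V => p.2) (fun x : V => x 0 j)); first exact: cvg_snd.
exact: coord_continuous.
Qed.

(** The algebra generated by smooth functions of affine forms. It is stable under every partial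
    derivative, so its members are in [Cinf] by a plain induction on the list of derivatives. *)
Inductive tf : (R -> V -> R) -> Prop :=
| tf_atom F a c b : smooth F -> tf (fun t x => F (lin a c b t x))
| tf_add f g : tf f -> tf g -> tf (fun t x => f t x + g t x)
| tf_mul f g : tf f -> tf g -> tf (fun t x => f t x * g t x).

Lemma tf_has_pd f k : tf f -> exists g, tf g /\ has_pd k f g.
Proof.
elim => {f}.
- move=> F a c b sF; have [F' [sF' dF]] := smooth_derivE sF.
  exists (fun t x => lin_coef a c k * F' (lin a c b t x)); split.
    by apply: (@tf_atom (fun s => lin_coef a c k * F' s)); apply: smoothM => //; exact: smooth_cst.
  move=> t x; have dl := is_derive_lin a c b k t x.
  have := is_derive1_comp (f := F) (g := line k (lin a c b) t x) (dF _) dl.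
  by rewrite line_base mulrC; case: k dl.
- move=> f g _ [f' [tf' df]] _ [g' [tg' dg]]; exists (fun t x => f' t x + g' t x).
  split; first exact: tf_add.
  move=> t x; have := is_deriveD (df t x) (dg t x).
  by case: k df dg.
- move=> f g tff [f' [tf' df]] tfg [g' [tg' dg]].
  exists (fun t x => f t x * g' t x + g t x * f' t x).
  split; first by apply: tf_add; exact: tf_mul.
  move=> t x; have h := is_deriveM (df t x) (dg t x); rewrite !line_base in h.
  by case: k df dg h.
Qed.

Lemma tf_continuous f : tf f -> continuous (fun p : R * V => f p.1 p.2).
Proof.
elim => {f}.
- move=> F a c b sF p; apply: (cvg_comp (fun p : R * V => lin a c b p.1 p.2) F).
    exact: continuous_lin.
  exact: smooth_continuous.
- by move=> f g _ cf _ cg p; apply: cvgD; [exact: cf|exact: cg].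
- by move=> f g _ cf _ cg p; apply: cvgM; [exact: cf|exact: cg].
Qed.

Lemma tf_pd f k : tf f -> tf (pd k f).
Proof. by move=> /(tf_has_pd k)[g [tg /has_pd_pd ->]]. Qed.

Lemma tf_Cinf f : tf f -> Cinf f.
Proof.
move=> tff s; have tfs : tf (iterpd s f) by elim: s => [|k s IH] //=; exact: tf_pd.
split; first exact: tf_continuous.
by move=> k t x; have [g [_ H]] := tf_has_pd k tfs; exact: has_pd_pderivable H t x.
Qed.

Lemma tf_time F : smooth F -> tf (fun t _ => F t).
Proof.
move=> sF; rewrite (_ : (fun t _ => F t) = (fun t x => F (lin 1 0 0 t x))); first exact: tf_atom.
apply/funext => t; apply/funext => x; rewrite /lin big1 ?mul1r ?addr0 //.
by move=> j _; rewrite mxE mul0r.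
Qed.

Lemma tf_space F (c : V) b : smooth F -> tf (fun _ x => F (\sum_j c 0 j * x 0 j + b)).
Proof.
move=> sF; rewrite (_ : (fun _ _ => _) = (fun t x => F (lin 0 c b t x))); first exact: tf_atom.
by apply/funext => t; apply/funext => x; rewrite /lin mul0r add0r.
Qed.

Lemma tf_coord F j a : smooth F -> tf (fun _ x => F (x 0 j * a)).
Proof.
move=> sF; have := @tf_space F (a *: delta_mx 0 j) 0 sF; congr tf.
apply/funext => t; apply/funext => x; congr F; rewrite addr0 (bigD1 j) //= big1 ?addr0.
  by rewrite !mxE !eqxx mulr1 mulrC.
by move=> i ij; rewrite !mxE eqxx (negbTE ij) mulr0 mul0r.
Qed.

Lemma tf_prod (I : Type) (s : seq I) (P : pred I) (F : I -> R -> V -> R) : (forall i, tf (F i)) ->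
  tf (fun t x => \prod_(i <- s | P i) F i t x).
Proof.
move=> tF; elim: s => [|i s IH].
  have := tf_time (smooth_cst 1); congr tf.
  by apply/funext => t; apply/funext => x; rewrite big_nil.
have [Pi|Pi] := boolP (P i).
  have := tf_mul (tF i) IH; congr tf.
  by apply/funext => t; apply/funext => x; rewrite big_cons Pi.
move: IH; congr tf; apply/funext => t; apply/funext => x.
by rewrite big_cons (negbTE Pi).
Qed.

Section localized_wave.
Variables (th : R -> R) (N : nat) (xi : V) (a : R).
Hypothesis sth : smooth th.

Definition phase (x : V) : R := \sum_j xi 0 j * x 0 j + a.
Definition scl : R := N.+1%:R^-1.
Definition wave (t : R) (x : V) : R :=
  th t * \prod_j plateau (x 0 j * scl) * cos (phase x).

Lemma tf_wave : tf wave.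
Proof.
apply: tf_mul; last exact: tf_space (smooth_cos R).
apply: tf_mul; first exact: tf_time.
by apply: tf_prod => j; apply: tf_coord; exact: smooth_plateau.
Qed.

Lemma wave_test (al be : R) : 0 < al -> (forall t, ~~ (al <= t <= be) -> th t = 0) ->
  test_fun wave.
Proof.
move=> al0 th0; split; first exact: tf_Cinf tf_wave.
pose A : set R := `[- (2 * N.+1%:R), 2 * N.+1%:R]%classic.
exists (`[al, be] `*` [set v : V | forall i, A (v ord0 i)]); split.
- apply: compact_setX; first exact: segment_compact.
  by apply: (@rV_compact _ _ (fun=> A)) => i; exact: segment_compact.
- move=> p [] /=; rewrite in_itv /= => /andP[h _] _; exact: lt_le_trans h.
- move=> [t x] /= H; rewrite /wave; have [tt|/th0 ->] := boolP (al <= t <= be); last by rewrite !mul0r.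
  have [/forallP h|] := boolP [forall j, `|x 0 j * scl| <= 2].
    exfalso; apply: H; split; rewrite /= ?in_itv //= => i; rewrite /A /= in_itv /= -ler_norml.
    by have := h i; rewrite normrM [`|scl|]ger0_norm ?invr_ge0 // ler_pdivrMr.
  rewrite negb_forall => /existsP[j]; rewrite -ltNge => hj.
  by rewrite (bigD1 j) //= plateau_out // mul0r mulr0 mul0r.
Qed.

Definition others (j : 'I_d) (x : V) : R := \prod_(i | i != j) plateau (x 0 i * scl).
(* The shape of wave and of its derivatives along x_j. *)
Definition wave_form (j : 'I_d) (u v : R -> R) (t : R) (x : V) : R :=
  th t * others j x * (u (x 0 j) * cos (phase x) + v (x 0 j) * sin (phase x)).

Lemma waveE j : wave = wave_form j (fun y => plateau (y * scl)) (fun=> 0).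
Proof.
apply/funext => t; apply/funext => x.
by rewrite /wave /wave_form /others (bigD1 j) //= mul0r addr0; ring.
Qed.

(** [others] does not depend on x_j, and differentiating the phase only mixes the pair (u, v). The
    form is thus preserved, and a second application gives the second derivative. *)
Lemma pd_wave_form j u v u' v' :
  (forall y, is_derive y (1:R) u (u' y)) -> (forall y, is_derive y (1:R) v (v' y)) ->
  pd (Some j) (wave_form j u v) =
  wave_form j (fun y => u' y + xi 0 j * v y) (fun y => v' y - xi 0 j * u y).
Proof.
move=> du dv; apply: has_pd_pd => t x /=.
have ph h : phase (x + h *: delta_mx 0 j) = phase x + h * xi 0 j.
  rewrite /phase.
  rewrite sum_shift.
  ring.
have ot h : others j (x + h *: delta_mx 0 j) = others j x.
  by apply: eq_bigr => i ij; rewrite !mxE eqxx (negbTE ij) mulr0 addr0.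
have xj h : (x + h *: delta_mx 0 j) 0 j = x 0 j + h by rewrite !mxE !eqxx mulr1.
rewrite (_ : (fun h => _) = (fun h => th t * others j x * (u (x 0 j + h) * cos (phase x + h * xi 0 j) + v (x 0 j + h) * sin (phase x + h * xi 0 j)))); last first.
  by apply/funext => h; rewrite /wave_form ph ot xj.
have d1 : is_derive (0:R) (1:R) (fun h => x 0 j + h) 1.
  by have := is_deriveD (is_derive_cst (x 0 j) (0:R) (1:R)) (is_derive_id (0:R) (1:R)); rewrite add0r.
have d2 : is_derive (0:R) (1:R) (fun h => phase x + h * xi 0 j) (xi 0 j).
  by apply: is_derive_eq; rewrite /GRing.scale /=; ring.
have du0 : is_derive (0:R) (1:R) (fun h => u (x 0 j + h)) (u' (x 0 j)).
  have := is_derive1_comp (f := u) (du (x 0 j + 0)) d1; by rewrite mulr1 addr0.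
have dv0 : is_derive (0:R) (1:R) (fun h => v (x 0 j + h)) (v' (x 0 j)).
  have := is_derive1_comp (f := v) (dv (x 0 j + 0)) d1; by rewrite mulr1 addr0.
have dc : is_derive (0:R) (1:R) (fun h => cos (phase x + h * xi 0 j)) (- sin (phase x) * xi 0 j).
  have := is_derive1_comp (f := @cos R) (g := fun h => phase x + h * xi 0 j) (is_derive_cos (phase x + 0 * xi 0 j)) d2; by rewrite mul0r addr0.
have ds : is_derive (0:R) (1:R) (fun h => sin (phase x + h * xi 0 j)) (cos (phase x) * xi 0 j).
  have := is_derive1_comp (f := @sin R) (g := fun h => phase x + h * xi 0 j) (is_derive_sin (phase x + 0 * xi 0 j)) d2; by rewrite mul0r addr0.
have dw := is_deriveZ (th t * others j x) (is_deriveD (is_deriveM du0 dc) (is_deriveM dv0 ds)).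
move: dw; rewrite /GRing.scale /= !addr0 mul0r addr0 => dw.
rewrite /wave_form; apply: (is_derive_eq dw); ring.
Qed.

Lemma pd_time_wave th' : (forall t, is_derive t (1:R) th (th' t)) ->
  pd None wave = fun t x => th' t * \prod_j plateau (x 0 j * scl) * cos (phase x).
Proof.
move=> dth; apply: has_pd_pd => t x /=.
pose c := \prod_j plateau (x 0 j * scl) * cos (phase x).
rewrite (_ : (fun s => _) = (fun s => th s * c)); last by apply/funext => s; rewrite /wave mulrA.
by have dt := dth t; apply: is_derive_eq; rewrite /GRing.scale /= /c; ring.
Qed.
End localized_wave.
End test_functions.

(** * Uniform bounds and limits of the localized waves *)

Section wave_limits.
Context (R : realType) (d : nat).
Notation V := 'rV[R]_d.
Variables (th th' : R -> R) (c0 : R).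
Hypothesis dth : forall t, is_derive t (1:R) th (th' t).
Hypothesis thc : forall t, `|th t| <= c0.
Hypothesis thc' : forall t, `|th' t| <= c0.
Variables (xi : V) (a : R).
Notation wave N := (@wave R d th N xi a).
Notation phase := (@phase R d xi a).

Let c0_ge0 : 0 <= c0. Proof. exact: le_trans (thc 0). Qed.

Lemma norm_prod01 (I : Type) (s : seq I) (P : pred I) (F : I -> R) :
  (forall i, 0 <= F i <= 1) -> `|\prod_(i <- s | P i) F i| <= 1.
Proof.
move=> h; rewrite normr_prod; elim: s => [|i s IH]; first by rewrite big_nil.
rewrite big_cons; case: (P i) => //; have /andP[f0 f1] := h i.
by rewrite mulr_ile1 // ?prodr_ge0 // ger0_norm.
Qed.

Lemma norm_wave_form N (j : 'I_d) (u v : R -> R) t (x : V) (A B : R) : `|u (x 0 j)| <= A -> `|v (x 0 j)| <= B ->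
  `|wave_form th N xi a j u v t x| <= c0 * (A + B).
Proof.
move=> uA vB; rewrite /wave_form !normrM ler_pM //.
  by rewrite -[leRHS]mulr1 ler_pM //; apply: norm_prod01 => i; exact: plateau_01.
apply: (le_trans (ler_normD _ _)); rewrite !normrM lerD //.
  by apply: le_trans uA; rewrite ler_piMr // norm_cos_le1.
by apply: le_trans vB; rewrite ler_piMr // norm_sin_le1.
Qed.

Lemma near_scl (y : R) : \forall N \near \oo, `|y * scl R N| < 1.
Proof.
have h : (fun N : nat => y * N.+1%:R^-1) @ \oo --> (0:R).
  by rewrite -(mulr0 y); apply: cvgMl_tmp; exact: cvg_harmonic.
by have /cvgr0Pnorm_lt := h; apply.
Qed.

Lemma is_derive_plateau_scl (f f' : R -> R) N : (forall x, is_derive x (1:R) f (f' x)) ->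
  forall y, is_derive y (1:R) (fun y => f (y * scl R N)) (f' (y * scl R N) * scl R N).
Proof.
move=> df y.
have dl : is_derive y (1:R) (fun y => y * scl R N) (scl R N).
  by apply: is_derive_eq; rewrite /GRing.scale /=; ring.
exact: (is_derive1_comp (f := f) (g := fun y => y * scl R N) (df _) dl).
Qed.

Lemma deriv_near_cst (f f' : R -> R) c x : (forall x, is_derive x (1:R) f (f' x)) ->
  (\forall y \near x, f y = c) -> f' x = 0.
Proof.
move=> df fc; have [_ <-] := df x.
have d0 : is_derive x (1:R) f 0.
  by apply: (@near_eq_is_derive R R R (fun=> c)); apply: filterS fc => y ->.
by have [_ ->] := d0.
Qed.

Lemma deriv_in (f f' : R -> R) c : (forall x, is_derive x (1:R) f (f' x)) ->
  (forall x, `|x| < 1 -> f x = c) -> forall x : R, `|x| < 1 -> f' x = 0.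
Proof.
move=> df fc x x1; apply: (deriv_near_cst df (c := c)); near=> y.
apply: fc; near: y; have cn : `|y| @[y --> x] --> `|x| by exact: norm_continuous.
exact: (cvgr_lt _ cn).
Unshelve. all: by end_near.
Qed.

Lemma scl_01 N : 0 <= scl R N <= 1.
Proof. by rewrite /scl invr_ge0 ler0n /= invf_le1 ?ler1n. Qed.

(** The bounds are uniform in [N] because each derivative of the cut-off brings a factor [scl] <= 1.
    At a fixed point the scaled coordinates eventually lie in (-1, 1), where the cut-off is 1 and
    its derivatives vanish, so the limits are attained for all large [N]. The clause on zeros of
    [th] and [th'] confines the derivatives to the time support. *)
Lemma wave_derivs : exists c1 c2 : R, [/\ 0 <= c1, 0 <= c2,
  forall N t x, [/\ `|pd None (wave N) t x| <= c0,
     forall j, `|pd (Some j) (wave N) t x| <= c0 * (c1 + `|xi 0 j|) &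
     forall j, `|pd (Some j) (pd (Some j) (wave N)) t x|
        <= c0 * (c2 + `|xi 0 j| ^+ 2 + 2 * (`|xi 0 j| * c1))] /\
    (th t = 0 -> th' t = 0 -> [/\ pd None (wave N) t x = 0, forall j, pd (Some j) (wave N) t x = 0 &
      forall j, pd (Some j) (pd (Some j) (wave N)) t x = 0]) &
  forall t x, \forall N \near \oo, [/\ pd None (wave N) t x = th' t * cos (phase x),
     forall j, pd (Some j) (wave N) t x = - (th t * xi 0 j * sin (phase x)) &
     forall j, pd (Some j) (pd (Some j) (wave N)) t x = - (th t * xi 0 j ^+ 2 * cos (phase x))]].
Proof.
have [p1 [sp1 dp1]] := smooth_derivE (@smooth_plateau R).
have [p2 [sp2 dp2]] := smooth_derivE sp1.
have o1 := deriv_out dp1 (@plateau_out R).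
have o2 := deriv_out dp2 o1.
have i1 := deriv_in dp1 (fun x h => plateau_in (ltW h)).
have i2 := deriv_in dp2 i1.
have [c1 [c10 b1]] := compact_support_bounded (smooth_continuous sp1) o1.
have [c2 [c20 b2]] := compact_support_bounded (smooth_continuous sp2) o2.
exists c1, c2.
have E1 N j : pd (Some j) (wave N) = wave_form th N xi a j
    (fun y => p1 (y * scl R N) * scl R N) (fun y => - xi 0 j * plateau (y * scl R N)).
  rewrite (waveE th N xi a j) (pd_wave_form _ _ _ _ _ (is_derive_plateau_scl N dp1) (v' := fun=> 0)).
  by congr wave_form; apply/funext => y; ring.
have E2 N j : pd (Some j) (pd (Some j) (wave N)) = wave_form th N xi a j
    (fun y => p2 (y * scl R N) * scl R N * scl R N - xi 0 j ^+ 2 * plateau (y * scl R N))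
    (fun y => - 2 * xi 0 j * (p1 (y * scl R N) * scl R N)).
  rewrite E1.
  have du y : is_derive y (1:R) (fun y => p1 (y * scl R N) * scl R N)
      (p2 (y * scl R N) * scl R N * scl R N).
    have h := is_derive_plateau_scl N dp2 y.
    by apply: is_derive_eq; rewrite /GRing.scale /=; ring.
  have dv y : is_derive y (1:R) (fun y => - xi 0 j * plateau (y * scl R N))
      (- xi 0 j * (p1 (y * scl R N) * scl R N)).
    have h := is_derive_plateau_scl N dp1 y.
    by apply: is_derive_eq; rewrite /GRing.scale /=; ring.
  rewrite (pd_wave_form _ _ _ _ _ du dv).
  by congr wave_form; apply/funext => y; ring.
have E0 N := pd_time_wave N xi a dth.
split => // [N t x|t x].
  have /andP[s0 s1] := scl_01 N.
  split; last first.
    by move=> th0 th0'; split=> [|j|j]; rewrite ?E0 ?E2 ?E1 /wave_form ?th0 ?th0' !mul0r.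
  split => [|j|j].
  - rewrite E0 !normrM -[leRHS]mulr1 ler_pM // ?norm_cos_le1 //.
    by rewrite -[leRHS]mulr1 ler_pM //; apply: norm_prod01 => i; exact: plateau_01.
  - rewrite E1; apply: norm_wave_form.
      by rewrite normrM -[leRHS]mulr1 ler_pM // ger0_norm.
    rewrite normrM normrN -[leRHS]mulr1 ler_pM //.
    by have /andP[? ?] := plateau_01 (x 0 j * scl R N); rewrite ger0_norm.
  - rewrite E2; apply: norm_wave_form.
      apply: (le_trans (ler_normB _ _)); rewrite lerD //.
        by rewrite -mulrA normrM -[leRHS]mulr1 ler_pM // ger0_norm ?mulr_ile1 // mulr_ge0.
      rewrite normrM normrX -[leRHS]mulr1 ler_pM // ?exprn_ge0 //.
      by have /andP[? ?] := plateau_01 (x 0 j * scl R N); rewrite ger0_norm.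
    rewrite -mulrA normrM normrN normr_nat ler_pM2l // normrM ler_pM //.
    by rewrite normrM -[leRHS]mulr1 ler_pM // ger0_norm.
have H : \forall N \near \oo, forall j, `|x 0 j * scl R N| < 1.
  by apply: filter_forall => j; exact: near_scl.
near=> N.
have hN : forall j, `|x 0 j * scl R N| < 1 by near: N.
have pl j : plateau (x 0 j * scl R N) = 1 by rewrite plateau_in // ltW.
have ot j : others N j x = 1 by rewrite /others big1.
split => [|j|j].
- by rewrite E0 big1 // mulr1.
- by rewrite E1 /wave_form ot pl i1 //; ring.
- by rewrite E2 /wave_form ot pl i1 // i2 //; ring.
Unshelve. all: by end_near.
Qed.
End wave_limits.

(** * Measurability and truncation *)

Section caratheodory.
Context d (Z : measurableType d) (R : realType).

(** [r] is rounded down to the grid of step 1/(N+1). On each of the countably many level sets the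
    second argument of [H] is constant, and continuity in that argument passes to the limit. *)
Lemma measurable_caratheodory (H : Z -> R -> R) (r : Z -> R) :
  (forall s, measurable_fun setT (H^~ s)) -> (forall z, continuous (H z)) ->
  measurable_fun setT r -> measurable_fun setT (fun z => H z (r z)).
Proof.
move=> mH cH mr; pose q N (s : R) : R := (Num.floor (s * N.+1%:R))%:~R / N.+1%:R.
apply: (@measurable_fun_cvg _ _ _ _ (fun N z => H z (q N (r z)))).
  move=> N _ Y mY; rewrite setTI.
  rewrite (_ : _ @^-1` Y = \bigcup_(k : int) ([set z | k%:~R <= r z * N.+1%:R < (k + 1)%:~R] `&`
    (H^~ (k%:~R / N.+1%:R) @^-1` Y))).
    apply: countable_bigcupT_measurable => [|k]; first exact: countableP.
    apply: measurableI; last first.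
      by rewrite -[X in measurable X]setTI; exact: mH.
    rewrite (_ : [set z | _] = (fun z => r z * N.+1%:R) @^-1` `[k%:~R, (k + 1)%:~R[%classic).
      by rewrite -[X in measurable X]setTI; apply: measurable_funM.
    by apply/seteqP; split => z /=; rewrite in_itv.
  apply/seteqP; split => [z /= Yz|z [k _] [/= /andP[k1 k2]]].
    exists (Num.floor (r z * N.+1%:R)) => //; split => //=.
    by rewrite floor_le /= floorD1_gt.
  by rewrite /q (floor_def (m := k)) // k1.
move=> z _; apply: (cvg_comp (fun N => q N (r z)) (H z)); last exact: cH.
have c : (fun N : nat => r z - N.+1%:R^-1) @ \oo --> r z - 0.
  by apply: cvgB; [exact: cvg_cst|exact: cvg_harmonic].
rewrite subr0 in c; apply: (squeeze_cvgr _ c (@cvg_cst _ _ _ _ _)).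
near=> N; have N0 : 0 < N.+1%:R :> R by rewrite ltr0n.
rewrite /q; apply/andP; split; last by rewrite ler_pdivrMr // floor_le.
rewrite ler_pdivlMr // mulrBl mulVf ?gt_eqF // lerBlDr -[1]/(1%:~R) -intrD.
by have /andP[_ /ltW] := floor_itv (r z * N.+1%:R).
Unshelve. all: by end_near.
Qed.
End caratheodory.

Section continuous_on_coordinates.
Context d (Z : measurableType d) (R : realType) (n : nat).
Notation V := 'rV[R]_n.

(** [a] takes values in the iterated product while [F] is continuous on row vectors. The coordinates
    are inserted one at a time, each by [measurable_caratheodory] along a basis direction. *)
Lemma measurable_continuous_coord (F : V * R -> R) (a : Z -> mT (lebn R n)) (r : Z -> R) :
  continuous F -> measurable_fun setT a -> measurable_fun setT r ->
  measurable_fun setT (fun z => F (fromcoord (a z), r z)).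
Proof.
move=> cF ma mr; apply: (@measurable_caratheodory _ _ _ (fun z s => F (fromcoord (a z), s))) => //.
- move=> s0.
  have aff (v u : V) : continuous (fun s : R => v + s *: u).
    move=> s; apply: cvgD; first exact: cvg_cst.
    by apply: cvgZr_tmp; exact: cvg_id.
  (* Induction on the list of inserted coordinates. The base vector [v] is general because freezing
     one coordinate at [s] moves it. *)
  have key (l : seq 'I_n) (v : V) :
      measurable_fun setT (fun z => F (v + \sum_(j <- l) co (a z) j *: delta_mx 0 j, s0)).
    elim: l v => [|j l IH] v.
      by under eq_fun do rewrite big_nil; exact: measurable_cst.
    under eq_fun do rewrite big_cons addrCA addrA [_ + v]addrC.
    apply: (@measurable_caratheodory _ _ _ (fun z s => F (v + s *: delta_mx 0 j +
      \sum_(j <- l) co (a z) j *: delta_mx 0 j, s0)) (fun z => co (a z) j)).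
    + by move=> s; exact: IH.
    + move=> z s; have cE : continuous (fun s : R => (v + s *: delta_mx 0 j +
        \sum_(j <- l) co (a z) j *: delta_mx 0 j : V, s0)).
        move=> s1; apply: (@cvg_pair _ _ _ _ (nbhs (v + s1 *: delta_mx 0 j +
          \sum_(j <- l) co (a z) j *: delta_mx 0 j : V)) (nbhs s0)).
          by apply: cvgD; [exact: aff|exact: cvg_cst].
        exact: cvg_cst.
      exact: (cvg_comp _ F (cE s) (cF _)).
    + exact: (measurableT_comp (measurable_co j) (g := a)).
  have := key (index_enum 'I_n) 0; congr (measurable_fun _ _); apply/funext => z.
  by rewrite add0r [in RHS](row_sum_delta (fromcoord (a z))).
- move=> z s; have cE : continuous (fun s : R => (fromcoord (a z), s)).
    move=> s1; apply: (@cvg_pair _ _ _ _ (nbhs (fromcoord (a z))) (nbhs s1)).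
      exact: cvg_cst.
    exact: cvg_id.
  exact: (cvg_comp _ F (cE s) (cF _)).
Qed.
End continuous_on_coordinates.

Section lipschitz.
Context (R : realType).

Lemma derive1_bound_lipschitz (f : R -> R) (M c : R) : (forall r, derivable f r 1) ->
  (forall r, `|r| <= M -> `|derive1 f r| <= c) ->
  forall r1 r2, `|r1| <= M -> `|r2| <= M -> `|f r1 - f r2| <= c * `|r1 - r2|.
Proof.
move=> df fc; suff le r1 r2 : `|r1| <= M -> `|r2| <= M -> r2 <= r1 ->
    `|f r1 - f r2| <= c * `|r1 - r2|.
  move=> r1 r2 h1 h2; have [/ltW h|h] := ltP r1 r2; last exact: le.
  by rewrite distrC [`|r1 - r2|]distrC le.
move=> h1 h2 r21.
have D x : is_derive x (1:R) f (derive1 f x) by rewrite derive1E; exact: DeriveDef.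
have cf : {within `[r2, r1], continuous f}.
  by apply: continuous_subspaceT => x; have [/derivable1_diffP/differentiable_continuous] := D x.
have [s] := MVT_segment r21 (fun x _ => D x) cf.
rewrite in_itv /= => /andP[s1 s2] ->.
rewrite normrM ler_wpM2r // fc //.
by move: h1 h2; rewrite !ler_norml => /andP[? ?] /andP[? ?]; apply/andP; split; lra.
Qed.

Lemma continuous_bounded_ball (f : R -> R) (M : R) : continuous f ->
  exists c, forall r, `|r| <= M -> `|f r| <= c.
Proof.
move=> cf; have [M0|M0] := ltP M 0.
  by exists 0 => r rM; have := normr_ge0 r; rewrite leNgt (le_lt_trans rM).
have cn : {within `[- M, M], continuous (fun x => `|f x|)}.
  apply: continuous_subspaceT => x; apply: (cvg_comp f (fun y => `|y|) (cf x)).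
  exact: norm_continuous.
have [|c _ H] := EVT_max _ cn; first by rewrite ge0_cp.
by exists `|f c| => r; rewrite ler_norml => rM; apply: H; rewrite in_itv.
Qed.
End lipschitz.

Section sections_of_null_sets.
Context d1 d2 (X : measurableType d1) (Y : measurableType d2) (R : realType).
Variables (mu : {sigma_finite_measure set X -> \bar R})
  (nu : {sigma_finite_measure set Y -> \bar R}).

Lemma ae_prod1 (P : X -> Prop) : {ae mu, forall x, P x} ->
  {ae (mu \x nu)%E, forall p : X * Y, P p.1}.
Proof.
move=> [N [mN N0 sN]]; exists (N `*` setT); split; first exact: measurableX.
  by have /= := @product_measure1E _ _ _ _ _ mu nu _ _ mN measurableT; rewrite N0 mul0e.
by move=> [x y] /= nP; split => //; exact: sN.
Qed.

Lemma ae_sections1 (P : X * Y -> Prop) : {ae (mu \x nu)%E, forall p, P p} ->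
  {ae mu, forall x, {ae nu, forall y, P (x, y)}}.
Proof.
move=> [N [mN N0 sN]].
have h : {ae mu, forall x, nu (xsection N x) = 0%E}.
  have mf := measurable_fun_xsection nu mN.
  have e0 : (\int[mu]_x `|nu (xsection N x)| = 0)%E.
    by rewrite -[RHS]N0; apply: eq_integral => x _; rewrite gee0_abs.
  have := (ae_eq_integral_abs mu measurableT mf).1 e0.
  by apply: aeS => x; apply.
apply: aeS h => x Nx; exists (xsection N x); split => //; first exact: measurable_xsection.
by move=> y nP; apply/xsectionP; exact: sN.
Qed.
End sections_of_null_sets.

(** * Bounded representatives of solutions *)

Section space_time.
Context (R : realType) (d : nat).
Notation X := (mT (lebn R d)).
Notation RT := (measurableTypeR R).
Notation leb := (@lebesgue_measure R).
Notation LX := (leb \x Leb R d)%E.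
Notation V := 'rV[R]_d.

(** The two product measures slice in opposite orders. They agree on rectangles, hence everywhere by
    uniqueness of the product measure. *)
Lemma lebtxE (A : set (RT * X)) : measurable A -> LX A = (@lebtx R d) A.
Proof.
move=> mA; apply: product_measure_unique => // A1 A2 m1 m2.
exact: product_measure2E.
Qed.

Lemma ae_lebtx (P : RT * X -> Prop) : {ae (@lebtx R d), forall p, P p} -> {ae LX, forall p, P p}.
Proof. by move=> [N [mN N0 sN]]; exists N; split => //; rewrite lebtxE. Qed.

Lemma integral_lebtx (f : RT * X -> \bar R) :
  (\int[(@lebtx R d)]_p f p = \int[LX]_p f p)%E.
Proof. by apply/esym/eq_measure_integral => A mA _; exact: lebtxE. Qed.

Lemma integrable_lebtx (f : RT * X -> \bar R) :
  (@lebtx R d).-integrable setT f -> LX.-integrable setT f.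
Proof.
by move=> /integrableP[mf fi]; apply/integrableP; split => //; rewrite -integral_lebtx.
Qed.

(** [u] is set to zero outside (0, T), at points where it exceeds the essential bound, and on whole
    time slices whose L^1 norm is too large. Only null sets are affected inside the strip, and
    afterwards all the bounds hold everywhere. *)
Lemma truncation (T : R) (u : R -> V -> R) : (forall t, 0 <= t -> measRd (u t)) ->
  sol_class T u ->
  exists (U : R -> X -> R) (M C : R), [/\ measurable_fun setT (fun p : RT * X => U p.1 p.2),
    forall t x, `|U t x| <= M, forall t, integrable1 (Leb R d) (U t),
    forall t, \int[Leb R d]_x `|U t x| <= C &
    {ae LX, forall p : RT * X, 0 < p.1 < T -> U p.1 p.2 = u p.1 (fromcoord p.2)}].
Proof.
move=> mu [[C0 hC] mU [M0 hM]].
(* The maxima with 0 ensure that the zero function obeys the bounds too. *)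
pose M := Num.max M0 0; pose C := Num.max C0 0.
pose D : set (RT * X) := [set p | 0 < p.1 < T].
have mD : measurable D.
  rewrite (_ : D = (fst @^-1` `]0, T[%classic)); last by apply/seteqP; split => p /=; rewrite in_itv.
  by rewrite -[X in measurable X]setTI; exact: measurable_fst.
pose v (p : RT * X) : R := u p.1 (fromcoord p.2).
have mv : measurable_fun D v by exact: mU.
pose U0 (p : RT * X) : R := if (0 < p.1 < T) && (`|v p| <= M) then v p else 0.
have mU0 : measurable_fun setT U0.
  pose v0 := v \_ D.
  have mv0 : measurable_fun setT v0 by apply/(measurable_restrictT _ mD).
  rewrite (_ : U0 = fun p => if `|v0 p| <= M then v0 p else 0).
    apply: measurable_fun_ifT => //; apply: measurable_fun_ler => //.
    exact: measurableT_comp.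
  apply/funext => p; rewrite /U0 /v0 /patch; have [h|h] := boolP (0 < p.1 < T).
    by rewrite mem_set.
  by rewrite memNset /= ?if_same //; exact/negP.
have U0M p : `|U0 p| <= M.
  by rewrite /U0; case: ifP => [/andP[]//|_]; rewrite normr0 le_max lexx orbT.
pose e t := (\int[Leb R d]_x `|U0 (t, x)|%:E)%E.
have mE : measurable_fun setT (e : RT -> \bar R).
  apply: (measurable_fun_fubini_tonelli_F (fun p => `|U0 p|%:E)) => //.
  by apply/measurable_EFinP; exact: measurableT_comp.
pose U t x := if (e t <= C%:E)%E then U0 (t, x) else 0.
have mUU : measurable_fun setT (fun p : RT * X => U p.1 p.2).
  rewrite (_ : (fun p => _) = fun p : RT * X => if (e p.1 <= C%:E)%E then U0 p else 0).
    apply: measurable_fun_ifT => //.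
    apply: measurable_fun_lee => //.
    exact: measurableT_comp.
  by apply/funext => -[].
have UC t : (\int[Leb R d]_x `|U t x|%:E <= C%:E)%E.
  rewrite /U; have [//|_] := boolP (e t <= C%:E)%E.
  rewrite integral0_eq ?lee_fin ?le_max ?lexx ?orbT //.
  by move=> x _; rewrite normr0.
have Ui t : integrable1 (Leb R d) (U t).
  apply/integrableP; split; first by apply/measurable_EFinP; exact: (measurable_prod1 (t : RT) mUU).
  by apply: le_lt_trans (UC t) _; rewrite ltry.
exists U, M, C; split => //.
- by move=> t x; rewrite /U; case: ifP => // _; rewrite normr0 le_max lexx orbT.
- by move=> t; have := UC t; rewrite (integrable1_EFin (integrable1_norm (Ui t))) lee_fin.
have good : {ae leb, forall t, (e t <= C%:E)%E}.
  apply: aeS hC => t Ht; have [tT|tT] := boolP (0 < t < T); last first.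
    rewrite /e integral0_eq ?lee_fin ?le_max ?lexx ?orbT //.
    by move=> x _; rewrite /U0 (negbTE tT) normr0.
  apply: (@le_trans _ _ C0%:E); last by rewrite lee_fin le_max lexx.
  apply: le_trans (Ht tT); apply: ge0_le_integral => //.
  - by apply/measurable_EFinP; apply: measurableT_comp => //; exact: (measurable_prod1 (t : RT) mU0).
  - apply/measurable_EFinP; apply: measurableT_comp => //; apply: mu.
    by have /andP[/ltW] := tT.
  - move=> x _; rewrite lee_fin /U0 /v /= tT /=; case: ifP => // _; by rewrite normr0.
have := ae_and (ae_lebtx hM) (ae_prod1 (Leb R d) good).
apply: aeS => -[t x] /= [h1 h2] tT; rewrite /U h2 /U0 /= tT /=.
by rewrite /v /= le_max h1.
Qed.
End space_time.

(** * The weak equation for the truncations *)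

Section truncated_weak_form.
Context (R : realType) (d : nat).
Notation X := (mT (lebn R d)).
Notation RT := (measurableTypeR R).
Notation leb := (@lebesgue_measure R).
Notation LX := (leb \x Leb R d)%E.
Notation V := 'rV[R]_d.
Implicit Types (phi : R -> V -> R) (U : R -> X -> R).
Variables (beta : R -> R) (b : V -> R -> V).
Hypothesis cbeta : continuous beta.
Hypothesis cb : forall j, continuous (fun p : V * R => b p.1 p.2 0 j).

Lemma measurable_continuous_RRd (F : R -> V -> R) : continuous (fun p : R * V => F p.1 p.2) ->
  measurable_fun setT (fun p : RT * X => F p.1 (fromcoord p.2)).
Proof.
move=> cF; apply: (@measurable_continuous_coord _ (RT * X)%type R d (fun p => F p.2 p.1) snd fst) => //.
have sw : continuous (fun p : V * R => (p.2, p.1)).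
  move=> p; apply: (@cvg_pair _ _ _ _ (nbhs p.2) (nbhs p.1)); [exact: cvg_snd|exact: cvg_fst].
by move=> p; exact: (cvg_comp _ (fun p : R * V => F p.1 p.2) (sw p) (cF _)).
Qed.

Definition flux j U t x : R := b (fromcoord x) (U t x) 0 j * U t x.

Definition weak_integrand U phi (p : RT * X) : R :=
  U p.1 p.2 * pd None phi p.1 (fromcoord p.2) +
  beta (U p.1 p.2) * laplacian phi p.1 (fromcoord p.2) +
  \sum_j flux j U p.1 p.2 * pd (Some j) phi p.1 (fromcoord p.2).

Lemma measurable_beta U : measurable_fun setT (fun p : RT * X => U p.1 p.2) ->
  measurable_fun setT (fun p : RT * X => beta (U p.1 p.2)).
Proof.
move=> mU; apply: (measurableT_comp (f := beta)) => //; exact: continuous_measurable_fun.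
Qed.

Lemma measurable_flux j U : measurable_fun setT (fun p : RT * X => U p.1 p.2) ->
  measurable_fun setT (fun p : RT * X => flux j U p.1 p.2).
Proof.
move=> mU; apply: measurable_funM => //.
exact: (@measurable_continuous_coord _ (RT * X)%type R d (fun p => b p.1 p.2 0 j) snd).
Qed.

Lemma measurable_iterpd phi s : Cinf phi ->
  measurable_fun setT (fun p : RT * X => iterpd s phi p.1 (fromcoord p.2)).
Proof. by move=> sphi; apply: measurable_continuous_RRd; exact: (sphi s).1. Qed.

Lemma measurable_laplacian phi : Cinf phi ->
  measurable_fun setT (fun p : RT * X => laplacian phi p.1 (fromcoord p.2)).
Proof.
by move=> sphi; apply: measurable_sum => j; exact: (measurable_iterpd [:: Some j; Some j] sphi).
Qed.

Lemma measurable_weak_integrand U phi : measurable_fun setT (fun p : RT * X => U p.1 p.2) ->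
  Cinf phi -> measurable_fun setT (weak_integrand U phi).
Proof.
move=> mU sphi; apply: measurable_funD; first apply: measurable_funD.
- by apply: measurable_funM => //; exact: (measurable_iterpd [:: None] sphi).
- by apply: measurable_funM; [exact: measurable_beta|exact: measurable_laplacian].
- apply: measurable_sum => j; apply: measurable_funM; first exact: measurable_flux.
  exact: (measurable_iterpd [:: Some j] sphi).
Qed.

(** The integrand involves [phi] only through derivatives. These vanish outside (0, T), where [U]
    and [u] may differ; inside the strip the two agree almost everywhere. *)
Lemma weak_form_truncated (u0 : V -> R) u U phi (T : R) : distr_solution beta b u0 u ->
  measurable_fun setT (fun p : RT * X => U p.1 p.2) ->
  {ae LX, forall p : RT * X, 0 < p.1 < T -> U p.1 p.2 = u p.1 (fromcoord p.2)} ->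
  test_fun phi ->
  (forall t x, ~~ (0 < t < T) -> [/\ pd None phi t x = 0, forall j, pd (Some j) phi t x = 0 &
    forall j, pd (Some j) (pd (Some j) phi) t x = 0]) ->
  integrable1 LX (weak_integrand U phi) /\ \int[LX]_p weak_integrand U phi p = 0.
Proof.
move=> [_ _ weak _] mU Uu tphi phi0; have [intg int0] := weak _ tphi.
pose G (p : RT * X) : R := \sum_(g <- NFPE_integrand beta b u phi) g p.1 (fromcoord p.2).
have gi g : g \in NFPE_integrand beta b u phi ->
    integrable1 LX (fun p : RT * X => g p.1 (fromcoord p.2)).
  by move=> /intg gi; exact: (integrable_lebtx gi).
have GE p : G p = u p.1 (fromcoord p.2) * pd None phi p.1 (fromcoord p.2) +
    beta (u p.1 (fromcoord p.2)) * laplacian phi p.1 (fromcoord p.2) +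
    \sum_j b (fromcoord p.2) (u p.1 (fromcoord p.2)) 0 j * u p.1 (fromcoord p.2) *
      pd (Some j) phi p.1 (fromcoord p.2).
  by rewrite /G /NFPE_integrand !big_cons big_nil addr0 addrA.
have Gi : integrable1 LX G.
  rewrite (_ : G = fun p => u p.1 (fromcoord p.2) * pd None phi p.1 (fromcoord p.2) +
    beta (u p.1 (fromcoord p.2)) * laplacian phi p.1 (fromcoord p.2) +
    \sum_j b (fromcoord p.2) (u p.1 (fromcoord p.2)) 0 j * u p.1 (fromcoord p.2) *
      pd (Some j) phi p.1 (fromcoord p.2)); last by apply/funext => p; exact: GE.
  apply: integrable1D; first apply: integrable1D.
  - apply: (gi (fun t x => u t x * pd None phi t x)); by rewrite !inE eqxx.
  - apply: (gi (fun t x => beta (u t x) * laplacian phi t x)); by rewrite !inE eqxx orbT.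
  - apply: (gi (fun t x => \sum_(i < d) b x (u t x) 0 i * u t x * pd (Some i) phi t x)).
    by rewrite !inE eqxx !orbT.
have mG := integrable1_meas Gi.
have [sphi _] := tphi.
have mI := measurable_weak_integrand mU sphi.
have IG : {ae LX, forall p, weak_integrand U phi p = G p}.
  apply: aeS Uu => p Up; rewrite GE /weak_integrand /flux.
  have [tT|/phi0 H] := boolP (0 < p.1 < T); first by rewrite Up.
  have [h0 h1 h2] := H (fromcoord p.2).
  have l0 : laplacian phi p.1 (fromcoord p.2) = 0 by rewrite /laplacian big1.
  rewrite h0 l0 !mulr0 !big1 // => j _; by rewrite h1 mulr0.
split.
  apply/integrableP; split; first exact/measurable_EFinP.
  have /integrableP[_] := Gi; congr (_ < _)%E; apply: ae_eq_integral => //.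
  - by apply: measurableT_comp => //; exact/measurable_EFinP.
  - by apply: measurableT_comp => //; exact/measurable_EFinP.
  - by apply: aeS IG => p /= -> _.
rewrite (Rint_ae mI mG IG) /Rintegral.
by have := int0; rewrite /intRRd integral_lebtx => ->.
Qed.
End truncated_weak_form.

(** * The equation in Fourier variables *)

Section wave_identity.
Context (R : realType) (d : nat).
Notation X := (mT (lebn R d)).
Notation RT := (measurableTypeR R).
Notation leb := (@lebesgue_measure R).
Notation mu := (Leb R d).
Notation LX := (leb \x mu)%E.
Notation V := 'rV[R]_d.

Lemma integrable1_strip (T C : R) (f : R -> X -> R) : 0 <= T ->
  measurable_fun setT (fun p : RT * X => f p.1 p.2) ->
  (forall t, integrable1 mu (f t)) -> (forall t, \int[mu]_x `|f t x| <= C) ->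
  integrable1 LX (fun p : RT * X => ind T p.1 * f p.1 p.2).
Proof.
move=> T0 mf fi fC.
have mI : measurable_fun setT (fun p : RT * X => ind T p.1 * f p.1 p.2).
  by apply: measurable_funM => //; exact: (measurableT_comp (measurable_ind T)).
apply/(integrable12ltyP _ _ ((measurable_EFinP _ _).2 mI)) => /=.
apply: (@le_lt_trans _ _ (\int[leb]_t (C%:E * (ind T t)%:E))%E).
  apply: ge0_le_integral => //.
  - by move=> t _; exact: integral_ge0.
  - apply: (measurable_fun_fubini_tonelli_F (fun p => (`|(ind T p.1 * f p.1 p.2)%:E|)%E)) => //.
    by apply: measurableT_comp => //; exact/measurable_EFinP.
  - apply: measurable_funeM; apply/measurable_EFinP; exact: measurable_ind.
  - move=> t _; under eq_integral do rewrite normrM norm_ind EFinM.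
    rewrite ge0_integralZl_EFin ?ind_ge0 //; last first.
      apply/measurable_EFinP; apply: measurableT_comp => //; exact: integrable1_meas (fi t).
    rewrite muleC (integrable1_EFin (integrable1_norm (fi t))).
    by apply: lee_wpmul2r; rewrite lee_fin ?ind_ge0.
have Ci := integrable1Z C (integrable1_ind T).
by have := integrable1_EFin Ci; under eq_integral do rewrite EFinM; move=> ->; rewrite ltry.
Qed.

Variables (beta : R -> R) (b : V -> R -> V) (U1 U2 : R -> X -> R) (T C L : R).
Hypothesis cbeta : continuous beta.
Hypothesis cb : forall j, continuous (fun p : V * R => b p.1 p.2 0 j).
Hypotheses (mU1 : measurable_fun setT (fun p : RT * X => U1 p.1 p.2))
  (mU2 : measurable_fun setT (fun p : RT * X => U2 p.1 p.2)).
Definition gap t x : R := U1 t x - U2 t x.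
Definition beta_gap t x : R := beta (U1 t x) - beta (U2 t x).
Definition flux_gap j t x : R := flux b j U1 t x - flux b j U2 t x.
Hypotheses (T0 : 0 <= T) (L0 : 0 <= L).
Hypotheses (gapi : forall t, integrable1 mu (gap t)) (gapC : forall t, \int[mu]_x `|gap t x| <= C).
Hypotheses (betaL : forall t x, `|beta_gap t x| <= L * `|gap t x|)
  (fluxL : forall j t x, `|flux_gap j t x| <= L * `|gap t x|).
Hypothesis weak : forall phi : R -> V -> R, test_fun phi ->
  (forall t x, ~~ (0 < t < T) -> [/\ pd None phi t x = 0, forall j, pd (Some j) phi t x = 0 &
    forall j, pd (Some j) (pd (Some j) phi) t x = 0]) ->
  (integrable1 LX (weak_integrand beta b U1 phi) /\ \int[LX]_p weak_integrand beta b U1 phi p = 0) /\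
  (integrable1 LX (weak_integrand beta b U2 phi) /\ \int[LX]_p weak_integrand beta b U2 phi p = 0).

Lemma measurable_gap : measurable_fun setT (fun p : RT * X => gap p.1 p.2).
Proof. exact: measurable_funB. Qed.

Lemma measurable_beta_gap : measurable_fun setT (fun p : RT * X => beta_gap p.1 p.2).
Proof. exact: (measurable_funB (measurable_beta cbeta mU1) (measurable_beta cbeta mU2)). Qed.

Lemma measurable_flux_gap j : measurable_fun setT (fun p : RT * X => flux_gap j p.1 p.2).
Proof. exact: (measurable_funB (measurable_flux cb j mU1) (measurable_flux cb j mU2)). Qed.

Let dom (f : R -> X -> R) t : measurable_fun setT (fun p : RT * X => f p.1 p.2) ->
  (forall t x, `|f t x| <= L * `|gap t x|) -> integrable1 mu (f t).
Proof.
move=> mf fL; apply: (@integrable1_dom _ _ _ _ _ (fun x => L * `|gap t x|)) => //.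
  exact: (measurable_prod1 (t : RT) mf).
by apply: integrable1Z; exact: integrable1_norm.
Qed.

Lemma integrable1_beta_gap t : integrable1 mu (beta_gap t).
Proof. exact: (dom t measurable_beta_gap betaL). Qed.

Lemma integrable1_flux_gap j t : integrable1 mu (flux_gap j t).
Proof. exact: (dom t (measurable_flux_gap j) (fluxL j)). Qed.

Variables (xi : V) (a : R).
Notation ph x := (phase xi a (fromcoord (x : X))).
(** The phase [a] makes one computation serve both transforms: [a = 0] gives the cosine transform
    and [a = - pi / 2] the sine transform. *)
Definition gap_hat t : R := \int[mu]_x (gap t x * cos (ph x)).
Definition rhs_hat t : R :=
  - (\sum_j xi 0 j ^+ 2) * \int[mu]_x (beta_gap t x * cos (ph x))
  - \sum_j xi 0 j * \int[mu]_x (flux_gap j t x * sin (ph x)).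

Lemma measurable_phase : measurable_fun setT (fun x : X => ph x).
Proof.
apply: measurable_funD => //; apply: measurable_sum => j; apply: measurable_funM => //.
exact: measurable_co.
Qed.

Lemma integrable1_mul_cos (f : X -> R) : integrable1 mu f -> integrable1 mu (fun x => f x * cos (ph x)).
Proof.
apply: (@integrable1_bndMr _ _ _ _ 1) => [|x]; last exact: norm_cos_le1.
by apply: measurable_cosf; exact: measurable_phase.
Qed.

Lemma integrable1_mul_sin (f : X -> R) : integrable1 mu f -> integrable1 mu (fun x => f x * sin (ph x)).
Proof.
apply: (@integrable1_bndMr _ _ _ _ 1) => [|x]; last exact: norm_sin_le1.
by apply: measurable_sinf; exact: measurable_phase.
Qed.

Lemma norm_Rint_mul (f g : X -> R) : integrable1 mu f -> measurable_fun setT g ->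
  (forall x, `|g x| <= 1) -> `|\int[mu]_x (f x * g x)| <= \int[mu]_x `|f x|.
Proof.
move=> fi mg g1; apply: Rint_norm_le; first exact: integrable1_norm.
  by apply: measurable_funM => //; exact: integrable1_meas fi.
by move=> x; rewrite normrM ler_piMr.
Qed.

Let mcos : measurable_fun setT (fun x : X => cos (ph x)).
Proof. by apply: measurable_cosf; exact: measurable_phase. Qed.
Let msin : measurable_fun setT (fun x : X => sin (ph x)).
Proof. by apply: measurable_sinf; exact: measurable_phase. Qed.

Let mhat (f : R -> X -> R) (g : X -> R) : measurable_fun setT (fun p : RT * X => f p.1 p.2) ->
  measurable_fun setT g -> measurable_fun setT (fun t : RT => \int[mu]_x (f t x * g x)).
Proof.
move=> mf mg; apply: (@measurable_Rint2 _ _ RT X R mu (fun p => f p.1 p.2 * g p.2)).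
by apply: measurable_funM => //; exact: measurableT_comp.
Qed.

Lemma measurable_gap_hat : measurable_fun setT (gap_hat : RT -> R).
Proof. exact: (mhat measurable_gap mcos). Qed.

Lemma measurable_rhs_hat : measurable_fun setT (rhs_hat : RT -> R).
Proof.
apply: measurable_funB.
  by apply: measurable_funM => //; exact: (mhat measurable_beta_gap mcos).
apply: measurable_sum => j; apply: measurable_funM => //.
exact: (mhat (measurable_flux_gap j) msin).
Qed.

Lemma norm_gap_hat t : `|gap_hat t| <= C.
Proof.
apply: le_trans (gapC t); apply: norm_Rint_mul => // x; exact: norm_cos_le1.
Qed.

Let LC (f : X -> R) t : integrable1 mu f -> (forall x, `|f x| <= L * `|gap t x|) ->
  \int[mu]_x `|f x| <= L * C.
Proof.
move=> fi fL; have gn := integrable1_norm (gapi t).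
apply: (@le_trans _ _ (\int[mu]_x (L * `|gap t x|))).
  by apply: Rint_le => //; [exact: integrable1_norm|exact: integrable1Z].
by rewrite RintegralZl ?ler_wpM2l.
Qed.

Lemma norm_rhs_hat t : `|rhs_hat t| <= (\sum_j xi 0 j ^+ 2) * (L * C) + \sum_j `|xi 0 j| * (L * C).
Proof.
have S0 : 0 <= \sum_j xi 0 j ^+ 2 by apply: sumr_ge0 => j _; exact: sqr_ge0.
apply: (le_trans (ler_normB _ _)); apply: lerD.
  rewrite normrM normrN (ger0_norm S0) ler_wpM2l //.
  apply: le_trans (LC (integrable1_beta_gap t) (betaL t)).
  by apply: norm_Rint_mul => [||x]; [exact: integrable1_beta_gap|exact: mcos|exact: norm_cos_le1].
apply: (le_trans (ler_norm_sum _ _ _)); apply: ler_sum => j _; rewrite normrM ler_wpM2l //.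
apply: le_trans (LC (integrable1_flux_gap j t) (fluxL j t)).
by apply: norm_Rint_mul => [||x]; [exact: integrable1_flux_gap|exact: msin|exact: norm_sin_le1].
Qed.

(** The weak forms of the two truncations are subtracted, with the localized wave as test function.
    The limit [N] to infinity is taken by dominated convergence, with a multiple of |gap| on the
    strip as majorant, and Fubini leaves an identity in time alone. *)
Lemma wave_identity (th th' : R -> R) (al be : R) : smooth th ->
  (forall t, is_derive t (1:R) th (th' t)) -> 0 < al -> be < T ->
  (forall t, ~~ (al <= t <= be) -> th t = 0) ->
  \int[leb]_t (th' t * gap_hat t + th t * rhs_hat t) = 0.
Proof.
move=> sth dth al0 beT th0.
have th'0 t : ~~ (al <= t <= be) -> th' t = 0.
  rewrite negb_and -!ltNge => /orP[h|h]; apply: (deriv_near_cst dth (c := 0)).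
    near=> y; apply: th0; rewrite negb_and -ltNge; apply/orP; left.
    by near: y; exact: lt_nbhsl.
  near=> y; apply: th0; rewrite negb_and -!ltNge; apply/orP; right.
  by near: y; exact: lt_nbhsr.
have out t : be < `|t| -> ~~ (al <= t <= be).
  by move=> h; apply/negP => /andP[h1 h2]; move: h; rewrite ger0_norm ?ltNge ?h2 // (le_trans (ltW al0)).
have cth' : continuous th'.
  have [f [sf df]] := smooth_derivE sth.
  suff -> : th' = f by exact: smooth_continuous.
  by apply/funext => t; have [_ <-] := dth t; have [_ <-] := df t.
have [k1 [k10 hk1]] := compact_support_bounded (smooth_continuous sth) (fun t h => th0 t (out t h)).
have [k2 [k20 hk2]] := compact_support_bounded cth' (fun t h => th'0 t (out t h)).
pose c0 := k1 + k2.
have thc t : `|th t| <= c0 by apply: (le_trans (hk1 t)); rewrite lerDl.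
have thc' t : `|th' t| <= c0 by apply: (le_trans (hk2 t)); rewrite lerDr.
have [c1 [c2 [c10 c20 B lim]]] := wave_derivs dth thc thc' xi a.
have c00 : 0 <= c0 by exact: addr_ge0.
pose phi N := wave th N xi a.
have Tal t : ~~ (0 < t < T) -> ~~ (al <= t <= be).
  by apply: contra => /andP[h1 h2]; rewrite (lt_le_trans al0 h1) (le_lt_trans h2 beT).
have tphi N : test_fun (phi N) by exact: (wave_test N xi a sth al0 th0).
have vphi N t x : ~~ (al <= t <= be) -> [/\ pd None (phi N) t x = 0,
    forall j, pd (Some j) (phi N) t x = 0 & forall j, pd (Some j) (pd (Some j) (phi N)) t x = 0].
  by move=> tab; have [_ h] := B N t x; apply: h; [exact: th0|exact: th'0].
pose D N (p : RT * X) : R := gap p.1 p.2 * pd None (phi N) p.1 (fromcoord p.2) +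
  beta_gap p.1 p.2 * laplacian (phi N) p.1 (fromcoord p.2) +
  \sum_j flux_gap j p.1 p.2 * pd (Some j) (phi N) p.1 (fromcoord p.2).
have DE N p : D N p = weak_integrand beta b U1 (phi N) p - weak_integrand beta b U2 (phi N) p.
  rewrite /D /weak_integrand /gap /beta_gap /flux_gap.
  under eq_bigr do rewrite mulrBl.
  by rewrite sumrB; ring.
have Dm N : measurable_fun setT (D N).
  have [sphi _] := tphi N; rewrite (_ : D N = fun p => weak_integrand beta b U1 (phi N) p -
    weak_integrand beta b U2 (phi N) p); last by apply/funext => p; exact: DE.
  exact: (measurable_funB (measurable_weak_integrand cbeta cb mU1 sphi) (measurable_weak_integrand cbeta cb mU2 sphi)).
have D0 N : \int[LX]_p D N p = 0.
  have [[i1 e1] [i2 e2]] := weak (tphi N) (fun t x h => vphi N t x (Tal t h)).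
  under eq_Rintegral do rewrite DE.
  by rewrite RintegralB // e1 e2 subr0.
pose S2 := \sum_j xi 0 j ^+ 2.
pose Dl (p : RT * X) : R := th' p.1 * (gap p.1 p.2 * cos (ph p.2)) +
  - (th p.1 * S2) * (beta_gap p.1 p.2 * cos (ph p.2)) +
  \sum_j - (th p.1 * xi 0 j) * (flux_gap j p.1 p.2 * sin (ph p.2)).
have Dcvg p : D N p @[N --> \oo] --> Dl p.
  apply: cvg_near_cst; apply: filterS (lim p.1 (fromcoord p.2)) => N [h0 h1 h2].
  rewrite /D /Dl /laplacian h0; congr (_ + _ + _).
  - by ring.
  - rewrite /S2 mulr_sumr -sumrN !mulr_suml mulr_sumr; apply: eq_bigr => j _; rewrite h2; ring.
  - by apply: eq_bigr => j _; rewrite h1; ring.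
have mDl : measurable_fun setT Dl by apply: (@measurable_fun_cvg _ _ _ _ D).
(* The three summands bound the factors of the time derivative, of the Laplacian and of the gradient
   given by [wave_derivs]; [L] compares [beta_gap] and [flux_gap] to [gap]. *)
pose c := c0 + L * \sum_j (c0 * (c2 + `|xi 0 j| ^+ 2 + 2 * (`|xi 0 j| * c1))) +
  L * \sum_j (c0 * (c1 + `|xi 0 j|)).
have gi : integrable1 LX (fun p : RT * X => c * (ind T p.1 * `|gap p.1 p.2|)).
  apply: integrable1Z; apply: (@integrable1_strip T C (fun t x => `|gap t x|)) => //.
  - by apply: measurableT_comp => //; exact: measurable_gap.
  - by move=> t; exact: integrable1_norm.
  - by move=> t; under eq_Rintegral do rewrite normr_id.
have Db N p : `|D N p| <= c * (ind T p.1 * `|gap p.1 p.2|).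
  have [tab|tab] := boolP (al <= p.1 <= be); last first.
    have [h0 h1 h2] := vphi N p.1 (fromcoord p.2) tab.
    have l0 : laplacian (phi N) p.1 (fromcoord p.2) = 0 by rewrite /laplacian big1.
    rewrite /D h0 l0 !mulr0 big1 ?addr0 ?normr0; last by move=> j _; rewrite h1 mulr0.
    rewrite !mulr_ge0 ?ind_ge0 // /c !addr_ge0 ?mulr_ge0 ?sumr_ge0 // => j _.
      by rewrite mulr_ge0 // !addr_ge0 ?mulr_ge0 // exprn_ge0.
    by rewrite mulr_ge0 // addr_ge0.
  have -> : ind T p.1 = 1.
    rewrite indE; move: tab => /andP[h1 h2].
    by rewrite (le_trans (ltW al0) h1) (le_trans h2 (ltW beT)).
  have [[b0 b1 b2] _] := B N p.1 (fromcoord p.2).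
  rewrite mul1r /c mulrDl [X in _ <= X + _]mulrDl; apply: (le_trans (ler_normD _ _)); apply: lerD.
    apply: (le_trans (ler_normD _ _)); apply: lerD.
      by rewrite normrM mulrC ler_wpM2r.
    rewrite normrM mulrAC ler_pM //.
    by apply: (le_trans (ler_norm_sum _ _ _)); exact: ler_sum.
  apply: (le_trans (ler_norm_sum _ _ _)); rewrite mulrAC mulr_sumr; apply: ler_sum => j _.
  by rewrite normrM ler_pM.
have Dl0 : \int[LX]_p Dl p = 0.
  have cv := Rint_dct Dm mDl (aeW _ Dcvg) gi Db.
  rewrite (_ : (fun N => _) = (fun=> 0)) in cv; last by apply/funext => N; exact: D0.
  exact: (cvg_unique (@Rhausdorff R) cv (cvg_cst _)).
have Dli : integrable1 LX Dl.
  apply: (integrable1_dom mDl _ gi) => p; apply: (cvgr_to_le (cvg_norm (Dcvg p))).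
  by apply: nearW => N.
rewrite -[RHS]Dl0 (Rint_fubini1 Dli); apply: eq_Rintegral => t _; rewrite /Dl /=.
have i1 := integrable1Z (th' t) (integrable1_mul_cos (gapi t)).
have i2 := integrable1Z (- (th t * S2)) (integrable1_mul_cos (integrable1_beta_gap t)).
have i3 j := integrable1Z (- (th t * xi 0 j)) (integrable1_mul_sin (integrable1_flux_gap j t)).
rewrite RintegralD //; last 2 first.
- exact: integrable1D.
- exact: integrable1_sum.
rewrite RintegralD // Rint_sum //.
rewrite !RintegralZl //; last 2 first.
- exact: integrable1_mul_cos (integrable1_beta_gap t).
- exact: integrable1_mul_cos (gapi t).
under [X in _ = _ + _ + X]eq_bigr do (rewrite RintegralZl //; last exact: integrable1_mul_sin (integrable1_flux_gap _ t)).
rewrite /gap_hat /rhs_hat -/S2 mulrDr addrA; congr (_ + _ + _); first by ring.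
rewrite mulrN mulr_sumr -sumrN; apply: eq_bigr => j _; rewrite mulrA mulNr.
Unshelve. all: by end_near.
Qed.
End wave_identity.

(** * Approximate point masses in time *)

Section duhamel.
Context (R : realType).
Notation leb := (@lebesgue_measure R).
Notation RT := (measurableTypeR R).

Lemma ramp_derivative : exists (k : R -> R) (c : R), [/\ forall x, is_derive x (1:R) (@step R) (k x),
  continuous k, forall x, `|k x| <= c & forall x, ~~ (0 <= x <= 1) -> k x = 0].
Proof.
have [k [sk dk]] := smooth_derivE (@smooth_step R).
have k0 x : ~~ (0 <= x <= 1) -> k x = 0.
  rewrite negb_and -!ltNge => /orP[h|h].
    apply: (deriv_near_cst dk (c := 0)); near=> y; apply/step_le0/ltW.
    by near: y; exact: lt_nbhsl.
  apply: (deriv_near_cst dk (c := 1)); near=> y; apply/step_ge1/ltW.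
  by near: y; exact: lt_nbhsr.
have [|c [_ hc]] := compact_support_bounded (a := 1) (smooth_continuous sk).
  move=> x x1; apply: k0; apply/negP => /andP[h1 h2].
  by move: x1; rewrite ger0_norm // ltNge h2.
by exists k, c; split => //; exact: smooth_continuous.
Unshelve. all: by end_near.
Qed.

Lemma Rint_derivative (F f : R -> R) (a b : R) : (forall x, is_derive x (1:R) F (f x)) ->
  continuous f -> a <= b -> (forall x, ~~ (a <= x <= b) -> f x = 0) ->
  \int[leb]_x f x = F b - F a.
Proof.
move=> dF cf ab f0; have E := integral_FTC dF cf ab; rewrite integral_mkcond in E.
rewrite /Rintegral -[RHS]/(fine (F b - F a)%:E) -E; congr fine; apply: eq_integral => x _.
rewrite /patch mem_setE in_itv /=; case: ifPn => // /f0 ->.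
by [].
Qed.

Variables (k : R -> R) (c : R).
Hypotheses (dk : forall x, is_derive x (1:R) (@step R) (k x)) (ck : continuous k)
  (kc : forall x, `|k x| <= c) (k0 : forall x, ~~ (0 <= x <= 1) -> k x = 0).

(** Derivative of a smooth ramp that rises from 0 to 1 on [s0, s0 + 1/(N+1)]: an approximate point
    mass at [s0] from the right, of total integral one. *)
Definition bump N s0 (s : R) : R := N.+1%:R * k (N.+1%:R * s + - (N.+1%:R * s0)).
Definition box N s0 : R -> R := \1_(`[s0, s0 + N.+1%:R^-1] : set R).

Lemma box_ge0 N s0 s : 0 <= box N s0 s.
Proof. by rewrite /box indicE ler0n. Qed.

Let N0 N : 0 < N.+1%:R :> R. Proof. by rewrite ltr0n. Qed.

Lemma is_derive_ramp N s0 s : is_derive s (1:R)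
  (fun s => step (N.+1%:R * s + - (N.+1%:R * s0))) (bump N s0 s).
Proof.
have dl : is_derive s (1:R) (fun s => N.+1%:R * s + - (N.+1%:R * s0)) N.+1%:R.
  by apply: is_derive_eq; rewrite /GRing.scale /=; ring.
have h := is_derive1_comp (f := @step R) (g := fun s => N.+1%:R * s + - (N.+1%:R * s0)) (dk _) dl.
by apply: (is_derive_eq h); rewrite /bump mulrC.
Qed.

Lemma bump_out N s0 s : ~~ (s0 <= s <= s0 + N.+1%:R^-1) -> bump N s0 s = 0.
Proof.
move=> h; rewrite /bump k0 ?mulr0 //; apply: contra h => /andP[h1 h2].
rewrite -lerBlDl -[_^-1]mul1r ler_pdivlMr // mulrBl ![_ * N.+1%:R]mulrC h2 andbT.
by rewrite -subr_ge0 -(pmulr_rge0 _ (N0 N)) mulrBr.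
Qed.

Lemma norm_bump_le N s0 s : `|bump N s0 s| <= c * N.+1%:R * box N s0 s.
Proof.
rewrite /box indicE mem_setE in_itv /=; case: (boolP (s0 <= s <= s0 + N.+1%:R^-1)) => h.
  by rewrite mulr1 normrM ger0_norm ?ler0n // mulrC ler_wpM2r // ler0n.
by rewrite bump_out // normr0 mulr0.
Qed.

Lemma continuous_bump N s0 : continuous (bump N s0).
Proof.
have ca : continuous (fun s : R => N.+1%:R * s + - (N.+1%:R * s0)).
  by move=> r; apply: cvgD; [apply: cvgM; [exact: cvg_cst|exact: cvg_id]|exact: cvg_cst].
have ck' : continuous (fun s : R => k (N.+1%:R * s + - (N.+1%:R * s0))).
  move=> s; apply: (@continuous_comp R R R (fun s : R => N.+1%:R * s + - (N.+1%:R * s0)) k).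
    exact: ca.
  exact: ck.
by move=> s; exact: (cvgM (cvg_cst _) (ck' s)).
Qed.

Lemma integrable1_bump N s0 : integrable1 leb (bump N s0).
Proof.
apply: (@integrable1_dom _ RT R leb (bump N s0) (fun s => c * N.+1%:R * box N s0 s)).
- exact: continuous_measurable_fun (@continuous_bump N s0).
- by move=> s; exact: norm_bump_le.
- by apply: integrable1Z; exact: integrable_indic_itv s0 _ true false.
Qed.

Lemma Rint_bump N s0 : \int[leb]_s bump N s0 s = 1.
Proof.
have s01 : s0 <= s0 + N.+1%:R^-1 by rewrite lerDl invr_ge0 ler0n.
rewrite (Rint_derivative (is_derive_ramp N s0) (@continuous_bump N s0) s01 (@bump_out N s0)).
rewrite mulrDr divff ?gt_eqF // step_ge1; last by lra.
by rewrite step_le0 ?subr0 // subrr.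
Qed.

Lemma Rint_box N s0 : \int[leb]_s box N s0 s = N.+1%:R^-1.
Proof.
rewrite /Rintegral integral_indic // setIT.
have /= -> := lebesgue_measure_itv `[s0, s0 + N.+1%:R^-1]; rewrite lte_fin.
by rewrite ltrDl invr_gt0 ltr0n /= addrAC subrr add0r.
Qed.

(** The bumps live to the right of [s0], so closeness of [g] to [l] is required only on that side,
    and only almost everywhere. *)
Lemma bump_cvg (g : R -> R) (s0 l cg : R) : measurable_fun setT (g : RT -> R) ->
  (forall s, `|g s| <= cg) ->
  (forall e, 0 < e -> exists2 de, 0 < de &
     {ae leb, forall s, s0 <= s <= s0 + de -> `|g s - l| <= e}) ->
  \int[leb]_s (bump N s0 s * g s) @[N --> \oo] --> l.
Proof.
move=> mg gb H; have c0 : 0 <= c by exact: le_trans (kc 0).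
apply/cvgrPdist_le => e e0.
(* The bump is at most c (N+1) on an interval of length 1/(N+1), so the error is at most c e / (c +
   1) <= e. The 1 avoids a division by zero. *)
have [de de0 ae_l] := H (e / (c + 1)) (divr_gt0 e0 (ltr_wpDl c0 ltr01)).
have near_de : \forall N \near \oo, N.+1%:R^-1 <= de.
  have h : (fun N : nat => N.+1%:R^-1) @ \oo --> (0:R) by exact: cvg_harmonic.
  near=> N; have : `|N.+1%:R^-1| <= de by near: N; move/cvgr0Pnorm_le : h; apply.
  by rewrite ger0_norm ?invr_ge0.
near=> N; have Nde : N.+1%:R^-1 <= de by near: N.
have bi := integrable1_bump N s0.
have bgi : integrable1 leb (fun s => bump N s0 s * g s).
  exact: (integrable1_bndMr mg gb bi).
have bli := integrable1Z l bi.
have E : \int[leb]_s (bump N s0 s * g s) - l = \int[leb]_s (bump N s0 s * (g s - l)).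
  transitivity (\int[leb]_s (bump N s0 s * g s - l * bump N s0 s)).
    by rewrite RintegralB // RintegralZl // Rint_bump mulr1.
  by apply: eq_Rintegral => s _; ring.
have bi2 : integrable1 leb (fun s => bump N s0 s * (g s - l)).
  rewrite (_ : (fun s => _) = fun s => bump N s0 s * g s - l * bump N s0 s).
    exact: integrable1B.
  by apply/funext => s; ring.
rewrite distrC E; apply: (le_trans (le_normr_Rintegral measurableT bi2)).
have boxi : integrable1 leb (box N s0) by exact: integrable_indic_itv s0 _ true false.
have boxi2 := integrable1Z (c * N.+1%:R * (e / (c + 1))) boxi.
apply: (@le_trans _ _ (\int[leb]_s (c * N.+1%:R * (e / (c + 1)) * box N s0 s))).
  apply: Rint_le_ae => //; first exact: integrable1_norm.
  apply: aeS ae_l => s Hs; rewrite normrM.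
  have [h|h] := boolP (s0 <= s <= s0 + N.+1%:R^-1); last first.
    rewrite bump_out // normr0 mul0r mulr_ge0 ?box_ge0 //.
    by rewrite mulr_ge0 ?divr_ge0 ?addr_ge0 ?(ltW e0) // mulr_ge0.
  rewrite mulrAC ler_pM //; first exact: norm_bump_le.
  apply: Hs; case/andP: h => -> h /=; apply: (le_trans h); by rewrite lerD2l.
rewrite RintegralZl // Rint_box mulrAC mulfK ?gt_eqF //.
rewrite mulrCA ler_piMr ?(ltW e0) // ler_pdivrMr ?mul1r ?lerDl //.
exact: ltr_wpDl.
Unshelve. all: by end_near.
Qed.
End duhamel.

(** * From a weak derivative to a primitive *)

Section primitive.
Context (R : realType).
Notation leb := (@lebesgue_measure R).
Notation RT := (measurableTypeR R).

(** Smooth approximations of the indicator of [s1, s2] give zeta(s1) - zeta(s2) + int_s1^s2 G = 0,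
    so [zeta] minus the primitive of [G] is constant on (0, T). Both are continuous up to the
    endpoints, and at 0 both vanish. The data [Z] need agree with the continuous [zeta] only almost
    everywhere. *)
Lemma weak_derivative_primitive (Z G zeta : R -> R) (T cz cg : R) : 0 < T ->
  measurable_fun setT (Z : RT -> R) -> measurable_fun setT (G : RT -> R) ->
  (forall s, `|Z s| <= cz) -> (forall s, `|G s| <= cg) ->
  {ae leb, forall s, 0 < s < T -> Z s = zeta s} ->
  (forall s0 e, 0 <= s0 -> 0 < e -> exists2 de, 0 < de &
     forall s, 0 <= s -> `|s - s0| <= de -> `|zeta s - zeta s0| <= e) ->
  zeta 0 = 0 ->
  (forall (th th' : R -> R) (al be : R), smooth th ->
    (forall t, is_derive t (1:R) th (th' t)) -> 0 < al -> be < T ->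
    (forall t, ~~ (al <= t <= be) -> th t = 0) ->
    \int[leb]_t (th' t * Z t + th t * G t) = 0) ->
  forall t, 0 <= t <= T -> zeta t = \int[leb]_s (ind t s * G s).
Proof.
move=> T0 mZ mG Zb Gb Zz cze z0 weak.
have cg0 : 0 <= cg by exact: le_trans (Gb 0).
pose prim t := \int[leb]_s (ind t s * G s).
have primi t : integrable1 leb (fun s => ind t s * G s) by exact: integrable1_ind_bnd mG Gb.
have [k [c [dk ck kc k0]]] := ramp_derivative R.
have mid s1 s2 : 0 < s1 -> s1 < s2 -> s2 < T -> zeta s1 - prim s1 = zeta s2 - prim s2.
  move=> s10 s12 s2T.
  (* A ramp up at [s1] minus a ramp up at [s2]; its derivative is the difference of two bumps. *)
  pose th N (s : R) : R := step (N.+1%:R * s + - (N.+1%:R * s1)) +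
    (-1) * step (N.+1%:R * s + - (N.+1%:R * s2)).
  pose th' N (s : R) : R := bump k N s1 s - bump k N s2 s.
  have sth N : smooth (th N).
    apply: smoothD; first exact: (smooth_aff _ _ (@smooth_step R)).
    apply: smoothM; first exact: smooth_cst.
    exact: (smooth_aff _ _ (@smooth_step R)).
  have dth N s : is_derive s (1:R) (th N) (th' N s).
    have h1 := is_derive_ramp dk N s1 s; have h2 := is_derive_ramp dk N s2 s.
    rewrite /th /th'; apply: is_derive_eq; rewrite /GRing.scale /=; ring.
  have N0 N : 0 < N.+1%:R :> R by rewrite ltr0n.
  have pre N s s0 : s <= s0 -> step (N.+1%:R * s + - (N.+1%:R * s0)) = 0.
    by move=> h; apply: step_le0; rewrite -mulrBr pmulr_rle0 // subr_le0.
  have post N s s0 : s0 + N.+1%:R^-1 <= s -> step (N.+1%:R * s + - (N.+1%:R * s0)) = 1.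
    move=> h; apply: step_ge1; rewrite -mulrBr -(@ler_pdivrMl _ (N.+1%:R)) // mulr1.
    by rewrite lerBrDl.
  have thE N s : ~~ (s1 <= s <= s2 + N.+1%:R^-1) -> th N s = 0.
    rewrite negb_and -!ltNge => /orP[h|h]; rewrite /th.
      by rewrite !pre ?mulr0 ?addr0 ?ltW // (lt_trans h).
    rewrite !post ?mulr1 ?subrr ?(ltW h) //.
    by apply: le_trans (ltW h); rewrite lerD2r ltW.
  have th1 N s : `|th N s| <= 1.
    have /andP[a1 a2] := step_01 (N.+1%:R * s + - (N.+1%:R * s1)).
    have /andP[b1 b2] := step_01 (N.+1%:R * s + - (N.+1%:R * s2)).
    by rewrite /th ler_norml; apply/andP; split; lra.
  (* The support ends at s2 + 1/(N+1) <= s2 + 1, which gives a majorant independent of [N]. *)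
  have thb N s : `|th N s * G s| <= cg * ind (s2 + 1) s.
    rewrite normrM indE; have [h|h] := boolP (0 <= s <= s2 + 1).
      by rewrite mulr1 -[leRHS]mul1r ler_pM.
    rewrite thE ?normr0 ?mul0r ?mulr0 //; apply: contra h => /andP[h1 h2].
    by rewrite (le_trans (ltW s10) h1) (le_trans h2) // lerD2l invf_le1 ?ler1n.
  have cN : (fun N : nat => N.+1%:R^-1) @ \oo --> (0:R) by exact: cvg_harmonic.
  have near_lt (e : R) : 0 < e -> \forall N \near \oo, N.+1%:R^-1 < e.
    move=> e0; near=> N; have : `|N.+1%:R^-1| < e by near: N; move/cvgr0Pnorm_lt : cN; apply.
    by rewrite ger0_norm ?invr_ge0.
  have lim s0 : 0 < s0 -> s0 < T -> \int[leb]_s (bump k N s0 s * Z s) @[N --> \oo] --> zeta s0.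
    move=> s00 s0T; apply: (bump_cvg dk ck kc k0 mZ Zb) => e e0.
    have [de de0 H] := cze s0 e (ltW s00) e0.
    (* The second bound keeps [s] below [T], where [Z] coincides with [zeta]. *)
    exists (Num.min de ((T - s0) / 2)).
      by rewrite lt_min de0 divr_gt0 // subr_gt0.
    apply: aeS Zz => s Zs /andP[h1]; rewrite -lerBlDl le_min => /andP[h2 h3].
    have sT : 0 < s < T by apply/andP; split; [exact: lt_le_trans h1|move: h3; lra].
    rewrite Zs //; apply: H; first by have /andP[/ltW] := sT.
    by rewrite ger0_norm // subr_ge0.
  have mth N : measurable_fun setT (th N : RT -> R).
    by apply: continuous_measurable_fun; exact: smooth_continuous.
  have limG : \int[leb]_s (th N s * G s) @[N --> \oo] --> prim s2 - prim s1.
    have -> : prim s2 - prim s1 = \int[leb]_s ((ind s2 s - ind s1 s) * G s).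
      by rewrite -RintegralB //; apply: eq_Rintegral => s _; rewrite mulrBl.
    have gi : integrable1 leb (fun s => cg * ind (s2 + 1) s).
      by apply: integrable1Z; exact: integrable1_ind.
    apply: (@Rint_dct _ RT R leb (fun N s => th N s * G s) (fun s => (ind s2 s - ind s1 s) * G s)
      (fun s => cg * ind (s2 + 1) s)) => //.
    - by move=> N; exact: measurable_funM.
    - apply: measurable_funM => //; apply: measurable_funB; exact: measurable_ind.
    - apply: aeW => s; apply: cvgM; last exact: cvg_cst.
      apply: cvg_near_cst; rewrite !indE.
      have [h1|h1] := leP s s1.
        apply: nearW => N; rewrite /th !pre ?(le_trans h1 (ltW s12)) // mulr0 addr0.
        by case: (0 <= s); rewrite ?subrr.
      have s0 : 0 <= s by rewrite ltW // (lt_trans s10).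
      rewrite s0 /= subr0; have [h2|h2] := leP s s2.
        have := near_lt (s - s1); rewrite subr_gt0 => /(_ h1); apply: filterS => N hN.
        by rewrite /th post ?pre ?mulr0 ?addr0 // -lerBrDl ltW.
      have := near_lt (s - s2); rewrite subr_gt0 => /(_ h2); apply: filterS => N hN.
      rewrite /th !post ?mulr1 ?subrr // -lerBrDl ltW //.
      by apply: (lt_le_trans hN); rewrite lerD2l lerN2 ltW.
  have E : \forall N \near \oo, \int[leb]_s (bump k N s1 s * Z s) - \int[leb]_s (bump k N s2 s * Z s)
      + \int[leb]_s (th N s * G s) = 0.
    near=> N.
    have beT : s2 + N.+1%:R^-1 < T.
      by rewrite -ltrBrDl; near: N; apply: near_lt; rewrite subr_gt0.
    have := weak (th N) (th' N) s1 (s2 + N.+1%:R^-1) (sth N) (dth N) s10 beT (thE N).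
    have i1 s0 : integrable1 leb (fun s => bump k N s0 s * Z s).
      by apply: (integrable1_bndMr mZ Zb); exact: (integrable1_bump ck kc k0).
    have i2 : integrable1 leb (fun s => th N s * G s).
      apply: (@integrable1_dom _ RT R leb _ (fun s => cg * ind (s2 + 1) s)).
      - exact: measurable_funM.
      - exact: thb.
      - by apply: integrable1Z; exact: integrable1_ind.
    rewrite -[RHS]/0 => e; rewrite -[RHS]e -RintegralB // -RintegralD //; last exact: integrable1B.
    by apply: eq_Rintegral => s _; rewrite /th' mulrBl.
  pose I N := \int[leb]_s (bump k N s1 s * Z s) - \int[leb]_s (bump k N s2 s * Z s)
      + \int[leb]_s (th N s * G s).
  have cv : I @ \oo --> zeta s1 - zeta s2 + (prim s2 - prim s1).
    by apply: cvgD => //; apply: cvgB; apply: lim => //; [exact: lt_trans s12 s2T|exact: lt_trans s12].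
  have cv0 : I @ \oo --> (0:R) by exact: cvg_near_cst.
  have e := cvg_unique (@Rhausdorff R) cv cv0.
  by apply/eqP; rewrite -subr_eq0; apply/eqP; rewrite -[RHS]e; ring.
have prim_lip s t : 0 <= s -> s <= t -> `|prim t - prim s| <= cg * (t - s).
  move=> s0 st; have t0 := le_trans s0 st.
  have -> : prim t - prim s = \int[leb]_r ((ind t r - ind s r) * G r).
    by rewrite -RintegralB //; apply: eq_Rintegral => r _; rewrite mulrBl.
  have ii : integrable1 leb (fun r => ind t r - ind s r).
    by apply: integrable1B; exact: integrable1_ind.
  have -> : cg * (t - s) = \int[leb]_r (cg * (ind t r - ind s r)).
    rewrite RintegralZl // RintegralB //; try exact: integrable1_ind.
    by rewrite !Rint_ind.
  have i01 r : 0 <= ind t r - ind s r.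
    rewrite subr_ge0 !indE; have [/andP[h1 h2]|_] := boolP (0 <= r <= s); last exact: ler0n.
    by rewrite h1 (le_trans h2 st).
  apply: Rint_norm_le; first exact: integrable1Z.
    by apply: measurable_funM => //; apply: measurable_funB; exact: measurable_ind.
  by move=> r; rewrite normrM ger0_norm // mulrC ler_wpM2r.
have prim_lip2 s t : 0 <= s -> 0 <= t -> `|prim t - prim s| <= cg * `|t - s|.
  move=> s0 t0; have [st|/ltW ts] := leP s t.
    by rewrite [`|t - s|]ger0_norm ?subr_ge0 // prim_lip.
  by rewrite distrC [`|t - s|]distrC [`|s - t|]ger0_norm ?subr_ge0 // prim_lip.
pose D t := zeta t - prim t.
have const s t : 0 < s < T -> 0 < t < T -> D s = D t.
  move=> /andP[s0 sT] /andP[t0 tT]; have [st|ts|->] := ltgtP s t => //.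
    exact: mid.
  by apply/esym; exact: mid.
have close s0 e : 0 <= s0 <= T -> 0 < e -> exists2 s, 0 < s < T & `|D s - D s0| <= e + e.
  move=> /andP[s00 s0T] e0; have [de de0 H] := cze s0 e s00 e0.
  (* [h] is small enough for the modulus of [zeta] and for the Lipschitz bound of [prim]. Being at
     most T / 4, it also leaves room to step from [s0] into (0, T), to the right when s0 <= T / 2
     and to the left otherwise. *)
  pose h := Num.min de (Num.min (e / (cg + 1)) (T / 4)).
  have cg1 : 0 < cg + 1 by exact: ltr_wpDl.
  have h0 : 0 < h by rewrite !lt_min de0 !divr_gt0.
  have [hde he hT] : [/\ h <= de, h <= e / (cg + 1) & h <= T / 4].
    by split; rewrite /h !ge_min lexx ?orbT.
  have he2 : cg * h <= e.
    apply: (@le_trans _ _ ((cg + 1) * h)); first by rewrite ler_pM2r // lerDl.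
    by rewrite mulrC -ler_pdivlMr.
  have [s [sT sh]] : exists s, 0 < s < T /\ `|s - s0| = h.
    have [l|l] := leP s0 (T / 2).
      exists (s0 + h); split; first by apply/andP; split; lra.
      by rewrite addrAC subrr add0r gtr0_norm.
    exists (s0 - h); split; first by apply/andP; split; lra.
    by rewrite addrAC subrr add0r normrN gtr0_norm.
  have s1 : 0 <= s by have /andP[/ltW] := sT.
  exists s => //; rewrite /D (_ : _ - _ = (zeta s - zeta s0) - (prim s - prim s0)); last by ring.
  apply: (le_trans (ler_normB _ _)); rewrite lerD //; first by rewrite H // sh.
  by apply: (le_trans (prim_lip2 _ _ s00 s1)); rewrite sh.
have half : 0 < T / 2 < T by apply/andP; split; lra.
have all_eq s0 : 0 <= s0 <= T -> D s0 = D (T / 2).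
  move=> s0T; apply/eqP; rewrite -subr_eq0 -normr_le0; apply/ler_addgt0Pl => e e0.
  have [s sT hs] := close s0 (e / 2) s0T (divr_gt0 e0 (ltr0Sn R 1)).
  rewrite addr0 distrC (const _ _ half sT); apply: (le_trans hs); lra.
have D0 : D 0 = 0.
  rewrite /D z0 /prim sub0r -[RHS]oppr0; congr (- _).
  (* The primitive at 0 is an integral over a single point, bounded by [cg] times its length. *)
  have : `|prim 0| <= cg * 0.
    have -> : cg * 0 = \int[leb]_s (cg * ind 0 s).
      by rewrite RintegralZl ?Rint_ind //; exact: integrable1_ind.
    apply: Rint_norm_le; first by apply: integrable1Z; exact: integrable1_ind.
      by apply: measurable_funM => //; exact: measurable_ind.
    by move=> r; rewrite normrM norm_ind mulrC ler_wpM2r ?ind_ge0.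
  by rewrite mulr0 normr_le0 => /eqP.
move=> t tT; apply/eqP; rewrite -subr_eq0 -/(prim t) -/(D t) (all_eq t tT).
by rewrite -(all_eq 0) ?D0 // lexx ltW.
Unshelve. all: by end_near.
Qed.
End primitive.

(** * Uniqueness *)

Section uniqueness.
Context (R : realType) (d : nat).
Notation X := (mT (lebn R d)).
Notation RT := (measurableTypeR R).
Notation leb := (@lebesgue_measure R).
Notation mu := (Leb R d).
Notation LX := (leb \x mu)%E.
Notation V := 'rV[R]_d.
Notation fc x := (fromcoord (x : X)).

Lemma continuous_cos_phase (xi : V) (a : R) : continuous (fun x : V => cos (phase xi a x)).
Proof.
have c := tf_continuous (tf_space xi a (smooth_cos R)).
have i : continuous (fun x : V => (0 : R, x)).
  move=> x; have c0 : (fun=> 0 : R) @ nbhs x --> (0 : R) by exact: cvg_cst.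
  exact: (cvg_pair c0 (@cvg_id _ (nbhs x))).
by move=> x; exact: (@continuous_comp V (R * V)%type R (fun x => (0, x)) _ x (i x) (c _)).
Qed.

Section one_solution.
Variables (beta : R -> R) (b : V -> R -> V) (u0 : V -> R) (u : R -> V -> R).
Hypothesis sol : distr_solution beta b u0 u.

Lemma solution_integrable t : 0 <= t -> integrable1 mu (fun x => u t (fc x)).
Proof. by move=> t0; have [h _ _ _] := sol; have [] := h t t0. Qed.

(** Narrow continuity tested on a cosine, which is bounded and continuous. The transforms of the
    solutions are thereby continuous in time, and the Duhamel formula extends to every [t]. *)
Lemma solution_modulus (xi : V) (a : R) s0 e : 0 <= s0 -> 0 < e -> exists2 de, 0 < de &
  forall s, 0 <= s -> `|s - s0| <= de ->
    `|\int[mu]_x (u s (fc x) * cos (phase xi a (fc x))) -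
      \int[mu]_x (u s0 (fc x) * cos (phase xi a (fc x)))| <= e.
Proof.
move=> s00 e0; have [_ narrow _ _] := sol.
have bnd : exists K, forall x : V, `|cos (phase xi a x)| <= K.
  by exists 1 => x; exact: norm_cos_le1.
have c := narrow _ (@continuous_cos_phase xi a) bnd s0 s00.
pose J t := \int[mu]_x (u t (fc x) * cos (phase xi a (fc x))).
have JE t : 0 <= t -> intRd (fun x => (u t x * cos (phase xi a x))%:E) = (J t)%:E.
  move=> t0; apply: (integrable1_EFin (mu := mu)); apply: integrable1_mul_cos.
  exact: solution_integrable.
rewrite (JE _ s00) in c.
have c' : (fun t => fine (intRd (fun x => (u t x * cos (phase xi a x))%:E)))
    @ within [set t : R | 0 <= t] (nbhs s0) --> J s0 by exact: (fine_cvg c).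
have /cvgrPdist_le/(_ e e0) := c'; rewrite nearE /within /= => /nbhs_ballP[de /= de0 H].
(* Half the radius, since the ball is open and the modulus is stated with a large inequality. *)
exists (de / 2); first by rewrite divr_gt0.
move=> s s0' sde; rewrite distrC; have := H s _ s0'; rewrite JE //; apply.
rewrite /ball /= distrC; apply: (le_lt_trans sde); lra.
Qed.
End one_solution.

Variables (beta : R -> R) (b : V -> R -> V) (u0 : V -> R) (u1 u2 : R -> V -> R).
Hypotheses (sol1 : distr_solution beta b u0 u1) (sol2 : distr_solution beta b u0 u2).
Variables (U1 U2 : R -> X -> R) (T M C L gam : R).
Hypothesis cbeta : continuous beta.
Hypothesis cb : forall j, continuous (fun p : V * R => b p.1 p.2 0 j).
Hypotheses (mU1 : measurable_fun setT (fun p : RT * X => U1 p.1 p.2))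
  (mU2 : measurable_fun setT (fun p : RT * X => U2 p.1 p.2)).
Hypotheses (Uu1 : {ae LX, forall p : RT * X, 0 < p.1 < T -> U1 p.1 p.2 = u1 p.1 (fc p.2)})
  (Uu2 : {ae LX, forall p : RT * X, 0 < p.1 < T -> U2 p.1 p.2 = u2 p.1 (fc p.2)}).
Notation gap := (gap U1 U2).
Notation beta_gap := (beta_gap beta U1 U2).
Notation flux_gap := (flux_gap b U1 U2).
Hypotheses (T0 : 0 < T) (L0 : 0 <= L) (gam0 : 0 < gam).
Hypotheses (gapM : forall t x, `|gap t x| <= M) (gapi : forall t, integrable1 mu (gap t))
  (gapC : forall t, \int[mu]_x `|gap t x| <= C).
Hypotheses (betaL : forall t x, `|beta_gap t x| <= L * `|gap t x|)
  (fluxL : forall j t x, `|flux_gap j t x| <= L * `|gap t x|)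
  (beta_mono : forall t x, gam * gap t x ^+ 2 <= beta_gap t x * gap t x).

(** [dif] is formed from the solutions and makes sense at every t >= 0; [gap] is formed from the
    truncations and agrees with it only at almost every time. *)
Let dif t (x : X) : R := u1 t (fc x) - u2 t (fc x).
Let zeta (xi : V) a t : R := \int[mu]_x (dif t x * cos (phase xi a (fc x))).

Let dif_int t : 0 <= t -> integrable1 mu (dif t).
Proof. by move=> t0; apply: integrable1B; [exact: (solution_integrable sol1)|exact: (solution_integrable sol2)]. Qed.

Let zeta_gap : {ae leb, forall s, 0 < s < T -> forall xi a, gap_hat U1 U2 xi a s = zeta xi a s}.
Proof.
apply: aeS (ae_and (ae_sections1 Uu1) (ae_sections1 Uu2)) => s [h1 h2] sT xi a.
have s0 : 0 <= s by have /andP[/ltW] := sT.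
apply: Rint_ae.
- exact: integrable1_meas (integrable1_mul_cos xi a (gapi s)).
- exact: integrable1_meas (integrable1_mul_cos xi a (dif_int s0)).
- by apply: aeS (ae_and h1 h2) => x /= [e1 e2]; rewrite /gap e1 // e2.
Qed.

Let duhamel_zeta xi a t : 0 <= t <= T ->
  zeta xi a t = \int[leb]_s (ind t s * rhs_hat beta b U1 U2 xi a s).
Proof.
apply: (@weak_derivative_primitive R (gap_hat U1 U2 xi a) (rhs_hat beta b U1 U2 xi a) (zeta xi a) T C
  ((\sum_j xi 0 j ^+ 2) * (L * C) + \sum_j `|xi 0 j| * (L * C)) T0) => //.
- exact: measurable_gap_hat.
- exact: measurable_rhs_hat.
- by move=> s; exact: norm_gap_hat.
- by move=> s; exact: (norm_rhs_hat cbeta cb mU1 mU2 L0 gapi gapC betaL fluxL xi a s).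
- by apply: aeS zeta_gap => s h sT; exact: h.
- move=> s0 e s00 e0; have e20 : 0 < e / 2 by rewrite divr_gt0.
  have [d1 d10 h1] := solution_modulus sol1 xi a s00 e20.
  have [d2 d20 h2] := solution_modulus sol2 xi a s00 e20.
  exists (Num.min d1 d2); first by rewrite lt_min d10.
  move=> s s1; rewrite le_min => /andP[/(h1 _ s1) k1 /(h2 _ s1) k2].
  have E t' : 0 <= t' -> zeta xi a t' = \int[mu]_x (u1 t' (fc x) * cos (phase xi a (fc x))) -
      \int[mu]_x (u2 t' (fc x) * cos (phase xi a (fc x))).
    move=> t'0; rewrite -RintegralB //; last 2 first.
    + exact: integrable1_mul_cos (solution_integrable sol1 t'0).
    + exact: integrable1_mul_cos (solution_integrable sol2 t'0).
    by apply: eq_Rintegral => x _; rewrite /dif mulrBl.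
  rewrite !E //; move: k1 k2; rewrite !ler_norml => /andP[? ?] /andP[? ?].
  by apply/andP; split; lra.
- rewrite /zeta; have [_ _ _ i1] := sol1; have [_ _ _ i2] := sol2.
  rewrite -[RHS](_ : \int[mu]_x 0 = 0); last by rewrite /Rintegral integral0.
  apply: Rint_ae => //; first exact: integrable1_meas (integrable1_mul_cos xi a (dif_int (lexx 0))).
  by apply: aeS (ae_and i1 i2) => x [e1 e2]; rewrite /dif e1 e2 subrr mul0r.
- move=> th th' al be sth dth al0 beT th0.
  have weak (phi : R -> V -> R) (tphi : test_fun phi) vphi :=
    conj (weak_form_truncated cbeta cb sol1 mU1 Uu1 tphi vphi)
      (weak_form_truncated cbeta cb sol2 mU2 Uu2 tphi vphi).
  exact: (wave_identity cbeta cb mU1 mU2 (ltW T0) L0 gapi gapC betaL fluxL weak xi a sth dth al0 beT th0).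
Qed.

Lemma ae_neq (c : R) : {ae leb, forall s : RT, s <> c}.
Proof.
exists [set c]; split; [exact: measurable_set1|exact: lebesgue_measure_set1|].
by move=> s /= /contrapT.
Qed.

Theorem solutions_eq t : 0 <= t <= T -> aeRd (fun x => u1 t x = u2 t x).
Proof.
move=> tT; have t0 : 0 <= t by case/andP: tT.
(* Frequency space is a second copy of the physical space: a point [y] stands for the wave vector
   [fc y], and the abstract phase becomes the scalar product. *)
have mth : measurable_fun setT (fun p : X * X => dotn p.1 p.2) by exact: measurable_dotn.
have ph0 y x : phase (fc y) 0 (fc x) = dotn y x by rewrite /phase addr0.
have phs y x : phase (fc y) (- (pi / 2)) (fc x) = dotn y x - pi / 2 by [].
have cosE y x : cos (phase (fc y) (- (pi / 2)) (fc x)) = sin (dotn y x).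
  by rewrite phs cosB cos_pihalf sin_pihalf mulr0 add0r mulr1.
have sinE y x : sin (phase (fc y) (- (pi / 2)) (fc x)) = - cos (dotn y x).
  by rewrite phs sinB cos_pihalf sin_pihalf mulr0 sub0r mulr1.
have hcE f y : hc mu (@dotn R d) f y = \int[mu]_x (f x * cos (phase (fc y) 0 (fc x))).
  by apply: eq_Rintegral => x _; rewrite ph0.
have hsE f y : hs mu (@dotn R d) f y = \int[mu]_x (f x * cos (phase (fc y) (- (pi / 2)) (fc x))).
  by apply: eq_Rintegral => x _; rewrite cosE.
pose fr (j : 'I_d) (y : X) := co y j.
have rc y s : rhs_cos mu (@dotn R d) fr beta_gap flux_gap y s = rhs_hat beta b U1 U2 (fc y) 0 s.
  rewrite /rhs_cos /rhs_hat hcE; congr (_ - _); apply: eq_bigr => j _; congr (_ * _).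
  by apply: eq_Rintegral => x _; rewrite ph0.
have rs y s : rhs_sin mu (@dotn R d) fr beta_gap flux_gap y s =
    rhs_hat beta b U1 U2 (fc y) (- (pi / 2)) s.
  rewrite /rhs_sin /rhs_hat hsE; congr (_ + _).
  rewrite -sumrN; apply: eq_bigr => j _; rewrite -mulrN; congr (_ * _).
  rewrite -RintN; last exact: integrable1_mul_sin (integrable1_flux_gap cb mU1 mU2 gapi fluxL j s).
  by apply: eq_Rintegral => x _; rewrite sinE mulrN opprK.
pose W m : X -> R := weight (eps R m).
pose K m : X -> X -> R := kernel (eps R m).
have W0 m y : 0 <= W m y by exact: weight_ge0.
have Wi m : integrable1 mu (W m) by exact: integrable1_weight (eps_gt0 R m).
have Wle m y : W 0%N y <= W m y.
  by apply: weight_le; rewrite /eps lef_pV2 ?posrE ?ltr0n // ler_nat.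
have Wgt0 y : 0 < W 0%N y by exact: weight_gt0.
have Kk m : markov_kernel mu (K m) by exact: markov_kerneln (eps_gt0 R m).
have WK m x y : \int[mu]_z (W m z * cos (dotn z x - dotn z y)) = K m x y.
  have := weight_fourier x y 0 (eps_gt0 R m); rewrite cos0 mul1r /K => <-.
  by apply: eq_Rintegral => z _; rewrite add0r.
have Ka (f : X -> R) : measurable_fun setT f -> integrable1 mu (fun x => f x ^+ 2) ->
    approximable mu K f by exact: kernel_approximable.
have mfr j : measurable_fun setT (fr j) by exact: measurable_co.
have zprim : {ae leb, forall s, 0 <= s <= T -> forall y,
    hc mu (@dotn R d) (gap s) y = prim (rhs_cos mu (@dotn R d) fr beta_gap flux_gap) y s /\
    hs mu (@dotn R d) (gap s) y = prim (rhs_sin mu (@dotn R d) fr beta_gap flux_gap) y s}.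
  (* [zeta_gap] covers the open interval only, so the endpoints 0 and [T] are discarded as null
     sets. *)
  apply: aeS (ae_and (ae_and (ae_neq 0) (ae_neq T)) zeta_gap) => s [[s0 sT] h] s0T y.
  have s0T' : 0 < s < T.
    by case/andP: s0T => a1 a2; rewrite !lt_neqAle a1 a2 !andbT eq_sym; apply/andP; split; exact/eqP.
  rewrite hcE hsE; split.
    apply: (etrans (h s0T' (fc y) 0)); apply: (etrans (duhamel_zeta (fc y) 0 s0T)).
    by apply: eq_Rintegral => r _; rewrite rc.
  apply: (etrans (h s0T' (fc y) _)); apply: (etrans (duhamel_zeta (fc y) _ s0T)).
  by apply: eq_Rintegral => r _; rewrite rs.
have EV := energy_vanishes mth W0 Wi Wle Wgt0 Kk WK Ka mfr (measurable_gap mU1 mU2)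
  (measurable_beta_gap cbeta mU1 mU2) (measurable_flux_gap cb mU1 mU2) gapM gapi gapC L0 betaL fluxL
  gam0 beta_mono (ltW T0) zprim tT.
have d0 : {ae mu, forall x, dif t x = 0}.
  (* [energy_vanishes] kills the primitives at the given [t]. By [duhamel_zeta] these are the
     transforms of [dif t] itself, not merely of [gap] at almost every time. *)
  apply: (transform_inj mth W0 Wi Kk WK Ka (dif_int t0)).
  apply: aeS EV => y [e1 e2]; split.
    rewrite hcE; apply: (etrans (duhamel_zeta (fc y) 0 tT)); apply: etrans e1.
    by apply: eq_Rintegral => s _; rewrite rc.
  rewrite hsE; apply: (etrans (duhamel_zeta (fc y) _ tT)); apply: etrans e2.
  by apply: eq_Rintegral => s _; rewrite rs.
by apply: aeS d0 => x /eqP; rewrite subr_eq0 => /eqP.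
Qed.
End uniqueness.

Unset Implicit Arguments.
Theorem theorem2p1 (R : realType) (d : nat) (hd : (0 < d)%N) (T : R) (hT : 0 < T)
  (beta : R -> R) (b : 'rV[R]_d -> R -> 'rV[R]_d)
  (* (i) *)
  (hbeta0 : beta 0 = 0)
  (hbeta_der : forall r, derivable beta r 1)
  (hbeta_C1 : continuous (derive1 beta))
  (hbeta_mon : exists gamma0 : R, 0 < gamma0 /\
     forall r1 r2, gamma0 * (r1 - r2) ^+ 2 <= (beta r1 - beta r2) * (r1 - r2))
  (* (ii) *)
  (hb_Cb : forall i : 'I_d,
     continuous (fun p : 'rV[R]_d * R => b p.1 p.2 0 i) /\
     exists C : R, forall x r, `|b x r 0 i| <= C)
  (hb_C1 : forall i : 'I_d, C1 (fun r x => b x r 0 i))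
  (hb0 : forall (i : 'I_d) x, b x 0 0 i = 0)
  (hb_dr : forall M : R, 0 < M -> exists CM : R, forall (i : 'I_d) x r,
     `|r| <= M -> `|pd None (fun r' x' => b x' r' 0 i) r x| <= CM)
  (hdelta_fin : forall r, exists C : R, forall x, jac_norm b x r <= C)
  (hdelta_Cb : continuous (delta_b b) /\ exists K : R, forall r, `|delta_b b r| <= K) :
  forall u0 : 'rV[R]_d -> R,
    measRd u0 -> integrableRd u0 -> (exists M : R, aeRd (fun x => `|u0 x| <= M)) ->
  forall u1 u2 : R -> 'rV[R]_d -> R,
    distr_solution beta b u0 u1 -> sol_class T u1 ->
    distr_solution beta b u0 u2 -> sol_class T u2 ->
  forall t, 0 <= t <= T -> aeRd (fun x => u1 t x = u2 t x).
Proof.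
move=> u0 _ _ _ u1 u2 sol1 class1 sol2 class2.
have [gam [gam0 mono]] := hbeta_mon.
have cbeta : continuous beta.
  by move=> r; apply/differentiable_continuous/derivable1_diffP; exact: hbeta_der.
have cb j : continuous (fun p : 'rV[R]_d * R => b p.1 p.2 0 j) := (hb_Cb j).1.
have meas u : distr_solution beta b u0 u -> forall t, 0 <= t -> measRd (u t).
  by move=> [h _ _ _] t t0; have [] := h t t0.
have [U1 [M1 [C1 [mU1 U1M U1i U1C Uu1]]]] := truncation (meas _ sol1) class1.
have [U2 [M2 [C2 [mU2 U2M U2i U2C Uu2]]]] := truncation (meas _ sol2) class2.
(* A point of the space is needed to read off that the sup bounds are nonnegative. *)
have x0 : mT (lebn R d) by exact: point.
have M10 : 0 <= M1 by exact: le_trans (U1M 0 x0).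
have M20 : 0 <= M2 by exact: le_trans (U2M 0 x0).
(* The summand 1 makes [M] positive, as [hb_dr] demands. *)
pose M := M1 + M2 + 1; have M0 : 0 < M by rewrite ltr_wpDl ?addr_ge0.
have U1b t x : `|U1 t x| <= M by apply: (le_trans (U1M t x)); rewrite /M; lra.
have U2b t x : `|U2 t x| <= M by apply: (le_trans (U2M t x)); rewrite /M; lra.
have [Lb betaL] := continuous_bounded_ball M hbeta_C1.
have [CM bL] := hb_dr M M0.
have zM : `|0 : R| <= M by rewrite normr0 ltW.
have Lb0 : 0 <= Lb := le_trans (normr_ge0 _) (betaL 0 zM).
have CM0 : 0 <= CM := le_trans (normr_ge0 _) (bL (Ordinal hd) 0 0 zM).
have b_lip j x r1 r2 : `|r1| <= M -> `|r2| <= M -> `|b x r1 0 j - b x r2 0 j| <= CM * `|r1 - r2|.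
  apply: (@derive1_bound_lipschitz _ (fun r => b x r 0 j)) => [r|r rM]; last exact: bL.
  by have [_ /(_ None)[+ _]] := hb_C1 j; exact.
(* [Lb] is a Lipschitz constant of [beta] on [-M, M], and 2 CM M is one of the flux r -> b(x, r) r
   there. *)
have L0 : 0 <= Lb + 2 * CM * M by rewrite addr_ge0 // mulr_ge0 ?(ltW M0) // mulr_ge0.
apply: (solutions_eq (L := Lb + 2 * CM * M) sol1 sol2 cbeta cb mU1 mU2 Uu1 Uu2 hT L0 gam0).
- by move=> t x; apply: (le_trans (ler_normB _ _)); exact: lerD (U1M t x) (U2M t x).
- by move=> t; exact: integrable1B (U1i t) (U2i t).
- move=> t; have i1 := integrable1_norm (U1i t); have i2 := integrable1_norm (U2i t).
  apply: (@le_trans _ _ (\int[Leb R d]_x (`|U1 t x| + `|U2 t x|))).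
    apply: Rint_le; last by move=> x; exact: ler_normB.
    - by apply: integrable1_norm; exact: integrable1B.
    - exact: integrable1D.
  by rewrite RintegralD //; exact: lerD.
- move=> t x; apply: (@le_trans _ _ (Lb * `|U1 t x - U2 t x|)).
    exact: (derive1_bound_lipschitz hbeta_der betaL).
  by rewrite ler_wpM2r // lerDl mulr_ge0 ?(ltW M0) // mulr_ge0.
- move=> j t x; rewrite /flux_gap /flux; set y := fromcoord x; set r1 := U1 t x; set r2 := U2 t x.
  (* Inserting b(y, 0) = 0 bounds the second factor by CM |r2|, so each of the two products is at
     most CM M |r1 - r2|. *)
  have -> : b y r1 0 j * r1 - b y r2 0 j * r2 =
    (b y r1 0 j - b y r2 0 j) * r1 + (b y r2 0 j - b y 0 0 j) * (r1 - r2) by rewrite hb0; ring.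
  have k1 := b_lip j y _ _ (U1b t x) (U2b t x).
  have k2 := b_lip j y _ _ (U2b t x) zM.
  apply: (@le_trans _ _ (CM * `|r1 - r2| * M + CM * M * `|r1 - r2|)).
    apply: (le_trans (ler_normD _ _)); rewrite !normrM; apply: lerD.
      by rewrite ler_pM // U1b.
    rewrite ler_wpM2r //; apply: (le_trans k2); rewrite subr0 ler_wpM2l //; exact: U2b.
  rewrite /gap -/r1 -/r2; have n0 := normr_ge0 (r1 - r2).
  have := mulr_ge0 Lb0 n0; move: (`|r1 - r2|) => n; nra.
- by move=> t x; exact: mono.
Qed.
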